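(* Let $\Omega\subset\mathbb{R}^n$ be a bounded open set and let $p\colon\mathbb{R}^n\to[1,\infty)$ be a $C^1$ function with $1<\inf_\Omega p\le\sup_\Omega p<\infty$. If a function $u\in C^1(\Omega)$ is a weak solution of $-\Delta_{p(x)}u=0$ in $\Omega\setminus\{x:u(x)=0\}$, then $u$ is a weak solution of $-\Delta_{p(x)}u=0$ in all of $\Omega$.
   Context: $\Delta_{p(x)}u=\operatorname{div}(|Du|^{p(x)-2}Du)$. A weak solution in an open set $U$ is $u\in W^{1,p(x)}_{loc}(U)$ (variable exponent Sobolev space: $\int_K|u|^{p(x)}+|Du|^{p(x)}<\infty$ for compact $K\subset U$) with $\int_U|Du|^{p(x)-2}Du\cdot D\varphi\,dx=0$ for all $\varphi\in C_0^\infty(U)$. *)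

(* Defs.v *)
From HB Require Import structures.
From mathcomp Require Import all_boot all_order all_algebra.
From mathcomp Require Import all_classical all_reals all_analysis.
Set Implicit Arguments. Unset Strict Implicit. Unset Printing Implicit Defensive.
Import Order.TTheory GRing.Theory Num.Theory.
Import numFieldNormedType.Exports.
Local Open Scope classical_set_scope.
Local Open Scope ring_scope.

Section PLaplace.
Variables (R : realType) (n : nat).
Local Notation Rn := 'rV[R]_n.

Definition ebasis (i : 'I_n) : Rn := delta_mx 0 i.

Definition partial (i : 'I_n) (f : Rn -> R) : Rn -> R :=
  fun x => 'D_(ebasis i) f x.

Definition grad (f : Rn -> R) (x : Rn) : Rn := \row_i partial i f x.

Definition dotRn (v w : Rn) : R := \sum_i v 0 i * w 0 i.
Definition enorm (v : Rn) : R := Num.sqrt (dotRn v v).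

Definition C1_on (f : Rn -> R) (U : set Rn) : Prop :=
  forall i : 'I_n,
    (forall x, U x -> derivable f x (ebasis i)) /\
    (forall x, U x -> {for x, continuous (partial i f)}).

Fixpoint iter_partial (s : seq 'I_n) (f : Rn -> R) : Rn -> R :=
  match s with
  | [::] => f
  | i :: s' => partial i (iter_partial s' f)
  end.

Definition smooth (f : Rn -> R) : Prop :=
  forall s : seq 'I_n,
    continuous (iter_partial s f) /\
    (forall i x, derivable (iter_partial s f) x (ebasis i)).

Definition support (f : Rn -> R) : set Rn := closure [set x | f x != 0].

Definition test_fun (U : set Rn) (phi : Rn -> R) : Prop :=
  smooth phi /\ compact (support phi) /\ support phi `<=` U.

End PLaplace.

(* Lebesgue integral over R^n, written as the iterated one-dimensional
   Lebesgue integral (R^{m+1} = R x R^m). *)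
Fixpoint intRn (R : realType) (n : nat) : ('rV[R]_n -> \bar R) -> \bar R :=
  match n with
  | 0 => fun f => f 0
  | m.+1 => fun f =>
      (\int[@lebesgue_measure R]_(t in [set: R])
          @intRn R m (fun y => f (row_mx (const_mx t : 'rV[R]_1) y)))%E
  end.

Definition intRn_on (R : realType) (n : nat) (A : set 'rV[R]_n)
  (f : 'rV[R]_n -> \bar R) : \bar R :=
  intRn (fun x => if x \in A then f x else 0%E).

(* u (of class C^1, so its weak gradient is its classical gradient) is a
   weak solution of -div(|Du|^{p(x)-2} Du) = 0 in the open set U:
   u \in W^{1,p(x)}_loc(U) and the weak equation holds for all test functions *)
Definition weak_solution (R : realType) (n : nat) (p : 'rV[R]_n -> R)
  (u : 'rV[R]_n -> R) (U : set 'rV[R]_n) : Prop :=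
  (forall K, compact K -> K `<=` U ->
     (intRn_on K (fun x => (powR `|u x| (p x)
                            + powR (enorm (grad u x)) (p x))%:E) < +oo)%E) /\
  (forall phi, test_fun U phi ->
     intRn_on U (fun x => (powR (enorm (grad u x)) (p x - 2)
                           * dotRn (grad u x) (grad phi x))%:E) = 0%E).

(* Main.v *)
(* Write [F = |Du|^(p-2) Du] and let [N] be a C^1 step, [0] below [1] and [1] above [2].  By a cut-off
   and mollification one may take [u], [p] globally nice and C^1 test functions [f].

   Regular points of the zero set.  Where [Du <> 0], testing with [f N(u^2/eps^2)] is allowed, and
   [f F] is uniformly close to a C^1 field [Y].  The layer estimate
   [int z / (1 + (u/eps)^2) <= C eps], obtained by integrating [D(atan(u/eps))] against a field
   transversal to the level sets, makes every error term vanish with [eps]; so [div F = 0] on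
   [{Du <> 0}].

   Critical points.  Let [w_k] be the difference quotients of [u], [lam = |w|^2], and subtract the
   equation from its translates.  Testing with [z^2 g(lam) w_k], where [g(lam) = lam^(-beta)] cut off
   below [delta^2] and [2 beta < 1], bounds [int z^2 g(lam) |w|^(p-2) |Dw|^2] uniformly in [delta]
   (the step of the difference quotients being small depending on [delta]); ellipticity absorbs
   the derivative of [g] because [lam g' >= - beta g].  Finally test with [f N(lam/delta^2)]:
   by Cauchy-Schwarz, [F . D(N(lam/delta^2))] is controlled by a small multiple of that energy plus
   a term [lam^((p-2)/2 + beta)], which tends to [0] on [{lam <= 2 delta^2}] as soon as
   [2 beta > 2 - c], where [c = inf p > 1]. *)

Require Import Defs.
From HB Require Import structures.
From mathcomp Require Import all_boot all_order all_algebra.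
From mathcomp Require Import all_classical all_reals all_analysis.
From mathcomp Require Import ring lra.
Import Order.TTheory GRing.Theory Num.Theory.
Import numFieldNormedType.Exports.
Local Open Scope classical_set_scope.
Local Open Scope ring_scope.
Set Implicit Arguments. Unset Strict Implicit. Unset Printing Implicit Defensive.

(** * C^1 functions on R^n *)

(** The exponents allowed are [2 - c < 2 beta < 1], a non-empty interval exactly because [c > 1].
    The upper end does not depend on [p]: differentiating [g(lam)] costs at most [2 beta] times the
    good term, since the square root of the linearized operator acts on one index of the matrix [Dw]
    and the contraction with [w] on the other.

    The order of the choices shapes the second stage. As [u] need not have second derivatives,
    linearizing [F] along a difference quotient leaves an error [tau |Dw|] that carries no weight,
    and [tau] is small only for steps that are small depending on [delta]. A cruder bound on the
    unweighted energy away from the critical points, which may blow up as [delta] decreases, is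
    proved beforehand, and [tau] is chosen against it. The other error, due to the variation of [p],
    has to be bounded uniformly in [delta]: it contains [|ln lam|], which a small power of [lam]
    pays for.

    Integrals are iterated one-dimensional ones, so almost everything is reduced to continuous
    functions of bounded support, and energy bounds are stated for arbitrary continuous
    minorants. *)

Lemma finite_uniform (R : realFieldType) (I : finType) (P : I -> R -> Prop) :
  (forall i d d', d' <= d -> P i d -> P i d') -> (forall i, exists2 d : R, 0 < d & P i d) ->
  exists2 d : R, 0 < d & forall i, P i d.
Proof.
move=> mono H; have : forall s : seq I, exists2 d : R, 0 < d & forall i, i \in s -> P i d.
  elim=> [|j s [d d0 Hd]]; first by exists 1.
  have [d' d'0 Hd'] := H j; exists (Num.min d d'); first by rewrite lt_min d0.
  move=> i; rewrite inE => /orP[/eqP ->|/Hd].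
    by apply: mono Hd'; rewrite ge_min lexx orbT.
  by apply: mono; rewrite ge_min lexx.
by move=> /(_ (enum I))[d d0 Hd]; exists d => // i; apply: Hd; exact: mem_enum.
Qed.

Lemma sum_ord_const (R : pzRingType) n (a : R) : \sum_(i < n) a = n%:R * a.
Proof. by rewrite sumr_const card_ord mulr_natl. Qed.

Section Norm.
Variables (R : realType) (n : nat).
Implicit Types (x y v : 'rV[R]_n) (f g : 'rV[R]_n -> R).

Lemma norm_coord v i : `|v 0 i| <= `|v|.
Proof.
rewrite [leRHS]/Num.norm /= mx_normrE.
exact: (le_bigmax _ (fun ij => `|v ij.1 ij.2|) (0, i)).
Qed.

Lemma norm_rV_le v (r : R) : 0 <= r -> (forall i, `|v 0 i| <= r) -> `|v| <= r.
Proof.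
move=> r0 H; rewrite [leLHS]/Num.norm /= mx_normrE; apply/bigmax_leP; split => //=.
by move=> [a b] _ /=; rewrite (ord1 a).
Qed.

Lemma norm_ebasis_le (i : 'I_n) : `|ebasis R i| <= 1.
Proof.
apply: norm_rV_le => // j; rewrite /ebasis mxE eqxx /=.
by case: (j == i); rewrite ?normr1 ?normr0.
Qed.

Lemma norm_scale_ebasis_le (h : R) (i : 'I_n) : `|h *: ebasis R i| <= `|h|.
Proof. by rewrite normrZ ler_piMr // norm_ebasis_le. Qed.

Lemma near_norm_lt x (d : R) : 0 < d -> nbhs x [set x' | `|x - x'| < d].
Proof. by move=> d0; have := nbhsx_ballx x d d0; rewrite -ball_normE. Qed.

Lemma near_norm_ex x (P : set 'rV[R]_n) :
  nbhs x P -> exists2 d : R, 0 < d & forall y, `|x - y| < d -> P y.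
Proof.
by move=> /nbhs_ballP[d /= d0 Hd]; exists d => // y xy; apply: Hd; rewrite -ball_normE.
Qed.

Variant bsupp f : Prop := Bsupp (r : R) of (forall x, r < `|x| -> f x = 0).

Lemma ball_compact (r : R) : compact [set x : 'rV[R]_n | `|x| <= r].
Proof.
apply: bounded_closed_compact.
  by exists r; split; [exact: num_real|move=> y ry x /= /le_trans ->//; exact: ltW].
rewrite (_ : [set x | _] = (fun x : 'rV[R]_n => `|x|) @^-1` [set r' | r' <= r]) //.
apply: preimage_closed; last exact: closed_le.
by move=> x _; apply: norm_continuous.
Qed.

Lemma uniform_cont f : continuous f -> bsupp f -> forall e : R, 0 < e ->
  exists2 d : R, 0 < d & forall x y, `|x - y| <= d -> `|f x - f y| <= e.
Proof.
move=> cf [r fr] e e0.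
have /compact_near_coveringP/(_ R 0^'+
  (fun d x => forall y, `|x - y| <= d -> `|f x - f y| <= e)) := @ball_compact (r + 1).
case.
  move=> x _.
  have e20 : 0 < e / 2 by rewrite divr_gt0.
  have /cvgrPdist_le/(_ _ e20)/nbhs_normP[d /= d0 Hd] := cf x.
  have d20 : 0 < d / 2 by rewrite divr_gt0.
  exists ([set x' | `|x - x'| < d / 2], [set d' : R | d' < d / 2]) => /=.
    split; first exact: near_norm_lt.
    exact: nbhs_right_lt.
  move=> [x' d'] /= [xx' d'd] y x'y.
  rewrite [e]splitr -(subrKA (f x)) (le_trans (ler_normD _ _))// lerD//.
    by rewrite distrC; apply: Hd => /=; rewrite (lt_le_trans xx')//; lra.
  apply: Hd => /=; rewrite [d]splitr -(subrKA x') (le_lt_trans (ler_normD _ _))// ltrD//.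
  by rewrite (le_lt_trans x'y).
move=> d /= d0 Hd.
(* The cap [1] matches the radius [r + 1] of the covered ball: a point beyond it has all its
   [D]-neighbours beyond [r], where [f] vanishes. *)
pose D := Num.min (d / 2) 1.
have D0 : 0 < D by rewrite lt_min divr_gt0 //= ltr01.
have Dd : D < d by rewrite gt_min ltr_pdivrMr // ltr_pMr // ltr1n.
exists D => // x y xy.
have [xr|xr] := leP `|x| (r + 1).
  apply: (Hd D) => //=.
  by rewrite sub0r normrN gtr0_norm.
rewrite !fr ?subrr ?normr0 ?(ltW e0)//; last by rewrite (lt_trans _ xr)// ltrDl.
have : `|x| <= `|x - y| + `|y| by rewrite -{1}(subrK y x) ler_normD.
have : D <= 1 by rewrite ge_min lexx orbT.
lra.
Qed.

End Norm.

Section Derive.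
Variables (R : realType) (V : normedModType R).
Implicit Types (f g : V -> R) (x v : V).

Lemma line_quotient f x v (t : R) :
  (fun h : R => h^-1 *: (((fun t => f (x + t *: v)) \o shift t) (h *: (1:R)) - f (x + t *: v)))
  = (fun h => h^-1 *: ((f \o shift (x + t *: v)) (h *: v) - f (x + t *: v))).
Proof.
apply/funext => h /=; congr (_ *: (f _ - _)).
by rewrite scalerDl addrCA /GRing.scale /= mulr1.
Qed.

Lemma is_derive_line f x v (t l : R) :
  is_derive (x + t *: v) v f l <-> is_derive t (1:R) (fun t => f (x + t *: v)) l.
Proof.
have E := line_quotient f x v t.
split=> -[Hd Hl]; split.
- by move: Hd; rewrite /derivable E.
- by move: Hl; rewrite /derive E.
- by move: Hd; rewrite /derivable E.
- by move: Hl; rewrite /derive E.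
Qed.

(** C^1 regularity is expressed by directional derivatives, so the chain rule is obtained by
    restriction to the line through [x]. *)
Lemma is_derive_comp1 f x v (h : R -> R) (df dh : R) :
  is_derive x v f df -> is_derive (f x) (1:R) h dh ->
  is_derive x v (fun y => h (f y)) (dh * df).
Proof.
move=> Hf Hh.
have E : x = x + 0 *: v by rewrite scale0r addr0.
rewrite E; apply/(is_derive_line (fun y => h (f y))).
have Hf' : is_derive (0:R) (1:R) (fun t => f (x + t *: v)) df.
  by apply/is_derive_line; rewrite scale0r addr0.
rewrite -[_ * _]/(dh *: df).
apply: (@is_derive1_comp R h (fun t => f (x + t *: v)) 0 dh df) => //.
by rewrite -E.
Qed.

Lemma mvt_line f (df : V -> R) x v (h : R) :
  (forall t, `|t| <= `|h| -> is_derive (x + t *: v) v f (df (x + t *: v))) ->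
  exists2 t, `|t| <= `|h| & f (x + h *: v) - f x = h * df (x + t *: v).
Proof.
move=> Hd.
pose F t := f (x + t *: v); pose dF t := df (x + t *: v).
have HF t : `|t| <= `|h| -> is_derive t (1:R) F (dF t).
  by move=> th; apply/is_derive_line; exact: Hd.
have F0 : F 0 = f x by rewrite /F scale0r addr0.
have [h0|h0] := leP 0 h.
  have [||c] := @MVT_segment R F dF 0 h h0.
  - move=> t; rewrite in_itv /= => /andP[t0 th]; apply: HF.
    by rewrite !ger0_norm // ltW.
  - apply: derivable_within_continuous => t; rewrite in_itv /= => /andP[t0 th].
    by have [] : is_derive t (1:R) F (dF t) by apply: HF; rewrite !ger0_norm.
  rewrite in_itv /= => /andP[c0 ch]; rewrite F0 subr0 => E.
  by exists c; [rewrite !ger0_norm|rewrite -/(F h) E mulrC].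
have [||c] := @MVT_segment R F dF h 0 (ltW h0).
- move=> t; rewrite in_itv /= => /andP[t0 th]; apply: HF.
  by rewrite (ltr0_norm h0) (ltr0_norm th) lerN2 ltW.
- apply: derivable_within_continuous => t; rewrite in_itv /= => /andP[t0 th].
  by have [] : is_derive t (1:R) F (dF t) by apply: HF; rewrite (ltr0_norm h0) (ler0_norm th) lerN2.
rewrite in_itv /= => /andP[c0 ch]; rewrite F0 sub0r => E.
exists c; first by rewrite (ltr0_norm h0) (ler0_norm ch) lerN2.
by rewrite -/(F h) -opprB E mulrN opprK mulrC.
Qed.

Lemma is_derive_translate f x v w (l : R) :
  is_derive (x + w) v f l -> is_derive x v (fun y => f (y + w)) l.
Proof.
have E : (fun h : R => h^-1 *: (((fun y => f (y + w)) \o shift x) (h *: v) - f (x + w)))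
  = (fun h => h^-1 *: ((f \o shift (x + w)) (h *: v) - f (x + w))).
  by apply/funext => h /=; rewrite addrA.
by move=> [Hd Hl]; split; [move: Hd|move: Hl]; rewrite /derivable /derive E.
Qed.

End Derive.

Section Continuity.
Variables (R : realType).

Lemma cont_add (T : topologicalType) (f g : T -> R) : continuous f -> continuous g -> continuous (fun x => f x + g x).
Proof. by move=> cf cg x; apply: cvgD; [exact: cf|exact: cg]. Qed.
Lemma cont_sub (T : topologicalType) (f g : T -> R) : continuous f -> continuous g -> continuous (fun x => f x - g x).
Proof. by move=> cf cg x; apply: cvgB; [exact: cf|exact: cg]. Qed.
Lemma cont_mul (T : topologicalType) (f g : T -> R) : continuous f -> continuous g -> continuous (fun x => f x * g x).
Proof. by move=> cf cg x; apply: cvgM; [exact: cf|exact: cg]. Qed.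
Lemma cont_opp (T : topologicalType) (f : T -> R) : continuous f -> continuous (fun x => - f x).
Proof. by move=> cf x; apply: cvgN; exact: cf. Qed.
Lemma cont_exp (T : topologicalType) (f : T -> R) k : continuous f -> continuous (fun x => f x ^+ k).
Proof.
move=> cf; elim: k => [|k IH]; first exact: cst_continuous.
by under eq_fun do rewrite exprS; exact: cont_mul.
Qed.
Lemma cont_norm (T : topologicalType) (f : T -> R) : continuous f -> continuous (fun x => `|f x|).
Proof. by move=> cf x; apply: cvg_norm; exact: cf. Qed.
Lemma cont_comp (T : topologicalType) (f : T -> R) (h : R -> R) :
  continuous f -> continuous h -> continuous (fun x => h (f x)).
Proof. by move=> cf ch x; apply: (@continuous_comp _ _ _ f h); [exact: cf|exact: ch]. Qed.
Lemma cont_sum (T : topologicalType) (I : Type) (s : seq I) (F : I -> T -> R) :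
  (forall k, continuous (F k)) -> continuous (fun x => \sum_(k <- s) F k x).
Proof.
move=> HF; elim: s => [|k s IH].
  by under eq_fun do rewrite big_nil; exact: cst_continuous.
by under eq_fun do rewrite big_cons; exact: cont_add.
Qed.
Lemma cont_max (T : topologicalType) (f g : T -> R) :
  continuous f -> continuous g -> continuous (fun x => Num.max (f x) (g x)).
Proof.
move=> cf cg; under eq_fun do rewrite maxr_absE.
apply: cont_mul; last exact: cst_continuous.
by apply: cont_add; [exact: cont_add|apply: cont_norm; exact: cont_sub].
Qed.
Lemma cont_addv (V : normedModType R) (v : V) : continuous (fun x : V => x + v).
Proof. by move=> x; apply: cvgD; [exact: cvg_id|exact: cvg_cst]. Qed.
Lemma cont_translate (V : normedModType R) (T : topologicalType) (f : V -> T) (v : V) :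
  continuous f -> continuous (fun x => f (x + v)).
Proof.
move=> cf x; apply: (@continuous_comp _ _ _ (fun x => x + v) f); last exact: cf.
exact: cont_addv.
Qed.

Lemma eps_delta_continuous (V : normedModType R) (f : V -> R) (x : V) :
  (forall e : R, 0 < e -> exists2 d : R, 0 < d & forall y, `|x - y| < d -> `|f x - f y| <= e) ->
  {for x, continuous f}.
Proof.
move=> H; apply/cvgrPdist_le => e e0; have [d d0 Hd] := H e e0.
by have := nbhsx_ballx x d d0; rewrite -ball_normE; apply: filterS => y; exact: Hd.
Qed.

Lemma continuous_eps_delta (V : normedModType R) (f : V -> R) (x : V) : {for x, continuous f} ->
  forall e : R, 0 < e -> exists2 d : R, 0 < d & forall y, `|x - y| < d -> `|f x - f y| < e.
Proof.
move=> /cvgrPdist_lt H e e0.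
have /nbhs_ballP[d d0 Hd] := H e e0.
by exists d => // y xy; apply: Hd; rewrite -ball_normE.
Qed.
End Continuity.

Section C1.
Variables (R : realType) (n : nat).
Local Notation X := 'rV[R]_n.
Implicit Types (x y v : X) (f g : X -> R).

(** The points [z k] replace the coordinates of [x] by those of [y] one at a time. In the sup norm
    they all stay in the ball, so the mean value theorem applies on each axis-parallel segment; the
    [n] segments give the factor [n]. *)
Lemma lip_ball f (df : 'I_n -> X -> R) x (r M : R) : 0 <= M ->
  (forall y i, `|y - x| <= r -> is_derive y (ebasis R i) f (df i y)) ->
  (forall y i, `|y - x| <= r -> `|df i y| <= M) ->
  forall y, `|y - x| <= r -> `|f y - f x| <= n%:R * M * `|y - x|.
Proof.
move=> M0 Hd HM y yr.
pose z (k : nat) : X := \row_i (if (i < k)%N then y 0 i else x 0 i).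
have zE : forall k, (k <= n)%N -> `|f (z k) - f x| <= k%:R * M * `|y - x|.
  elim=> [|k IH] kn.
    rewrite (_ : z 0%N = x) ?subrr ?normr0 ?mul0r //.
    by apply/rowP => i; rewrite mxE.
  pose i0 := Ordinal kn.
  have zS : z k.+1 = z k + (y 0 i0 - x 0 i0) *: ebasis R i0.
    apply/rowP => i; rewrite !mxE eqxx /= ltnS leq_eqVlt.
    have [->|ne] := eqVneq i i0; first by rewrite /= eqxx ltnn /= mulr1 addrC subrK.
    have -> : (i == k :> nat) = false by apply/negbTE; apply: contra ne => /eqP E; apply/eqP/val_inj.
    by rewrite mulr0 addr0.
  have path t : `|t| <= `|y 0 i0 - x 0 i0| -> `|z k + t *: ebasis R i0 - x| <= `|y - x|.
    move=> ht; apply: norm_rV_le => // i; rewrite !mxE eqxx /=.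
    have [->|ne] := eqVneq i i0.
      rewrite /= ltnn mulr1 addrAC subrr add0r (le_trans ht) //.
      by have := norm_coord (y - x) i0; rewrite !mxE.
    rewrite mulr0 addr0; case: ifP => _; last by rewrite subrr normr0.
    by have := norm_coord (y - x) i; rewrite !mxE.
  have [t ht E] := @mvt_line R X f (df i0) (z k) (ebasis R i0) (y 0 i0 - x 0 i0)
     (fun t ht => Hd _ _ (le_trans (path t ht) yr)).
  rewrite -(subrKA (f (z k))) (le_trans (ler_normD _ _)) // -natr1 !mulrDl mul1r addrC.
  rewrite lerD // ?IH 1?ltnW // zS E normrM mulrC ler_pM //.
    by apply: HM; apply: le_trans yr; exact: path.
  by have := norm_coord (y - x) i0; rewrite !mxE.
have := zE n (leqnn _); rewrite (_ : z n = y) //.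
by apply/rowP => i; rewrite mxE ltn_ord.
Qed.

(** [C1_on] speaks only of partial derivatives. Being continuous, they are bounded near [x], and
    [lip_ball] then bounds [f y - f x] by a multiple of [|y - x|]. *)
Lemma C1_on_cont f (U : set X) : open U -> C1_on f U ->
  forall x, U x -> {for x, continuous f}.
Proof.
move=> oU fU x Ux.
have H1 : \forall y \near x, U y by exact: open_nbhs_nbhs.
have H2 : \forall y \near x, forall i, `|partial i f x - partial i f y| < 1.
  apply: (@filter_forall X 'I_n (fun i y => `|partial i f x - partial i f y| < 1) (nbhs x)) => i.
  by have [_ /(_ x Ux)/cvgrPdist_lt/(_ 1 ltr01)] := fU i.
have [d d0 Hdd] := near_norm_ex (filterI H1 H2).
pose M : R := \sum_i (`|partial i f x| + 1).
have M0 : 0 <= M by apply: sumr_ge0 => i _; rewrite addr_ge0.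
have hd y : `|y - x| <= d / 2 -> `|x - y| < d by rewrite distrC; lra.
have L : forall y, `|y - x| <= d / 2 -> `|f y - f x| <= n%:R * M * `|y - x|.
  apply: (@lip_ball f (fun i => partial i f)) => // y i yd.
    have [Uy _] := Hdd y (hd y yd).
    by apply: DeriveDef => //; exact: (fU i).1.
  have [_ /(_ i) B] := Hdd y (hd y yd).
  apply: (@le_trans _ _ (`|partial i f x| + 1)).
    have := ler_normB (partial i f x) (partial i f x - partial i f y); rewrite opprB addrC subrK; lra.
  by rewrite /M (bigD1 i) //= lerDl sumr_ge0 // => j _; rewrite addr_ge0.
have P : 0 < n%:R * M + 1 by rewrite ltr_wpDl // mulr_ge0.
apply: (@eps_delta_continuous R X) => e e0.
exists (Num.min (d / 2) (e / (n%:R * M + 1))).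
  by rewrite lt_min !divr_gt0.
move=> y; rewrite lt_min => /andP[yd ye].
rewrite distrC (le_trans (L y _)) //; first by rewrite distrC ltW.
rewrite distrC; apply: (@le_trans _ _ ((n%:R * M + 1) * `|x - y|)); first by rewrite ler_wpM2r // lerDl.
by rewrite mulrC -ler_pdivlMr // ltW.
Qed.

Record C1 f : Prop := MkC1 {
  C1_cont : continuous f;
  C1_partials : forall i : 'I_n,
    (forall x, is_derive x (ebasis R i) f (partial i f x)) /\ continuous (partial i f)
}.

Lemma C1_of f (df : 'I_n -> X -> R) :
  continuous f -> (forall i x, is_derive x (ebasis R i) f (df i x)) ->
  (forall i, continuous (df i)) -> C1 f /\ forall i, partial i f = df i.
Proof.
move=> cf Hd cd.
have E i : partial i f = df i by apply/funext => x; rewrite /partial derive_val.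
by split => //; split => // i; rewrite E.
Qed.

Lemma C1_is_derive f i x : C1 f -> is_derive x (ebasis R i) f (partial i f x).
Proof. by move=> [_ /(_ i)[]]. Qed.

Lemma C1_partial_cont f i : C1 f -> continuous (partial i f).
Proof. by move=> [_ /(_ i)[]]. Qed.

Lemma C1_cst (c : R) : C1 (fun=> c) /\ forall i : 'I_n, partial i (fun=> c) = (fun=> 0).
Proof. by apply: (@C1_of _ (fun _ _ => 0)) => [|i]; exact: cst_continuous. Qed.

Lemma C1_add f g : C1 f -> C1 g -> C1 (fun x => f x + g x) /\
  forall i, partial i (fun x => f x + g x) = (fun x => partial i f x + partial i g x).
Proof.
move=> Hf Hg; apply: C1_of => [|i x|i].
- by apply: cont_add; exact: C1_cont.
- by apply: is_deriveD; exact: C1_is_derive.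
- by apply: cont_add; exact: C1_partial_cont.
Qed.

Lemma C1_mul f g : C1 f -> C1 g -> C1 (fun x => f x * g x) /\
  forall i, partial i (fun x => f x * g x) = (fun x => partial i f x * g x + f x * partial i g x).
Proof.
move=> Hf Hg; apply: C1_of => [|i x|i].
- by apply: cont_mul; exact: C1_cont.
- rewrite addrC [_ * g x]mulrC; exact: (is_deriveM (C1_is_derive i x Hf) (C1_is_derive i x Hg)).
- by apply: cont_add; apply: cont_mul; solve [exact: C1_partial_cont|exact: C1_cont].
Qed.

Lemma C1_comp f (h dh : R -> R) : C1 f ->
  (forall t, is_derive t (1:R) h (dh t)) -> continuous dh -> C1 (fun x => h (f x)) /\
  forall i, partial i (fun x => h (f x)) = (fun x => dh (f x) * partial i f x).
Proof.
move=> Hf Hh ch.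
have cth : continuous h.
  by move=> t; apply/differentiable_continuous/derivable1_diffP; case: (Hh t).
apply: C1_of => [|i x|i].
- exact: (cont_comp (C1_cont Hf) cth).
- exact: (is_derive_comp1 (C1_is_derive i x Hf) (Hh _)).
- apply: cont_mul; last exact: C1_partial_cont.
  exact: (cont_comp (C1_cont Hf) ch).
Qed.

Lemma C1_translate f v : C1 f -> C1 (fun x => f (x + v)) /\
  forall i, partial i (fun x => f (x + v)) = (fun x => partial i f (x + v)).
Proof.
move=> Hf; apply: C1_of => [|i x|i].
- by apply: (@cont_translate _ X); exact: C1_cont.
- by apply: is_derive_translate; exact: C1_is_derive.
- by apply: (@cont_translate _ X); exact: C1_partial_cont.
Qed.

Lemma C1_scale f (c : R) : C1 f -> C1 (fun x => c * f x) /\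
  forall i, partial i (fun x => c * f x) = (fun x => c * partial i f x).
Proof.
move=> Hf; have [Hc Ec] := C1_cst c; have [H E] := C1_mul Hc Hf; split => // i.
by rewrite E Ec; apply/funext => x; rewrite mul0r add0r.
Qed.

Lemma C1_sub f g : C1 f -> C1 g -> C1 (fun x => f x - g x) /\
  forall i, partial i (fun x => f x - g x) = (fun x => partial i f x - partial i g x).
Proof.
move=> Hf Hg; apply: C1_of => [|i x|i].
- by apply: cont_sub; exact: C1_cont.
- by apply: is_deriveB; exact: C1_is_derive.
- by apply: cont_sub; exact: C1_partial_cont.
Qed.

Lemma C1_sum (I : Type) (s : seq I) (F : I -> X -> R) : (forall k, C1 (F k)) ->
  C1 (fun x => \sum_(k <- s) F k x) /\
  forall i, partial i (fun x => \sum_(k <- s) F k x) = (fun x => \sum_(k <- s) partial i (F k) x).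
Proof.
move=> HF; elim: s => [|k s [IH IHE]].
  have [H E] := C1_cst 0.
  have F0 : (fun x => \sum_(k <- [::]) F k x) = fun=> 0 by apply/funext => x; rewrite big_nil.
  by rewrite F0; split => // i; rewrite E; apply/funext => x; rewrite big_nil.
have [H E] := C1_add (HF k) IH.
have FE : (fun x => \sum_(k <- (k :: s)) F k x) = (fun x => F k x + \sum_(j <- s) F j x).
  by apply/funext => x; rewrite big_cons.
by rewrite FE; split => // i; rewrite E; apply/funext => x; rewrite big_cons IHE.
Qed.

Lemma C1_prod (I : Type) (s : seq I) (F : I -> X -> R) : (forall k, C1 (F k)) ->
  C1 (fun x => \prod_(k <- s) F k x).
Proof.
move=> HF; elim: s => [|k s IH].
  have [H E] := C1_cst 1.
  by rewrite (_ : (fun x => _) = fun=> 1) //; apply/funext => x; rewrite big_nil.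
have [H E] := C1_mul (HF k) IH.
by rewrite (_ : (fun x => _) = (fun x => F k x * \prod_(j <- s) F j x)) //; apply/funext => x; rewrite big_cons.
Qed.

Lemma C1_coord (j : 'I_n) : C1 (fun x => x 0 j) /\
  forall i, partial i (fun x : X => x 0 j) = (fun=> (i == j)%:R).
Proof.
apply: C1_of => [x|i x|i x]; [exact: coord_continuous| |exact: cst_continuous].
have E : x = x + 0 *: ebasis R i by rewrite scale0r addr0.
rewrite E; apply/(is_derive_line (fun x : X => x 0 j)).
rewrite (_ : (fun t => _) = (fun t : R => x 0 j + (i == j)%:R * t)).
  have H1 := is_derive_id (0:R) (1:R).
  have H2 := is_deriveZ (i == j)%:R H1.
  have H3 := is_deriveD (is_derive_cst (x 0 j) (0:R) (1:R)) H2.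
  by move: H3; rewrite add0r /GRing.scale /= mulr1.
by apply/funext => t; rewrite !mxE eqxx /= mulrC eq_sym.
Qed.

(** Any compact set containing the non-zero points will do, so that products, translates and
    mollifications come with an explicit set and no closure has to be computed. *)
Definition supp_in (U : set X) f :=
  exists K, [/\ compact K, K `<=` U & forall x, ~ K x -> f x = 0].

Lemma partial_near0 f i x : (\forall y \near x, f y = 0) -> partial i f x = 0.
Proof.
move=> H; rewrite /partial.
have : is_derive x (ebasis R i) f 0.
  apply: (@near_eq_is_derive _ _ _ (fun=> 0)).
  by apply: filterS H => y ->.
by move=> D; rewrite derive_val.
Qed.

Lemma partial_bsupp f i : bsupp f -> bsupp (partial i f).
Proof.
move=> [r fr]; exists r => x rx; apply: partial_near0.
have H : 0 < `|x| - r by rewrite subr_gt0.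
apply: filterS (near_norm_lt x H) => y /= xy; apply: fr.
have := ler_normD (x - y) y; rewrite subrK; lra.
Qed.

Lemma compact_closed_rV (K : set X) : compact K -> closed K.
Proof. by apply: compact_closed; exact: norm_hausdorff. Qed.

Lemma partial_supp_in0 f i (K : set X) : closed K -> (forall x, ~ K x -> f x = 0) ->
  forall x, ~ K x -> partial i f x = 0.
Proof.
move=> cK fK x Kx; apply: partial_near0.
have : nbhs x (~` K) by apply: open_nbhs_nbhs; split => //; exact: closed_openC.
by apply: filterS => y; exact: fK.
Qed.

Lemma supp_in_bsupp U f : supp_in U f -> bsupp f.
Proof.
move=> [K [cK KU fK]].
have [M [Mr HM]] := compact_bounded cK.
exists (M + 1) => x Mx; apply: fK => Kx.
have := HM (M + 1) _ x Kx; rewrite ltrDl ltr01 => /(_ isT) /=; lra.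
Qed.

Lemma bsupp_mull f g : bsupp f -> bsupp (fun x => f x * g x).
Proof. by move=> [r fr]; exists r => x rx; rewrite fr // mul0r. Qed.
Lemma bsupp_mulr f g : bsupp g -> bsupp (fun x => f x * g x).
Proof. by move=> [r fr]; exists r => x rx; rewrite fr // mulr0. Qed.
Lemma bsupp_add f g : bsupp f -> bsupp g -> bsupp (fun x => f x + g x).
Proof.
move=> [r fr] [s gs]; exists (Num.max r s) => x; rewrite gt_max => /andP[? ?].
by rewrite fr // gs // addr0.
Qed.
Lemma bsupp_sum (I : Type) (s : seq I) (F : I -> X -> R) :
  (forall k, bsupp (F k)) -> bsupp (fun x => \sum_(k <- s) F k x).
Proof.
move=> HF; elim: s => [|k s IH]; first by exists 0 => x _; rewrite big_nil.
have [r fr] := bsupp_add (HF k) IH; exists r => x rx.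
by rewrite big_cons; exact: fr.
Qed.
Lemma bsupp_translate f v : bsupp f -> bsupp (fun x => f (x + v)).
Proof.
move=> [r fr]; exists (r + `|v|) => x rx; apply: fr.
have := ler_normB (x + v) v; rewrite addrK; lra.
Qed.

Lemma bsupp_bounded f : continuous f -> bsupp f -> exists2 M : R, 0 < M & forall x, `|f x| <= M.
Proof.
move=> cf [r fr].
have cpt : compact (f @` [set x : X | `|x| <= r]).
  by apply: continuous_compact; [exact: continuous_subspaceT|exact: ball_compact].
have [M [Mr HM]] := compact_bounded cpt.
exists (`|M| + 1); first by rewrite ltr_wpDl.
move=> x; have [xr|xr] := leP `|x| r; last by rewrite fr // normr0 addr_ge0.
apply: HM; last by exists x.
by rewrite (le_lt_trans (ler_norm M)) // ltrDl.
Qed.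

End C1.

(** * The iterated integral *)

Section Integral1.
Variable R : realType.
Local Notation mu := (@lebesgue_measure R).
Implicit Types g h : R -> R.

Definition bsupp1 g := exists r : R, forall t, r < `|t| -> g t = 0.
Definition Cc1 g := continuous g /\ bsupp1 g.
Definition int1 g : R := fine (\int[mu]_(t in [set: R]) (g t)%:E)%E.

Lemma Cc1_integrable g : Cc1 g -> mu.-integrable [set: R] (EFin \o g).
Proof.
move=> [cg [r gr]].
have H : mu.-integrable `[- r, r] (EFin \o g).
  by apply: continuous_compact_integrable; [exact: segment_compact|exact: continuous_subspaceT].
have E : EFin \o g = (EFin \o g) \_ `[- r, r].
  apply/funext => t; rewrite patchE; case: ifPn => //.
  rewrite notin_setE /= in_itv /= -ler_norml => /negP; rewrite -ltNge => rt.
  by rewrite gr.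
by rewrite E; apply/integrable_restrict => //; rewrite setTI.
Qed.

Lemma Cc1_integral g : Cc1 g -> (\int[mu]_(t in [set: R]) (g t)%:E)%E = (int1 g)%:E.
Proof. by move=> Hg; rewrite fineK //; exact: integrable_fin_num (Cc1_integrable Hg). Qed.

Lemma int1_linear (a : R) g h : Cc1 g -> Cc1 h -> int1 (fun t => a * g t + h t) = a * int1 g + int1 h.
Proof.
move=> Hg Hh; apply: EFin_inj; rewrite EFinD EFinM -!Cc1_integral //.
  rewrite -integralZl //; last exact: Cc1_integrable.
  rewrite -integralD //; first exact: (integrableZl _ _ (Cc1_integrable Hg)).
  exact: Cc1_integrable.
case: Hg => cg [r gr]; case: Hh => ch [s hs]; split.
  by apply: cont_add => //; apply: cont_mul => //; exact: cst_continuous.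
exists (Num.max r s) => t; rewrite gt_max => /andP[? ?]; by rewrite gr // hs // mulr0 addr0.
Qed.

Lemma int1_le g h : Cc1 g -> Cc1 h -> (forall t, g t <= h t) -> int1 g <= int1 h.
Proof.
move=> Hg Hh gh; rewrite -lee_fin -!Cc1_integral //; apply: le_integral => //.
- exact: Cc1_integrable.
- exact: Cc1_integrable.
- by move=> t _; rewrite /= lee_fin.
Qed.

Lemma int1_translate_ge0 g s : Cc1 g -> (forall t, 0 <= g t) -> int1 (fun t => g (t + s)) = int1 g.
Proof.
move=> [cg _] g0; rewrite /int1; congr fine.
have D t : is_derive t (1:R) (fun t : R => t + s) 1.
  by rewrite -[X in is_derive _ _ _ X]addr0; apply: is_deriveD; exact: is_derive_cst.
have E : derive1 (fun t : R => t + s) = fun=> 1 by apply/funext => t; rewrite derive1E derive_val.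
rewrite [RHS](@increasing_ge0_integration_by_substitutionT R (fun t => t + s)) //.
- apply: eq_integral => t _ /=; rewrite E mulr1 //.
- by move=> x y xy; rewrite ltrD2r.
- by rewrite E; exact: cst_continuous.
- by rewrite E; exact: is_cvg_cst.
- by rewrite E; exact: is_cvg_cst.
- exact: cvg_addrr_Ny.
- exact: cvg_addrr.
Qed.

Lemma Cc1_pos g : Cc1 g -> Cc1 (fun t => Num.max (g t) 0).
Proof.
move=> [cg [r gr]]; split; first by apply: cont_max => //; exact: cst_continuous.
by exists r => t rt; rewrite gr // maxxx.
Qed.

Lemma Cc1_opp g : Cc1 g -> Cc1 (fun t => - g t).
Proof.
move=> [cg [r gr]]; split; first exact: cont_opp.
by exists r => t rt; rewrite gr // oppr0.
Qed.

Lemma Cc1_translate g s : Cc1 g -> Cc1 (fun t => g (t + s)).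
Proof.
move=> [cg [r gr]]; split; first exact: (@cont_translate _ R).
exists (r + `|s|) => t rt; apply: gr.
have := ler_normB (t + s) s; rewrite addrK; lra.
Qed.

(** Positive and negative parts are again continuous of bounded support, and the substitution rule
    for nonnegative functions applies to each. *)
Lemma int1_translate g s : Cc1 g -> int1 (fun t => g (t + s)) = int1 g.
Proof.
move=> Hg.
have E (x : R) : x = (-1) * Num.max (- x) 0 + Num.max x 0.
  by case: (leP x 0) => x0; case: (leP (- x) 0) => x1; lra.
have E1 : int1 g = - int1 (fun t => Num.max (- g t) 0) + int1 (fun t => Num.max (g t) 0).
  rewrite -mulN1r -int1_linear; last 2 first.
  - by apply: Cc1_pos; exact: Cc1_opp.
  - exact: Cc1_pos.
  by congr int1; apply/funext => t.
have E2 : int1 (fun t => g (t + s)) = - int1 (fun t => Num.max (- g (t + s)) 0) + int1 (fun t => Num.max (g (t + s)) 0).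
  rewrite -mulN1r -int1_linear; last 2 first.
  - by apply: Cc1_pos; apply: Cc1_opp; exact: Cc1_translate.
  - by apply: Cc1_pos; exact: Cc1_translate.
  by congr int1; apply/funext => t.
rewrite E2 E1; congr (- _ + _).
  apply: (int1_translate_ge0 (g := fun t => Num.max (- g t) 0)).
    by apply: Cc1_pos; exact: Cc1_opp.
  by move=> t; rewrite le_max lexx orbT.
apply: (int1_translate_ge0 (g := fun t => Num.max (g t) 0)).
  exact: Cc1_pos.
by move=> t; rewrite le_max lexx orbT.
Qed.

Lemma int1_gt0 g t0 : Cc1 g -> (forall t, 0 <= g t) -> 0 < g t0 -> 0 < int1 g.
Proof.
move=> Hg g0 gt0; have [cg _] := Hg.
have [d d0 Hd] := @continuous_eps_delta R R g t0 (cg t0) (g t0 / 2) ltac:(by rewrite divr_gt0).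
have I1 := Cc1_integrable Hg.
have mg := measurable_int _ I1.
pose A : set R := [set` `[t0 - d / 2, t0 + d / 2]].
have mA : measurable A by exact: measurable_itv.
rewrite -lte_fin -Cc1_integral //.
apply: (@lt_le_trans _ _ (\int[mu]_(t in A) (g t)%:E)%E); last first.
  by apply: ge0_subset_integral => // t _; rewrite lee_fin.
apply: (@lt_le_trans _ _ (\int[mu]_(t in A) (cst (g t0 / 2)%:E) t)%E).
  rewrite integral_cst //.
  rewrite [X in (_ * X)%E](_ : _ = d%:E); last first.
    rewrite -[LHS]/(lebesgue_measure A) /A (lebesgue_measure_itv `[t0 - d / 2, t0 + d / 2]) /= lte_fin ifT; last lra.
    by rewrite -EFinB; congr EFin; lra.
  by rewrite -EFinM lte_fin mulr_gt0 // divr_gt0.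
apply: ge0_le_integral => //.
- by move=> t _; rewrite lee_fin; lra.
- exact: (measurable_funS measurableT (@subsetT _ A) mg).
- move=> t; rewrite /A /= in_itv /= => /andP[h1 h2]; rewrite lee_fin.
  have : `|g t0 - g t| < g t0 / 2 by apply: Hd; rewrite ltr_norml; lra.
  rewrite ltr_norml; lra.
Qed.

(* No measurability: the integral of a nonnegative function is a supremum over the simple functions
   below it. *)
Lemma ge0_integral_le (f g : R -> \bar R) :
  (forall t, (0 <= f t)%E) -> (forall t, (f t <= g t)%E) ->
  (\int[mu]_(t in [set: R]) f t <= \int[mu]_(t in [set: R]) g t)%E.
Proof.
move=> f0 fg; rewrite !ge0_integralTE //; last by move=> t; exact: le_trans (fg t).
apply: ereal_sup_le => _ [h hf <-]; exists h => // t; exact: le_trans (fg t).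
Qed.

End Integral1.

(** * Slicing by the first coordinate *)

Section ConsRow.
Variables (R : realType) (m : nat).

Definition consv (t : R) (y : 'rV[R]_m) : 'rV[R]_m.+1 := row_mx (const_mx t : 'rV_1) y.

Lemma consv0 t y : consv t y 0 ord0 = t.
Proof.
rewrite -[RHS](mxE matrix_key (fun _ _ => t) (0 : 'I_1) (0 : 'I_1)).
have -> : ord0 = lshift m (0 : 'I_1) :> 'I_m.+1 by exact: val_inj.
by apply: etrans (row_mxEl _ _ _ _) _; rewrite !mxE.
Qed.

Lemma consvS t y i : consv t y 0 (lift ord0 i) = y 0 i.
Proof.
have -> : lift ord0 i = rshift 1 i :> 'I_m.+1 by exact: val_inj.
exact: row_mxEr.
Qed.

Lemma consv_ext t (y : 'rV[R]_m) (v : 'rV[R]_m.+1) :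
  v 0 ord0 = t -> (forall i, v 0 (lift ord0 i) = y 0 i) -> v = consv t y.
Proof.
move=> h0 hS; apply/rowP => i; case: (unliftP ord0 i) => [j|] ->.
  by rewrite consvS.
by rewrite consv0.
Qed.

Lemma consvB t s y z : consv t y - consv s z = consv (t - s) (y - z).
Proof.
apply: consv_ext => [|i]; rewrite [LHS]mxE [X in _ + X]mxE; first by rewrite !consv0.
by rewrite !consvS !mxE.
Qed.

Lemma consvD t s y z : consv t y + consv s z = consv (t + s) (y + z).
Proof.
apply: consv_ext => [|i]; rewrite [LHS]mxE; first by rewrite !consv0.
by rewrite !consvS !mxE.
Qed.

Lemma consv_surj (v : 'rV[R]_m.+1) : exists t y, v = consv t y.
Proof.
exists (v 0 0), (\row_i v 0 (lift ord0 i)).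
by apply: consv_ext => // i; rewrite mxE.
Qed.

Lemma norm_consv_le t y (r : R) : `|t| <= r -> `|y| <= r -> `|consv t y| <= r.
Proof.
move=> tr yr; apply: norm_rV_le; first exact: le_trans tr.
move=> i; case: (unliftP ord0 i) => [j|] ->; last by rewrite consv0.
by rewrite consvS; exact: le_trans (norm_coord y j) yr.
Qed.

Lemma norm_consv_l t y : `|t| <= `|consv t y|.
Proof. by rewrite -{1}(consv0 t y) norm_coord. Qed.

Lemma norm_consv_r t y : `|y| <= `|consv t y|.
Proof.
by apply: norm_rV_le => // i; rewrite -(consvS t y i) norm_coord.
Qed.

End ConsRow.

Section Integral.
Variable R : realType.

Record Cc n (f : 'rV[R]_n -> R) : Prop := MkCc { Cc_cont : continuous f; Cc_bsupp : bsupp f }.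
Definition integ n (f : 'rV[R]_n -> R) : R := fine (intRn (fun x => (f x)%:E)).

Lemma Cc_linear n (a : R) (f g : 'rV[R]_n -> R) : Cc f -> Cc g -> Cc (fun x => a * f x + g x).
Proof.
move=> [cf bf] [cg bg]; split.
  by apply: cont_add => //; apply: cont_mul => //; exact: cst_continuous.
by apply: bsupp_add => //; exact: bsupp_mulr.
Qed.

Lemma Cc_translate n (f : 'rV[R]_n -> R) v : Cc f -> Cc (fun x => f (x + v)).
Proof.
by move=> [cf bf]; split; [exact: (@cont_translate _ 'rV[R]_n)|exact: bsupp_translate].
Qed.

(** A continuous majorant of the ball of radius [r] that vanishes beyond [r + 1]. Multiplied by a
    sup-norm error it yields an integrable bound. *)
Definition plateau n (r : R) (x : 'rV[R]_n) : R := Num.max (r + 1 - `|x|) 0.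

Lemma Cc_plateau n r : Cc (@plateau n r).
Proof.
split.
  apply: cont_max; last exact: cst_continuous.
  apply: cont_sub; first exact: cst_continuous.
  by move=> x; apply: (@norm_continuous _ 'rV[R]_n).
exists (r + 1) => x rx; rewrite /plateau; case: leP => //; lra.
Qed.

Lemma plateau_ge0 n r (x : 'rV[R]_n) : 0 <= plateau r x.
Proof. by rewrite /plateau le_max lexx orbT. Qed.

Lemma plateau_ge1 n r (x : 'rV[R]_n) : `|x| <= r -> 1 <= plateau r x.
Proof. by move=> xr; rewrite /plateau le_max; apply/orP; left; lra. Qed.

Lemma compact_plateau n (K : set 'rV[R]_n) : compact K -> exists eta : 'rV[R]_n -> R,
  [/\ Cc eta, forall x, 0 <= eta x & forall x, K x -> 1 <= eta x].
Proof.
move=> cK; have [r [_ HK]] := compact_bounded cK; exists (plateau (r + 1)); split.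
- exact: Cc_plateau.
- by move=> x; exact: plateau_ge0.
- by move=> x Kx; apply: plateau_ge1; apply: (HK (r + 1)) => //; rewrite ltrDl.
Qed.

(** One bundle for a joint induction on the dimension: the inner integral must be continuous in the
    sliced coordinate before the outer one can be handled, and that continuity uses linearity and
    monotonicity one dimension below. *)
Definition integral_facts n :=
  [/\ forall f : 'rV[R]_n -> R, Cc f -> intRn (fun x => (f x)%:E) = (integ f)%:E,
      forall (a : R) (f g : 'rV[R]_n -> R), Cc f -> Cc g ->
        integ (fun x => a * f x + g x) = a * integ f + integ g,
      forall f g : 'rV[R]_n -> R, Cc f -> Cc g -> (forall x, f x <= g x) -> integ f <= integ g,
      forall (f : 'rV[R]_n -> R) v, Cc f -> integ (fun x => f (x + v)) = integ f
    & forall (f : 'rV[R]_n -> R) x, Cc f -> (forall y, 0 <= f y) -> 0 < f x -> 0 < integ f].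

Section Slice.
Variable m : nat.
Hypothesis IH : integral_facts m.

Lemma Cc_slice (f : 'rV[R]_m.+1 -> R) t : Cc f -> Cc (fun y => f (consv t y)).
Proof.
move=> [cf [r fr]]; split.
  move=> y; apply: (@eps_delta_continuous R 'rV[R]_m) => e e0.
  have [d d0 Hd] := @continuous_eps_delta R 'rV[R]_m.+1 f (consv t y) (cf _) e e0.
  exists d => // z yz; apply: ltW; apply: Hd.
  rewrite consvB subrr; apply: le_lt_trans yz.
  by apply: norm_consv_le; rewrite ?normr0.
exists r => y ry; apply: fr; apply: lt_le_trans ry _; exact: norm_consv_r.
Qed.

Lemma int_close (f g : 'rV[R]_m -> R) r e : Cc f -> Cc g ->
  (forall x, r < `|x| -> f x = 0) -> (forall x, r < `|x| -> g x = 0) ->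
  (forall x, `|f x - g x| <= e) -> `|integ f - integ g| <= e * integ (@plateau m r).
Proof.
move=> Hf Hg fr gr fg; have [_ lin mono _ _] := IH.
have e0 : 0 <= e by apply: le_trans (fg 0).
have P x : `|f x - g x| <= e * plateau r x.
  have [xr|xr] := leP `|x| r.
    by rewrite (le_trans (fg x)) // ler_peMr // plateau_ge1.
  by rewrite fr // gr // subrr normr0 mulr_ge0 // plateau_ge0.
have H1 : integ f <= e * integ (@plateau m r) + integ g.
  rewrite -lin //; last exact: Cc_plateau.
  apply: mono => //; first by apply: Cc_linear => //; exact: Cc_plateau.
  by move=> x; have := P x; rewrite ler_norml; lra.
have H2 : integ g <= e * integ (@plateau m r) + integ f.
  rewrite -lin //; last exact: Cc_plateau.
  apply: mono => //; first by apply: Cc_linear => //; exact: Cc_plateau.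
  by move=> x; have := P x; rewrite ler_norml; lra.
rewrite ler_norml; lra.
Qed.

Lemma Cc_0 n : Cc (fun _ : 'rV[R]_n => 0).
Proof. by split; [exact: cst_continuous|exists 0]. Qed.

Lemma int_0 : integ (fun _ : 'rV[R]_m => 0) = 0.
Proof.
have [_ lin _ _ _] := IH; have := lin (-1) _ _ (Cc_0 m) (Cc_0 m).
by under eq_fun do rewrite mulr0 addr0; rewrite mulN1r addNr.
Qed.

(** Uniform continuity makes nearby slices uniformly close, and all slices vanish outside one ball,
    so [int_close] compares their integrals. *)
Lemma Cc1_slice_int (f : 'rV[R]_m.+1 -> R) : Cc f ->
  Cc1 (fun t => integ (fun y => f (consv t y))).
Proof.
move=> Hf; have [cf [r fr]] := Hf; have [_ lin mono _ _] := IH.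
split.
  move=> t; apply: (@eps_delta_continuous R R) => e e0.
  pose C := integ (@plateau m r) + 1.
  have C0 : 0 < C.
    rewrite ltr_wpDl // -int_0; apply: mono; [exact: Cc_0|exact: Cc_plateau|].
    by move=> x; exact: plateau_ge0.
  have [d d0 Hd] := uniform_cont cf (Bsupp fr) (divr_gt0 e0 C0).
  exists d => // s ts.
  have H := @int_close (fun y => f (consv t y)) (fun y => f (consv s y)) r (e / C).
  apply: le_trans (H _ _ _ _ _) _.
  - exact: Cc_slice.
  - exact: Cc_slice.
  - by move=> y ry; apply: fr; apply: lt_le_trans ry _; exact: norm_consv_r.
  - by move=> y ry; apply: fr; apply: lt_le_trans ry _; exact: norm_consv_r.
  - move=> y; apply: Hd; rewrite consvB subrr.
    by apply: norm_consv_le; rewrite ?normr0 // ltW.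
  - by rewrite mulrAC ler_pdivrMr // ler_wpM2l ?ltW // /C ltrDl.
exists r => t rt.
rewrite -[RHS]int_0; congr integ; apply/funext => y; apply: fr.
exact: lt_le_trans rt (norm_consv_l _ _).
Qed.

Lemma intRn_S (f : 'rV[R]_m.+1 -> R) : Cc f ->
  intRn (fun x => (f x)%:E) = (int1 (fun t => integ (fun y => f (consv t y))))%:E.
Proof.
move=> Hf; have [fin _ _ _ _] := IH.
rewrite -Cc1_integral; last exact: Cc1_slice_int.
by apply: eq_integral => t _; rewrite -fin //; exact: Cc_slice.
Qed.

Lemma integS (f : 'rV[R]_m.+1 -> R) : Cc f ->
  integ f = int1 (fun t => integ (fun y => f (consv t y))).
Proof. by move=> Hf; rewrite /integ intRn_S. Qed.

Lemma integral_factsS : integral_facts m.+1.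
Proof.
have [fin lin mono trans pos] := IH; split.
- by move=> f Hf; rewrite integS // intRn_S.
- move=> a f g Hf Hg.
  rewrite !integS //; last exact: Cc_linear.
  rewrite -int1_linear //; try exact: Cc1_slice_int.
  congr int1; apply/funext => t; rewrite -lin //; exact: Cc_slice.
- move=> f g Hf Hg fg; rewrite !integS //.
  apply: int1_le; [exact: Cc1_slice_int|exact: Cc1_slice_int|].
  by move=> t; apply: mono => //; exact: Cc_slice.
- move=> f v Hf; have [s [w ->]] := consv_surj v.
  rewrite !integS //; last exact: Cc_translate.
  rewrite -[RHS](int1_translate s); last exact: Cc1_slice_int.
  congr int1; apply/funext => t.
  rewrite -[RHS](trans _ w); last exact: Cc_slice.
  by congr integ; apply/funext => y; rewrite consvD.
- move=> f x Hf f0 fx; have [s [w E]] := consv_surj x.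
  rewrite integS //; apply: (@int1_gt0 R _ s); first exact: Cc1_slice_int.
    by move=> t; rewrite -int_0; apply: mono => //; [exact: Cc_0|exact: Cc_slice].
  by apply: (pos _ w) => //; [exact: Cc_slice|rewrite -E].
Qed.
End Slice.

Lemma integral_facts0 : integral_facts 0.
Proof.
by split => // [f g Hf Hg|f v Hf|f x _ _]; rewrite /integ /= ?thinmx0 ?addr0 // (thinmx0 x).
Qed.

Lemma integral_factsP n : integral_facts n.
Proof. by elim: n => [|m]; [exact: integral_facts0|exact: integral_factsS]. Qed.

(** Serves the Sobolev half of the conclusion, where the integrand is cut off at an arbitrary
    compact set and is not continuous. Nonnegativity is carried along because comparing outer
    integrals requires nonnegative inner ones. *)
Lemma intRn_le n (f g : 'rV[R]_n -> \bar R) :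
  (forall x, (0 <= f x)%E) -> (forall x, (f x <= g x)%E) ->
  (0 <= intRn f)%E /\ (intRn f <= intRn g)%E.
Proof.
elim: n f g => [|m IH] f g f0 fg; first by split; [exact: f0|exact: fg].
split.
  apply: integral_ge0 => t _; apply: (proj1 (IH _ _ _ _)) => y; [exact: f0|exact: fg].
apply: ge0_integral_le => t.
  apply: (proj1 (IH _ _ _ _)) => y; [exact: f0|exact: fg].
apply: (proj2 (IH _ _ _ _)) => y; [exact: f0|exact: fg].
Qed.

End Integral.

Section IntegralTheory.
Variables (R : realType) (n : nat).
Local Notation X := 'rV[R]_n.
Implicit Types (x y v : X) (f g : X -> R).

Lemma intRn_Cc f : Cc f -> intRn (fun x => (f x)%:E) = (integ f)%:E.
Proof. by have [H _ _ _ _] := integral_factsP R n; exact: H. Qed.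

Lemma integ_linear (a : R) f g : Cc f -> Cc g ->
  integ (fun x => a * f x + g x) = a * integ f + integ g.
Proof. by have [_ H _ _ _] := integral_factsP R n; exact: H. Qed.

Lemma integ_le f g : Cc f -> Cc g -> (forall x, f x <= g x) -> integ f <= integ g.
Proof. by have [_ _ H _ _] := integral_factsP R n; exact: H. Qed.

Lemma integ_translate f v : Cc f -> integ (fun x => f (x + v)) = integ f.
Proof. by have [_ _ _ H _] := integral_factsP R n; exact: H. Qed.

Lemma integ_gt0 f x : Cc f -> (forall y, 0 <= f y) -> 0 < f x -> 0 < integ f.
Proof. by have [_ _ _ _ H] := integral_factsP R n; exact: H. Qed.

Lemma integ0 : integ (fun _ : X => 0) = 0.
Proof. exact: (int_0 (integral_factsP R n)). Qed.

Lemma Cc_add f g : Cc f -> Cc g -> Cc (fun x => f x + g x).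
Proof. by move=> Hf Hg; have := Cc_linear 1 Hf Hg; under eq_fun do rewrite mul1r. Qed.

Lemma Cc_scale (a : R) f : Cc f -> Cc (fun x => a * f x).
Proof. by move=> Hf; have := Cc_linear a Hf (Cc_0 R n); under eq_fun do rewrite addr0. Qed.

Lemma Cc_opp f : Cc f -> Cc (fun x => - f x).
Proof. by move=> /(Cc_scale (-1)); under eq_fun do rewrite mulN1r. Qed.

Lemma Cc_sub f g : Cc f -> Cc g -> Cc (fun x => f x - g x).
Proof. by move=> Hf Hg; apply: Cc_add => //; exact: Cc_opp. Qed.

Lemma Cc_mulr f g : Cc f -> continuous g -> Cc (fun x => f x * g x).
Proof. by move=> [cf bf] cg; split; [exact: cont_mul|exact: bsupp_mull]. Qed.

Lemma Cc_mull f g : Cc f -> continuous g -> Cc (fun x => g x * f x).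
Proof. by move=> [cf bf] cg; split; [exact: cont_mul|exact: bsupp_mulr]. Qed.

Lemma Cc_norm f : Cc f -> Cc (fun x => `|f x|).
Proof.
move=> [cf [r fr]]; split; first exact: cont_norm.
by exists r => x rx; rewrite fr // normr0.
Qed.

Lemma Cc_sum (I : Type) (s : seq I) (F : I -> X -> R) :
  (forall k, Cc (F k)) -> Cc (fun x => \sum_(k <- s) F k x).
Proof. by move=> HF; split; [apply: cont_sum => k; case: (HF k)|apply: bsupp_sum => k; case: (HF k)]. Qed.

Lemma integ_add f g : Cc f -> Cc g -> integ (fun x => f x + g x) = integ f + integ g.
Proof.
by move=> Hf Hg; have := integ_linear 1 Hf Hg; under eq_fun do rewrite mul1r; rewrite mul1r.
Qed.

Lemma integ_scale (a : R) f : Cc f -> integ (fun x => a * f x) = a * integ f.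
Proof.
move=> Hf; have := integ_linear a Hf (Cc_0 R n); rewrite integ0 addr0.
by under eq_fun do rewrite addr0.
Qed.

Lemma integ_opp f : Cc f -> integ (fun x => - f x) = - integ f.
Proof. by move=> Hf; rewrite -mulN1r -integ_scale //; congr integ; apply/funext => x; rewrite mulN1r. Qed.

Lemma integ_sub f g : Cc f -> Cc g -> integ (fun x => f x - g x) = integ f - integ g.
Proof. by move=> Hf Hg; rewrite integ_add ?integ_opp //; exact: Cc_opp. Qed.

Lemma integ_sum (I : Type) (s : seq I) (F : I -> X -> R) : (forall k, Cc (F k)) ->
  integ (fun x => \sum_(k <- s) F k x) = \sum_(k <- s) integ (F k).
Proof.
move=> HF; elim: s => [|k s IH].
  by under eq_fun do rewrite big_nil; rewrite integ0 big_nil.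
under eq_fun do rewrite big_cons.
by rewrite integ_add // ?IH ?big_cons //; exact: Cc_sum.
Qed.

Lemma integ_ge0 f : Cc f -> (forall x, 0 <= f x) -> 0 <= integ f.
Proof. by move=> Hf f0; rewrite -integ0; apply: integ_le => //; exact: Cc_0. Qed.

Lemma integ_norm_le f g : Cc f -> Cc g -> (forall x, `|f x| <= g x) -> `|integ f| <= integ g.
Proof.
move=> Hf Hg fg; rewrite ler_norml -integ_opp //; apply/andP; split; apply: integ_le => //.
- exact: Cc_opp.
- by move=> x; have := fg x; rewrite ler_norml => /andP[].
- by move=> x; have := fg x; rewrite ler_norml => /andP[].
Qed.

Lemma eq0_small (a C : R) : 0 <= C -> (forall e, 0 < e -> `|a| <= e * C) -> a = 0.
Proof.
move=> C0 H; apply/eqP; rewrite -normr_eq0; apply/eqP/le_anti; rewrite normr_ge0 andbT.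
apply/ler_addgt0Pr => e e0; rewrite add0r.
have C1 : 0 < C + 1 by rewrite ltr_wpDl.
apply: le_trans (H (e / (C + 1)) (divr_gt0 e0 C1)) _.
by rewrite mulrAC ler_pdivrMr // ler_wpM2l ?ltW // ltrDl.
Qed.

Definition dq (h : R) i f x : R := h^-1 * (f (x + h *: ebasis R i) - f x).

Lemma dq_mvt f i h x : C1 f -> h != 0 ->
  exists2 y, `|y - x| <= `|h| & dq h i f x = partial i f y.
Proof.
move=> Hf h0.
have [t th E] := @mvt_line R X f (partial i f) x (ebasis R i) h (fun t _ => C1_is_derive i _ Hf).
exists (x + t *: ebasis R i); last by rewrite /dq E mulrA mulVf // mul1r.
by rewrite addrAC subrr add0r (le_trans (norm_scale_ebasis_le _ _)).
Qed.

Lemma dq_uniform f i : C1 f -> bsupp f -> forall e : R, 0 < e ->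
  exists2 d : R, 0 < d & forall h x, h != 0 -> `|h| <= d -> `|dq h i f x - partial i f x| <= e.
Proof.
move=> Hf bf e e0.
have [d d0 Hd] := uniform_cont (C1_partial_cont Hf) (partial_bsupp i bf) e0.
exists d => // h x h0 hd; have [y yx ->] := dq_mvt i x Hf h0.
by apply: Hd; exact: le_trans hd.
Qed.

Lemma Cc_C1 f : C1 f -> bsupp f -> Cc f.
Proof. by move=> Hf bf; split => //; exact: C1_cont. Qed.

Lemma Cc_partial f i : C1 f -> bsupp f -> Cc (partial i f).
Proof. by move=> Hf bf; split; [exact: C1_partial_cont|exact: partial_bsupp]. Qed.

Lemma Cc_dq f i h : Cc f -> Cc (dq h i f).
Proof. by move=> Hf; apply: Cc_scale; apply: Cc_sub => //; exact: Cc_translate. Qed.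

Lemma integ_dq f i h : Cc f -> integ (dq h i f) = 0.
Proof.
move=> Hf; rewrite /dq integ_scale; last by apply: Cc_sub => //; exact: Cc_translate.
by rewrite integ_sub ?integ_translate ?subrr ?mulr0 //; exact: Cc_translate.
Qed.

(** Translation invariance makes the integral of every difference quotient vanish, and these
    quotients converge uniformly to the derivative on a fixed ball. All coordinates are thus treated
    alike, whatever their place in the iterated integral. *)
Lemma integ_partial f i : C1 f -> bsupp f -> integ (partial i f) = 0.
Proof.
move=> Hf bf; have [r fr] := bf.
apply: (@eq0_small _ (integ (@plateau R n (r + 1)))).
  apply: integ_ge0; [exact: Cc_plateau|move=> x; exact: plateau_ge0].
move=> e e0; have [d d0 Hd] := dq_uniform i Hf bf e0.
(* The bound [h <= 1] keeps the support of the difference quotient inside the ball of radius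
   [r + 1]. *)
pose h := Num.min d 1.
have h0 : 0 < h by rewrite lt_min d0 ltr01.
have hd : `|h| <= d by rewrite gtr0_norm // ge_min lexx.
have h1 : `|h| <= 1 by rewrite gtr0_norm // ge_min lexx orbT.
rewrite -[integ _]subr0 -(integ_dq i h (Cc_C1 Hf bf)).
apply: (@int_close _ _ (integral_factsP R n)); [exact: Cc_partial|apply: Cc_dq; exact: Cc_C1| | |].
- move=> x rx; apply: partial_near0.
  have H : 0 < `|x| - r by lra.
  apply: filterS (near_norm_lt x H) => y /= xy; apply: fr.
  have := ler_normD (x - y) y; rewrite subrK; lra.
- move=> x rx; rewrite /dq !fr ?subrr ?mulr0 //; first lra.
  have := ler_normB (x + h *: ebasis R i) (h *: ebasis R i); rewrite addrK.
  have := norm_scale_ebasis_le h i; lra.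
- by move=> x; rewrite distrC; apply: Hd => //; rewrite gt_eqF.
Qed.

Lemma integ_parts f g i : C1 f -> C1 g -> bsupp f ->
  integ (fun x => f x * partial i g x) = - integ (fun x => partial i f x * g x).
Proof.
move=> Hf Hg bf; have [Hfg E] := C1_mul Hf Hg.
have := integ_partial i Hfg (bsupp_mull g bf); rewrite E integ_add.
- by move=> H; lra.
- by apply: Cc_mulr; [exact: Cc_partial|exact: C1_cont].
- by apply: Cc_mulr; [exact: Cc_C1|exact: C1_partial_cont].
Qed.

End IntegralTheory.

Lemma is_derive_eps_delta (R : realType) (V : normedModType R) (f : V -> R) x v (l : R) :
  (forall e : R, 0 < e -> exists2 d : R, 0 < d &
    forall h, h != 0 -> `|h| <= d -> `|h^-1 * (f (x + h *: v) - f x) - l| <= e) ->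
  is_derive x v f l.
Proof.
move=> H.
have C : h^-1 *: ((f \o shift x) (h *: v) - f x) @[h --> 0^'] --> l.
  apply/cvgrPdist_le => e e0; have [d d0 Hd] := H e e0.
  have : \forall h \near (0 : R), `|h| < d.
    have := nbhsx_ballx (0:R) d d0; rewrite -ball_normE; apply: filterS => h /=.
    by rewrite sub0r normrN.
  rewrite near_withinE; apply: filterS => h hd h0.
  rewrite distrC /= [_ + x]addrC; apply: Hd => //; exact: ltW.
split; first by apply/cvg_ex; exists l.
exact: cvg_lim.
Qed.

(** * Mollification and cut-off functions *)

(** Serves the glued functions [bumpq] and [psq]: one two-sided quadratic estimate at the junction
    replaces a comparison of one-sided derivatives. *)
Lemma is_derive_quadratic_error (R : realType) (f : R -> R) (t l C : R) : 0 <= C ->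
  (forall h, `|f (t + h) - f t - l * h| <= C * h ^+ 2) -> is_derive t (1:R) f l.
Proof.
move=> C0 H; apply: is_derive_eps_delta => e e0.
have C1 : 0 < C + 1 by rewrite ltr_wpDl.
exists (e / (C + 1)); first by rewrite divr_gt0.
move=> h h0 hd; rewrite -[h *: _]/(h * 1) mulr1.
have -> : h^-1 * (f (t + h) - f t) - l = h^-1 * (f (t + h) - f t - l * h).
  by field.
rewrite normrM normfV ler_pdivrMl ?normr_gt0 //.
apply: le_trans (H h) _; rewrite -[h ^+ 2]real_normK ?num_real // expr2 mulrCA ler_wpM2l //.
rewrite ler_pdivlMr // in hd; apply: le_trans hd.
by rewrite mulrC ler_wpM2l // lerDl.
Qed.

Section Bump.
Variables (R : realType) (e : R).
Hypothesis e_gt0 : 0 < e.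

(* Functions [q(t) s^(-m) exp(-1/s)] with [s = e^2 - t^2] form a family closed under derivation. *)
Definition bumpq (q : {poly R}) (m : nat) (t : R) : R :=
  if `|t| < e then q.[t] * ((e ^+ 2 - t ^+ 2) ^- m * expR (- (e ^+ 2 - t ^+ 2)^-1)) else 0.

(** With [s' = -2t], this is the numerator of the derivative of [q s^(-m) exp(-1/s)] over the
    denominator [s^(m+2)]. *)
Definition dbumpq (q : {poly R}) (m : nat) : {poly R} :=
  q^`() * ((e ^+ 2)%:P - 'X ^+ 2) ^+ 2 + (2 * m%:R) *: ('X * q * ((e ^+ 2)%:P - 'X ^+ 2))
  - 2 *: ('X * q).

Lemma sqdiff_gt0 (t : R) : `|t| < e -> 0 < e ^+ 2 - t ^+ 2.
Proof.
move=> te; rewrite subr_gt0 -[t ^+ 2]real_normK ?num_real // ltr_pXn2r // nnegrE //.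
exact: ltW.
Qed.

(** The term of order [m + 2] in the series of [exp(1/s)] beats [s^(-m)] and leaves the factor
    [s^2], which gives quadratic decay at the edge of the support. *)
Lemma expR_inv_bound (m : nat) (s : R) : 0 < s -> s ^- m * expR (- s^-1) <= m.+2`!%:R * s ^+ 2.
Proof.
move=> s0; rewrite expRN.
have := @expR_ge1Dxn R s^-1 m.+1 (ltW _); rewrite invr_gt0 => /(_ s0) H.
have H2 : (s^-1) ^+ m.+2 / m.+2`!%:R <= expR s^-1 by apply: le_trans H; rewrite lerDr.
have F0 : 0 < m.+2`!%:R :> R by rewrite ltr0n fact_gt0.
rewrite ler_pdivrMr ?expR_gt0 //.
rewrite ler_pdivrMr // in H2.
have -> : s ^- m = s ^+ 2 * s^-1 ^+ m.+2.
  by rewrite -exprVn !exprS; move: (s^-1 ^+ m) => W; field; rewrite gt_eqF.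
rewrite [leRHS](_ : _ = s ^+ 2 * (expR s^-1 * m.+2`!%:R)); last by ring.
by rewrite ler_wpM2l // exprn_ge0 // ltW.
Qed.

Lemma bumpq_bound q m : exists2 C : R, 0 <= C & forall t t0, e <= `|t0| -> `|bumpq q m t| <= C * (t - t0) ^+ 2.
Proof.
have cpt : compact ((horner q) @` [set` `[-e, e]]).
  apply: continuous_compact; last exact: segment_compact.
  apply: continuous_subspaceT => x; exact: continuous_horner.
have [M [_ HM]] := compact_bounded cpt.
pose C := `|M| + 1.
have HC t : `|t| < e -> `|q.[t]| <= C.
  move=> te; apply: (HM C); first by rewrite /C (le_lt_trans (ler_norm M)) // ltrDl.
  by exists t => //=; rewrite in_itv /= -ler_norml ltW.
exists (C * (m.+2`!%:R * (2 * e) ^+ 2)).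
  by rewrite !mulr_ge0 // ?addr_ge0 // ltW.
move=> t t0 et0; rewrite /bumpq; case: ifPn => te; last first.
  by rewrite normr0 mulr_ge0 ?sqr_ge0 // !mulr_ge0 ?addr_ge0 // ltW.
have s0 := sqdiff_gt0 te.
rewrite normrM -[leRHS]mulrA ler_pM //; first exact: HC.
rewrite ger0_norm; last by rewrite mulr_ge0 ?expR_ge0 // invr_ge0 exprn_ge0 // ltW.
apply: le_trans (expR_inv_bound m s0) _; rewrite -[leRHS]mulrA ler_wpM2l //.
have -> : (2 * e) ^+ 2 * (t - t0) ^+ 2 = `|2 * e * (t - t0)| ^+ 2.
  by rewrite real_normK ?num_real //; ring.
(* Since [t0] lies on or beyond the edge, [e - |t| <= |t - t0|], and the other factor [e + |t|] is
   at most [2 e]. *)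
have H1 : e ^+ 2 - t ^+ 2 <= `|2 * e * (t - t0)|.
  have H2 : e - `|t| <= `|t - t0|.
    have := ler_normB t (t - t0); rewrite opprB addrC subrK; lra.
  have -> : e ^+ 2 - t ^+ 2 = (e + `|t|) * (e - `|t|).
    by rewrite -[t ^+ 2]real_normK ?num_real //; ring.
  have e20 : 0 < 2 * e by rewrite mulr_gt0.
  rewrite normrM (gtr0_norm e20) ler_pM //; have := normr_ge0 t; lra.
by rewrite !expr2 ler_pM // ltW.
Qed.

Lemma is_derive_bumpq q m (t : R) : is_derive t (1:R) (bumpq q m) (bumpq (dbumpq q m) m.+2 t).
Proof.
have [te|et] := ltP `|t| e; last first.
  rewrite [bumpq (dbumpq q m) _ _]/bumpq ltNge et /=.
  have [C C0 HC] := bumpq_bound q m.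
  apply: (is_derive_quadratic_error C0) => h; rewrite mul0r subr0.
  rewrite [X in _ - X](_ : _ = 0) ?subr0; last by rewrite /bumpq ltNge et.
  by have := HC (t + h) t et; rewrite addrAC subrr add0r.
have s0 := sqdiff_gt0 te.
pose s (t : R) := e ^+ 2 - t ^+ 2.
have st0 : s t != 0 by rewrite gt_eqF.
have ds : is_derive t (1:R) s (- (2 * t)).
  rewrite /s -[X in is_derive _ _ _ X]add0r; apply: is_deriveD.
  have H := is_deriveX 2 (is_derive_id t (1:R)).
  have H' := is_deriveN H.
  apply: is_derive_eq H' _.
  by rewrite /GRing.scale /= expr1 mulr1 mulr_natl.
have di : is_derive t (1:R) (fun t => (s t)^-1) ((2 * t) / (s t) ^+ 2).
  have := is_deriveV st0 ds.
  move=> H; apply: is_derive_eq H _.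
  by rewrite /GRing.scale /= mulNr mulrN opprK mulrC.
have dE : is_derive t (1:R) (fun t => expR (- (s t)^-1)) (expR (- (s t)^-1) * - ((2 * t) / (s t) ^+ 2)).
  apply: (is_derive_comp1 (f := fun t => - (s t)^-1)).
have dm : is_derive t (1:R) (fun t => (s t) ^- m) (m%:R * (s t)^-1 ^+ m.-1 * ((2 * t) / (s t) ^+ 2)).
  have := is_deriveX m di => H.
  rewrite (_ : (fun t => _) = (fun t => (s t)^-1) ^+ m); last by apply/funext => z; rewrite fctE /= exprVn.
  apply: is_derive_eq H _.
  by rewrite /GRing.scale /= mulr_natl.
have dq : is_derive t (1:R) (fun t => q.[t]) (q^`()).[t] by exact: is_derive_poly.
have D := is_deriveM dq (is_deriveM dm dE).
have E : \near t, q.[t] * ((s t) ^- m * expR (- (s t)^-1)) = bumpq q m t.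
  have : \forall z \near t, `|z| < e.
    have d0 : 0 < e - `|t| by lra.
    have := nbhsx_ballx t _ d0; rewrite -ball_normE; apply: filterS => z /=.
    have := ler_normB t (t - z); rewrite opprB addrC subrK; lra.
  by apply: filterS => z ze; rewrite /bumpq ze.
apply: (near_eq_is_derive E).
pose E' := expR (- (s t)^-1); pose W := (s t) ^- m.
pose dE' := E' * - ((2 * t) / (s t) ^+ 2).
pose dW := m%:R * (s t)^-1 ^+ m.-1 * ((2 * t) / (s t) ^+ 2).
apply: (is_derive_eq D).
transitivity (q.[t] * (W * dE' + E' * dW) + (W * E') * q^`().[t]); first by [].
have Hd : (dbumpq q m).[t] = q^`().[t] * (s t) ^+ 2 + 2 * m%:R * (t * q.[t] * s t) - 2 * (t * q.[t]).
  by rewrite /dbumpq !(hornerD, hornerN, hornerM, hornerZ, horner_exp, hornerX, hornerC).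
rewrite /bumpq te Hd /dE' -/(s t) -/E'.
have -> : (s t) ^- m.+2 = (s t)^-1 ^+ 2 * W by rewrite /W -!exprVn -exprD.
rewrite /W /dW -exprVn.
case: (m) => [|k]; first by rewrite /= expr0; field.
by rewrite /= !exprS; move: ((s t)^-1 ^+ k) => V; field.
Qed.

Lemma continuous_bumpq q m : continuous (bumpq q m).
Proof.
move=> t; apply/differentiable_continuous/derivable1_diffP.
by case: (is_derive_bumpq q m t).
Qed.

End Bump.

Section BumpProduct.
Variables (R : realType) (n : nat) (e : R).
Hypothesis e_gt0 : 0 < e.
Local Notation X := 'rV[R]_n.
Implicit Types (G : 'I_n -> {poly R} * nat) (x : X).

Definition bumpn G x : R := \prod_j bumpq e (G j).1 (G j).2 (x 0 j).

(* The sign makes the family of kernels [x |-> bumpn G (z - x)] stable under partial derivatives. *)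
Definition dbumpn G (i : 'I_n) : 'I_n -> {poly R} * nat :=
  fun j => if j == i then (- dbumpq e (G j).1 (G j).2, (G j).2.+2) else G j.

Lemma bumpqN q m t : bumpq e (- q) m t = - bumpq e q m t.
Proof. by rewrite /bumpq; case: ifP => _; rewrite ?oppr0 // hornerN mulNr. Qed.

Lemma is_derive_bumpn G i x : is_derive x (ebasis R i) (bumpn G) (- bumpn (dbumpn G i) x).
Proof.
pose P := \prod_(j | j != i) bumpq e (G j).1 (G j).2 (x 0 j).
have E : x = x + 0 *: ebasis R i by rewrite scale0r addr0.
rewrite {1}E; apply/is_derive_line.
rewrite (_ : (fun t => _) = (fun t : R => P * bumpq e (G i).1 (G i).2 (t + x 0 i))); last first.
  apply/funext => t; rewrite /bumpn (bigD1 i) //= mulrC; congr (_ * _).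
    apply: eq_bigr => j ji; rewrite !mxE eqxx /= (negbTE ji) mulr0 addr0 //.
  by rewrite !mxE !eqxx /= mulr1 addrC.
rewrite (_ : - _ = P * bumpq e (dbumpq e (G i).1 (G i).2) (G i).2.+2 (0 + x 0 i)); last first.
  rewrite /bumpn (bigD1 i) //= /dbumpn eqxx /= bumpqN mulNr opprK add0r mulrC; congr (_ * _).
  by apply: eq_bigr => j ji; rewrite (negbTE ji).
apply: is_deriveZ; apply: is_derive_translate; exact: is_derive_bumpq.
Qed.

Lemma cont_bumpn G : continuous (bumpn G).
Proof.
rewrite /bumpn => x; have : forall s : seq 'I_n,
    continuous (fun x : X => \prod_(j <- s) bumpq e (G j).1 (G j).2 (x 0 j)); last exact.
elim=> [|k s IH]; first by under eq_fun do rewrite big_nil; exact: cst_continuous.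
under eq_fun do rewrite big_cons; apply: cont_mul => //.
apply: (@cont_comp _ X (fun x => x 0 k)); first exact: coord_continuous.
exact: continuous_bumpq.
Qed.

Lemma bumpn_supp G x : e < `|x| -> bumpn G x = 0.
Proof.
move=> ex; have [j xj] : exists j, e < `|x 0 j|.
  apply/not_existsP => H; suff : `|x| <= e by lra.
  by apply: norm_rV_le => [|i]; [exact: ltW|have /negP := H i; rewrite -leNgt].
by rewrite /bumpn (bigD1 j) //= /bumpq ltNge (ltW xj) mul0r.
Qed.

Lemma C1_bumpn G : C1 (bumpn G) /\ forall i, partial i (bumpn G) = (fun x => - bumpn (dbumpn G i) x).
Proof.
apply: C1_of => [|i x|i]; [exact: cont_bumpn|exact: is_derive_bumpn|apply: cont_opp; exact: cont_bumpn].
Qed.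

Lemma bsupp_bumpn G : bsupp (bumpn G).
Proof. by exists e => x; exact: bumpn_supp. Qed.

Definition conv (f rho : X -> R) x : R := integ (fun z => f z * rho (z - x)).

Lemma convE (f : X -> R) (rho : X -> R) x : Cc f -> continuous rho ->
  conv f rho x = integ (fun y => f (x + y) * rho y).
Proof.
move=> Hf crho; rewrite /conv -(@integ_translate R n _ x).
  by congr integ; apply/funext => y; rewrite addrK addrC.
by apply: Cc_mulr => //; exact: (@cont_translate _ X).
Qed.

Lemma is_derive_conv (f : X -> R) G i x : Cc f ->
  is_derive x (ebasis R i) (conv f (bumpn G)) (conv f (bumpn (dbumpn G i)) x).
Proof.
move=> Hf; apply: is_derive_eps_delta => eps eps0.
have Hg := Cc_norm Hf; have g0 := integ_ge0 Hg (fun x => normr_ge0 (f x)).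
have C0 : 0 < integ (fun x => `|f x|) + 1 by rewrite ltr_wpDl.
have [HB EB] := C1_bumpn G.
have [d d0 Hd] := dq_uniform i HB (bsupp_bumpn G) (divr_gt0 eps0 C0).
exists d => // h h0 hd.
have cB G' v : continuous (fun z : X => bumpn G' (z - v)) by apply: (@cont_translate _ X); exact: cont_bumpn.
rewrite /conv -integ_sub; try exact: Cc_mulr.
rewrite -integ_scale; last by apply: Cc_sub; exact: Cc_mulr.
rewrite -integ_sub; [|by apply: Cc_scale; apply: Cc_sub; exact: Cc_mulr|exact: Cc_mulr].
apply: (@le_trans _ _ (integ (fun z => eps / (integ (fun x => `|f x|) + 1) * `|f z|))); last first.
  rewrite integ_scale // mulrAC ler_pdivrMr // ler_wpM2l ?ltW // ltrDl //.
apply: integ_norm_le; [|exact: Cc_scale|].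
  apply: Cc_sub; last exact: Cc_mulr.
  by apply: Cc_scale; apply: Cc_sub; exact: Cc_mulr.
move=> z.
(* Moving [x] by [h] moves the argument [z - x] of the kernel by [- h]. *)
have := Hd (- h) (z - x); rewrite oppr_eq0 normrN => /(_ h0 hd).
rewrite /dq EB opprK scaleNr.
have -> : z - x - h *: ebasis R i = z - (x + h *: ebasis R i) by rewrite opprD addrA.
rewrite invrN mulNr => H.
have -> : h^-1 * (f z * bumpn G (z - (x + h *: ebasis R i)) - f z * bumpn G (z - x)) -
   f z * bumpn (dbumpn G i) (z - x) = - (f z * (- (h^-1 * (bumpn G (z - (x + h *: ebasis R i)) - bumpn G (z - x))) +
     bumpn (dbumpn G i) (z - x))) by ring.
by rewrite normrN normrM mulrC ler_wpM2r.
Qed.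

Lemma cont_conv (f : X -> R) G : Cc f -> continuous (conv f (bumpn G)).
Proof.
move=> Hf x; apply: (@eps_delta_continuous R X) => eps eps0.
have Hg := Cc_norm Hf; have g0 := integ_ge0 Hg (fun x => normr_ge0 (f x)).
have C0 : 0 < integ (fun x => `|f x|) + 1 by rewrite ltr_wpDl.
have [d d0 Hd] := uniform_cont (@cont_bumpn G) (bsupp_bumpn G) (divr_gt0 eps0 C0).
exists d => // y xy.
have cB G' v : continuous (fun z : X => bumpn G' (z - v)) by apply: (@cont_translate _ X); exact: cont_bumpn.
rewrite /conv -integ_sub; try exact: Cc_mulr.
apply: (@le_trans _ _ (integ (fun z => eps / (integ (fun x => `|f x|) + 1) * `|f z|))); last first.
  rewrite integ_scale // mulrAC ler_pdivrMr // ler_wpM2l ?ltW // ltrDl //.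
apply: integ_norm_le; [by apply: Cc_sub; exact: Cc_mulr|exact: Cc_scale|].
move=> z; rewrite -mulrBr normrM mulrC ler_wpM2r //; apply: Hd.
by rewrite opprB [z - x + _]addrC addrA subrK distrC ltW.
Qed.

Lemma smooth_conv (f : X -> R) G : Cc f -> smooth (conv f (bumpn G)).
Proof.
move=> Hf; have H s : exists G', iter_partial s (conv f (bumpn G)) = conv f (bumpn G').
  elim: s => [|i s [G' IH]]; first by exists G.
  exists (dbumpn G' i); rewrite /= IH; apply/funext => x; rewrite /partial.
  by have D := is_derive_conv G' i x Hf; rewrite derive_val.
move=> s; have [G' ->] := H s; split; first exact: cont_conv.
by move=> i x; case: (is_derive_conv G' i x Hf).
Qed.

End BumpProduct.

Section Mollify.
Variables (R : realType) (n : nat).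
Local Notation X := 'rV[R]_n.
Implicit Types (f rho : X -> R) (x y : X).

(** Here the derivative falls on [f] and not on the kernel; this makes the gradient of a mollified
    C^1 function uniformly close to the original gradient. *)
Lemma is_derive_param f rho i x : C1 f -> bsupp f -> Cc rho ->
  is_derive x (ebasis R i) (fun x => integ (fun y => f (x + y) * rho y))
    (integ (fun y => partial i f (x + y) * rho y)).
Proof.
move=> Hf bf Hr; apply: is_derive_eps_delta => eps eps0.
have Hg := Cc_norm Hr; have g0 := integ_ge0 Hg (fun x => normr_ge0 (rho x)).
have C0 : 0 < integ (fun x => `|rho x|) + 1 by rewrite ltr_wpDl.
have [d d0 Hd] := dq_uniform i Hf bf (divr_gt0 eps0 C0).
exists d => // h h0 hd.
have cf (g : X -> R) v : continuous g -> continuous (fun z : X => g (v + z)).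
  by move=> cg; under eq_fun do rewrite addrC; exact: (@cont_translate _ X).
have M1 v : Cc (fun y => f (v + y) * rho y) by apply: Cc_mull => //; apply: cf; exact: C1_cont.
have M2 v : Cc (fun y => partial i f (v + y) * rho y) by apply: Cc_mull => //; apply: cf; exact: C1_partial_cont.
rewrite -integ_sub // -integ_scale; last exact: Cc_sub.
rewrite -integ_sub //; last by apply: Cc_scale; exact: Cc_sub.
apply: (@le_trans _ _ (integ (fun z => eps / (integ (fun x => `|rho x|) + 1) * `|rho z|))); last first.
  rewrite integ_scale // mulrAC ler_pdivrMr // ler_wpM2l ?ltW // ltrDl //.
apply: integ_norm_le; [|exact: Cc_scale|].
  by apply: Cc_sub => //; apply: Cc_scale; exact: Cc_sub.
move=> y; have := Hd h (x + y) h0 hd; rewrite /dq addrAC => H.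
rewrite -!mulrBl mulrA -mulrBl normrM ler_wpM2r //.
Qed.

Lemma mollify f : Cc f -> forall tau r : R, 0 < tau -> 0 < r ->
  exists g : X -> R, [/\ smooth g, forall x, `|g x - f x| <= tau,
    forall x, (forall y, `|y - x| <= r -> f y = 0) -> g x = 0
  & C1 f -> forall i x, `|partial i g x - partial i f x| <= tau].
Proof.
move=> Hf tau r tau0 r0.
have key (h : X -> R) : Cc h -> exists2 d : R, 0 < d & forall rho : X -> R, Cc rho -> (forall y, 0 <= rho y) ->
    integ rho = 1 -> (forall y, d < `|y| -> rho y = 0) ->
    forall x, `|integ (fun y => h (x + y) * rho y) - h x| <= tau.
  move=> [ch bh]; have [d d0 Hd] := uniform_cont ch bh tau0.
  exists d => // rho Hr r0' r1 rd x.
  have cx : continuous (fun y : X => h (x + y)).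
    by under eq_fun do rewrite addrC; exact: (@cont_translate _ X).
  have H1 : Cc (fun y => h (x + y) * rho y) by exact: Cc_mull.
  have H2 : Cc (fun y => h x * rho y) by exact: Cc_scale.
  rewrite -[h x]mulr1 -r1 -integ_scale // -integ_sub // -[tau]mulr1 -r1 -integ_scale //.
  apply: integ_norm_le; [exact: Cc_sub|exact: Cc_scale|].
  move=> y; rewrite -mulrBl normrM (ger0_norm (r0' y)).
  have [yd|yd] := leP `|y| d; last by rewrite rd // !mulr0.
  by rewrite ler_wpM2r // Hd // addrAC subrr add0r.
have [d1 d10 Hd1] := key f Hf.
have [d2 d20 Hd2] : exists2 d2 : R, 0 < d2 & forall i, C1 f -> forall rho : X -> R, Cc rho -> (forall y, 0 <= rho y) ->
    integ rho = 1 -> (forall y, d2 < `|y| -> rho y = 0) ->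
    forall x, `|integ (fun y => partial i f (x + y) * rho y) - partial i f x| <= tau.
  apply: finite_uniform => [i d d' dd Hd Cf rho Hr r0' r1 rd|i].
    by apply: Hd => // y dy; apply: rd; exact: le_lt_trans dy.
  have [Cf|nCf] := pselect (C1 f); last by exists 1.
  by have [d d0 Hd] := key (partial i f) (Cc_partial i Cf (Cc_bsupp Hf)); exists d.
(* At most [r] for the support, at most [d1] for the values, at most [d2] for the gradients. *)
pose e := Num.min r (Num.min d1 d2).
have e0 : 0 < e by rewrite !lt_min r0 d10.
pose G0 := fun _ : 'I_n => (1%:P : {poly R}, 0%N).
have B0 x : 0 <= bumpn e G0 x.
  apply: prodr_ge0 => j _; rewrite /bumpq; case: ifP => // _.
  by rewrite hornerC mul1r mulr_ge0 ?expR_ge0 // invr_ge0 expr0.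
have HB : Cc (bumpn e G0) by split; [exact: cont_bumpn|exact: bsupp_bumpn].
have I0 : 0 < integ (bumpn e G0).
  apply: (@integ_gt0 _ _ _ 0) => //; apply: prodr_gt0 => j _.
  by rewrite /bumpq mxE normr0 e0 hornerC mul1r expr0 invr1 mul1r expR_gt0.
pose c := (integ (bumpn e G0))^-1.
pose rho := fun y => c * bumpn e G0 y.
have Hr : Cc rho by exact: Cc_scale.
have r0' y : 0 <= rho y by rewrite mulr_ge0 // invr_ge0 ltW.
have r1 : integ rho = 1 by rewrite integ_scale // mulVf // gt_eqF.
have rd d y : e <= d -> d < `|y| -> rho y = 0.
  by move=> ed dy; rewrite /rho bumpn_supp ?mulr0 //; exact: le_lt_trans dy.
(* The normalizing constant is moved onto [f], because [smooth_conv] is about kernels of the exact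
   form [bumpn e G]. *)
pose g := conv (fun z => c * f z) (bumpn e G0).
have gE x : g x = integ (fun y => f (x + y) * rho y).
  rewrite /g convE; [|exact: Cc_scale|exact: cont_bumpn].
  by congr integ; apply/funext => y; rewrite /rho; ring.
exists g; split.
- by apply: smooth_conv => //; exact: Cc_scale.
- move=> x; rewrite gE; apply: Hd1 => // y dy; apply: (rd d1) => //.
  by rewrite !ge_min lexx /= orbT.
- move=> x fx; rewrite gE -[RHS](@integ0 R n); congr integ; apply/funext => y.
  have [yr|yr] := leP `|y| r; first by rewrite fx ?mul0r // addrAC subrr add0r.
  by rewrite (rd r) ?mulr0 // ge_min lexx.
- move=> Cf i x.
  have gE' : g = (fun x => integ (fun y => f (x + y) * rho y)) by apply/funext.
  have D := is_derive_param i x Cf (Cc_bsupp Hf) Hr.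
  rewrite {1}/partial gE' derive_val; apply: Hd2 => // y dy; apply: (rd d2) => //.
  by rewrite !ge_min lexx !orbT.
Qed.

Lemma smooth_C1 f : smooth f -> C1 f.
Proof.
move=> Hf; split; first by have [] := Hf [::].
move=> i; split; last by have [] := Hf [:: i].
move=> x; apply: DeriveDef => //; by have [_] := Hf [::]; apply.
Qed.

(** [K'] is the sum of [K] and a closed ball, compact as the image of a product under addition. It
    will hold the supports of mollified and translated functions. *)
Lemma compact_room (K U : set X) : compact K -> open U -> K `<=` U ->
  exists2 r : R, 0 < r & exists K', [/\ compact K', K' `<=` U &
    forall x y, K x -> `|y - x| <= r -> K' y].
Proof.
move=> cK oU KU.
have /compact_near_coveringP/(_ R 0^'+ (fun d x => forall y, `|x - y| <= d -> U y)) := cK.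
case.
  move=> x Kx.
  have [d d0 Hd] : exists2 d : R, 0 < d & forall y, `|x - y| < d -> U y.
    by apply: near_norm_ex; apply: open_nbhs_nbhs; split => //; exact: KU.
  have d20 : 0 < d / 2 by rewrite divr_gt0.
  exists ([set x' | `|x - x'| < d / 2], [set d' : R | d' < d / 2]) => /=.
    split; first exact: near_norm_lt.
    exact: nbhs_right_lt.
  move=> [x' d'] /= [xx' d'd] y x'y; apply: Hd.
  rewrite [d]splitr -(subrKA x') (le_lt_trans (ler_normD _ _))// ltrD//.
  by rewrite (le_lt_trans x'y).
move=> d /= d0 Hd.
have d20 : 0 < d / 2 by rewrite divr_gt0.
have HdU x y : K x -> `|x - y| <= d / 2 -> U y.
  move=> Kx xy; apply: (Hd (d / 2) _ d20 x Kx y) => //=.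
  by rewrite sub0r normrN gtr0_norm //; lra.
exists (d / 2) => //.
exists [set y | exists2 x, K x & `|y - x| <= d / 2]; split.
- rewrite (_ : [set y | _] = (fun p : X * X => p.1 + p.2) @` (K `*` [set z : X | `|z| <= d / 2])); last first.
    apply/seteqP; split => [y [x Kx xy]|_ [[x z] /= [Kx zd] <-]].
      by exists (x, y - x) => //=; rewrite addrC subrK.
    by exists x => //; rewrite addrAC subrr add0r.
  apply: continuous_compact; last by apply: compact_setX => //; exact: ball_compact.
  apply: continuous_subspaceT => p; exact: (@add_continuous X).
- by move=> y [x Kx xy]; apply: (HdU x) => //; rewrite distrC.
- by move=> x y Kx xy; exists x.
Qed.

Definition flux (F : 'I_n -> X -> R) f : R := integ (fun x => \sum_i F i x * partial i f x).

Lemma Cc_flux (F : 'I_n -> X -> R) f : (forall i, continuous (F i)) -> C1 f -> bsupp f ->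
  Cc (fun x => \sum_i F i x * partial i f x).
Proof. by move=> cF Hf bf; apply: Cc_sum => i; apply: Cc_mull => //; exact: Cc_partial. Qed.

(** [flux] sees only first derivatives, so it passes to the limit when gradients converge uniformly
    on a fixed compact set; mollification approximates [f] by test functions in this sense. *)
Lemma flux_C1 (F : 'I_n -> X -> R) (U : set X) : open U -> (forall i, continuous (F i)) ->
  (forall f, test_fun U f -> flux F f = 0) -> forall f, C1 f -> supp_in U f -> flux F f = 0.
Proof.
move=> oU cF H f Cf [K [cK KU fK]].
have bf : bsupp f by apply: (@supp_in_bsupp _ _ U); exists K.
have [r r0 [K' [cK' K'U HK']]] := compact_room cK oU KU.
have [M HM] : exists M, forall x, K' x -> `|x| <= M.
  have [M [_ HM]] := compact_bounded cK'; exists (M + 1) => x Kx.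
  by apply: (HM (M + 1)) => //; rewrite ltrDl.
pose B := fun x : X => \sum_i `|F i x| * plateau M x.
have HB : Cc B.
  by apply: Cc_sum => i; apply: Cc_mull; [exact: Cc_plateau|exact: cont_norm].
have B0 x : 0 <= B x by apply: sumr_ge0 => i _; rewrite mulr_ge0 // plateau_ge0.
apply: (@eq0_small _ _ (integ B)); first exact: integ_ge0.
move=> tau tau0.
have [g [sg _ g0 Hg]] := mollify (Cc_C1 Cf bf) tau0 r0.
have gK' x : ~ K' x -> g x = 0.
  move=> nK; apply: g0 => y yx; apply: fK => Ky; apply: nK; apply: (HK' y x) => //.
  by rewrite distrC.
have Cg := smooth_C1 sg.
have bg : bsupp g by apply: (@supp_in_bsupp _ _ U); exists K'.
have clK' := compact_closed_rV cK'.
have tg : test_fun U g.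
  have sK : Defs.support g `<=` K'.
    apply: (subset_trans _ clK'); apply: closure_subset => x /= gx.
    by apply: contrapT => nK; rewrite gK' ?eqxx in gx.
  split => //; split; last exact: subset_trans K'U.
  by apply: (subclosed_compact _ cK' sK); exact: closed_closure.
rewrite -[flux F f]subr0 -(H g tg) /flux -integ_sub; [|exact: Cc_flux|exact: Cc_flux].
rewrite -integ_scale //; apply: integ_norm_le; [|exact: Cc_scale|].
  by apply: Cc_sub; exact: Cc_flux.
move=> x; rewrite -sumrB /B mulr_sumr (le_trans (ler_norm_sum _ _ _)) //.
apply: ler_sum => i _; rewrite -mulrBr normrM mulrCA ler_wpM2l //.
have [Kx|nKx] := pselect (K' x).
  rewrite distrC; apply: le_trans (Hg Cf i x) _.
  by rewrite -{1}[tau]mulr1 ler_wpM2l ?(ltW tau0) // plateau_ge1 // HM.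
have nK y : ~ K' y -> ~ K y.
  by move=> nK' Ky; apply: nK'; apply: (HK' y y) => //; rewrite subrr normr0 ltW.
rewrite (partial_supp_in0 i clK' gK' nKx) (partial_supp_in0 i clK' _ nKx).
  by rewrite subrr normr0 mulr_ge0 ?plateau_ge0 ?(ltW tau0).
by move=> y /nK; exact: fK.
Qed.

End Mollify.

(** * C^1 steps and cut-offs *)

Section SmoothStep.
Variable R : realType.
Implicit Types t : R.

(* [1 - psq (1 - psq (t - 1))] is C^1 and satisfies [dstep^2 <= 16 step], which a generic step does not. *)
Definition psq t : R := Num.max t 0 ^+ 2.

Lemma is_derive_psq t : is_derive t (1:R) psq (2 * Num.max t 0).
Proof.
apply: (@is_derive_quadratic_error _ _ _ _ 1) => // h; rewrite /psq mul1r.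
rewrite ler_norml; case: (leP (t + h) 0) => a; case: (leP t 0) => b; apply/andP; split; nra.
Qed.

Definition step t : R := 1 - psq (1 - psq (t - 1)).
Definition dstep t : R := 4 * Num.max (1 - psq (t - 1)) 0 * Num.max (t - 1) 0.

Lemma is_derive_step t : is_derive t (1:R) step (dstep t).
Proof.
have D1 : is_derive t (1:R) (fun t => t - 1) 1.
  by rewrite -[X in is_derive _ _ _ X]subr0; apply: is_deriveB.
have D2 : is_derive t (1:R) (fun t => psq (t - 1)) (2 * Num.max (t - 1) 0 * 1).
  by apply: (@is_derive_comp1 R R (fun t => t - 1)); exact: is_derive_psq.
have D3 : is_derive t (1:R) (fun t => 1 - psq (t - 1)) (0 - 2 * Num.max (t - 1) 0 * 1) by exact: is_deriveB.
have D4 := is_derive_comp1 D3 (is_derive_psq (1 - psq (t - 1))).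
have D5 := is_deriveB (is_derive_cst (1:R) t (1:R)) D4.
apply: is_derive_eq D5 _; rewrite /dstep; ring.
Qed.

Lemma cont_dstep : continuous dstep.
Proof.
have c1 : continuous (fun t : R => Num.max (t - 1) 0).
  apply: cont_max; last exact: cst_continuous.
  by apply: cont_sub; [move=> x; exact: cvg_id|exact: cst_continuous].
apply: cont_mul => //; apply: cont_mul; first exact: cst_continuous.
apply: cont_max; last exact: cst_continuous.
by apply: cont_sub; [exact: cst_continuous|exact: cont_exp].
Qed.

Lemma step_facts t : [/\ 0 <= step t <= 1, 0 <= dstep t <= 4, dstep t ^+ 2 <= 16 * step t,
  t <= 1 -> step t = 0 /\ dstep t = 0 & 2 <= t -> step t = 1 /\ dstep t = 0].
Proof.
rewrite /step /dstep /psq.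
case: (leP (t - 1) 0) => a.
  rewrite expr0n /= subr0; case: (leP (1 : R) 0) => b; first lra.
  by rewrite expr1n !subrr !mulr0 expr0n /=; split; lra.
have a2 : 0 < (t - 1) ^+ 2 by rewrite exprn_gt0.
case: (leP (1 - (t - 1) ^+ 2) 0) => b.
  by rewrite expr0n /= subr0 !mulr0 !mul0r expr0n /=; split; lra.
have t2 : t - 1 < 1 by nra.
have b1 : 1 - (t - 1) ^+ 2 <= 1 by lra.
split; try (move=> ?; lra).
- nra.
- apply/andP; split; nra.
- have -> : (4 * (1 - (t - 1) ^+ 2) * (t - 1)) ^+ 2 = 16 * ((t - 1) ^+ 2 * (1 - (t - 1) ^+ 2) ^+ 2) by ring.
  rewrite ler_wpM2l //; move: ((t - 1) ^+ 2) a2 b b1 => z; nra.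
Qed.

End SmoothStep.

Section Cutoff.
Variables (R : realType) (n : nat).
Local Notation X := 'rV[R]_n.
Implicit Types (x y : X).

Definition box (c : X) (r : R) x : R := \prod_j (1 - step (r ^- 2 * (x 0 j - c 0 j) ^+ 2)).

Lemma C1_box c r : C1 (box c r).
Proof.
apply: C1_prod => j.
have [H1 _] := C1_coord R j.
have [H2 _] := C1_sub H1 (C1_cst n (c 0 j)).1.
have [H3 _] := C1_mul H2 H2.
have [H4 _] := C1_scale (r ^- 2) H3.
have [H5 _] := C1_comp H4 (@is_derive_step R) (@cont_dstep R).
exact: (C1_sub (C1_cst n 1).1 H5).1.
Qed.

Lemma box_itv c r x : 0 <= box c r x <= 1.
Proof.
rewrite prodr_ge0 => [|j _]; last by have [/andP[? ?] _ _ _ _] := step_facts (r ^- 2 * (x 0 j - c 0 j) ^+ 2); lra.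
by apply: prodr_ile1 => j _; have [/andP[? ?] _ _ _ _] := step_facts (r ^- 2 * (x 0 j - c 0 j) ^+ 2); lra.
Qed.

Lemma box1 c r x : 0 < r -> `|x - c| <= r -> box c r x = 1.
Proof.
move=> r0 xc; rewrite /box big1 // => j _.
have [_ _ _ H _] := step_facts (r ^- 2 * (x 0 j - c 0 j) ^+ 2).
have [|->] := H; last by rewrite subr0.
have := norm_coord (x - c) j; rewrite !mxE => xj.
rewrite ler_pdivrMl ?exprn_gt0 // mulr1 -[(_ - _) ^+ 2]real_normK ?num_real //.
by rewrite ler_pXn2r // ?nnegrE ?(ltW r0) //; exact: le_trans xc.
Qed.

Lemma box0 c r x : 0 < r -> 2 * r < `|x - c| -> box c r x = 0.
Proof.
move=> r0 xc.
have [j xj] : exists j, 2 * r < `|(x - c) 0 j|.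
  apply/not_existsP => H; suff : `|x - c| <= 2 * r by lra.
  by apply: norm_rV_le => [|i]; [lra|have /negP := H i; rewrite -leNgt].
rewrite /box (bigD1 j) //=.
have [_ _ _ _ H] := step_facts (r ^- 2 * (x 0 j - c 0 j) ^+ 2).
have [|->] := H; last by rewrite subrr mul0r.
rewrite !mxE in xj.
rewrite ler_pdivlMl ?exprn_gt0 // -[(_ - _) ^+ 2]real_normK ?num_real //.
by move: (`|_|) xj => z; nra.
Qed.

Lemma cutoff (K U : set X) : compact K -> open U -> K `<=` U ->
  exists z V, [/\ C1 z, forall x, 0 <= z x <= 1, supp_in U z, open V & K `<=` V /\ forall x, V x -> z x = 1].
Proof.
move=> cK oU KU.
have [r r0 [K' [cK' K'U HK']]] := compact_room cK oU KU.
have r20 : 0 < r / 2 by rewrite divr_gt0.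
have cK1 := cK; rewrite compact_cover in cK1.
have [||D DK KD] := cK1 X K (fun c => [set x | `|c - x| < r / 2]).
- move=> c _; rewrite openE => x /= xc.
  have H : 0 < r / 2 - `|c - x| by lra.
  apply: filterS (near_norm_lt x H) => y /= xy.
  by have := ler_normD (c - x) (x - y); rewrite subrKA; lra.
- by move=> x Kx; exists x => //=; rewrite subrr normr0.
have [s sK Ks] : exists2 s : seq X, (forall c, c \in s -> K c) & forall x, K x -> exists2 c, c \in s & `|c - x| < r / 2.
  exists (finmap.enum_fset D) => [c cD|x Kx]; first by have := DK c cD; rewrite inE.
  by have [c cD xc] := KD x Kx; exists c.
(* This combination equals [1] wherever one of the boxes does and stays within [[0, 1]]. Boxes of
   size [r / 2] vanish beyond distance [r] from their centres, hence outside [K']. *)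
pose z x := 1 - \prod_(c <- s) (1 - box c (r / 2) x).
pose V := \bigcup_(c in [set c | c \in s]) [set x | `|c - x| < r / 2].
have P01 x c : 0 <= 1 - box c (r / 2) x <= 1 by have /andP[? ?] := box_itv c (r / 2) x; lra.
exists z, V; split.
- apply: (C1_sub (C1_cst n 1).1 _).1; apply: C1_prod => c.
  exact: (C1_sub (C1_cst n 1).1 (C1_box _ _)).1.
- move=> x; rewrite /z.
  have : 0 <= \prod_(c <- s) (1 - box c (r / 2) x).
    by apply: prodr_ge0 => c _; have /andP[] := P01 x c.
  have : \prod_(c <- s) (1 - box c (r / 2) x) <= 1.
    by apply: prodr_ile1 => c _; exact: P01.
  lra.
- exists K'; split => // x nK; rewrite /z big_seq big1 ?subrr // => c cD.
  rewrite box0 ?subr0 //; rewrite mulrCA mulfV // mulr1 ltNge; apply/negP => xc.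
  by apply: nK; apply: (HK' c) => //; exact: sK.
- apply: bigcup_open => c _; rewrite openE => x /= xc.
  have H : 0 < r / 2 - `|c - x| by lra.
  apply: filterS (near_norm_lt x H) => y /= xy.
  by have := ler_normD (c - x) (x - y); rewrite subrKA; lra.
split; first by move=> x /Ks[c cs xc]; exists c.
move=> x [c cD xc]; rewrite /z (perm_big _ (perm_to_rem cD)) big_cons.
have -> : box c (r / 2) x = 1 by apply: box1 => //; rewrite distrC ltW.
by rewrite /= subrr mul0r subr0.
Qed.

Lemma compact_lower_bound (K : set X) (g : X -> R) : compact K -> continuous g ->
  (forall x, K x -> 0 < g x) -> exists2 m : R, 0 < m & forall x, K x -> m <= g x.
Proof.
move=> cK cg g0.
have /compact_near_coveringP/(_ R 0^'+ (fun d x => d <= g x)) := cK.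
case.
  move=> x Kx.
  have gx2 : 0 < g x / 2 by rewrite divr_gt0 // g0.
  have [d d0 Hd] := @continuous_eps_delta R X g x (cg x) _ gx2.
  exists ([set x' | `|x - x'| < d], [set d' : R | d' < g x / 2]) => /=.
    by split; [exact: near_norm_lt|exact: nbhs_right_lt].
  move=> [x' d'] /= [/Hd xx' d'd]; rewrite ltr_norml in xx'; lra.
move=> d /= d0 Hd; exists (d / 2); first by rewrite divr_gt0.
move=> x Kx; apply: Hd => //=; last by rewrite divr_gt0.
by rewrite sub0r normrN gtr0_norm ?divr_gt0 // ltr_pdivrMr // ltr_pMr // ltr1n.
Qed.

Lemma compact_closedI (K A : set X) : compact K -> closed A -> compact (K `&` A).
Proof.
move=> cK cA; apply: (subclosed_compact _ cK); last by move=> x [].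
by apply: closedI => //; exact: compact_closed_rV.
Qed.

Lemma closed_ge (g : X -> R) (a : R) : continuous g -> closed [set x | a <= g x].
Proof.
move=> cg; rewrite (_ : [set x | _] = g @^-1` [set t | a <= t]) //.
by apply: preimage_closed; [move=> x _; exact: cg|exact: closed_ge].
Qed.

Lemma open_gt (g : X -> R) (a : R) : continuous g -> open [set x | a < g x].
Proof.
move=> cg; rewrite (_ : [set x | _] = g @^-1` [set t | a < t]) //.
by apply: open_comp; [move=> x _; exact: cg|exact: open_gt].
Qed.

End Cutoff.

(** * Regular points of the zero set *)

Section StepSquare.
Variable R : realType.
Implicit Types t : R.

Definition qs t : R := step (t ^+ 2).
Definition dqs t : R := 2 * t * dstep (t ^+ 2).

Lemma is_derive_qs t : is_derive t (1:R) qs (dqs t).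
Proof.
have D := is_deriveX 2 (is_derive_id t (1:R)).
have D' := is_derive_comp1 D (is_derive_step (t ^+ 2)).
apply: is_derive_eq D' _.
by rewrite /dqs /GRing.scale /= expr1 mulr1 mulr_natl mulrC.
Qed.

Lemma cont_dqs : continuous dqs.
Proof.
have ci : continuous (fun t : R => t) by move=> x; exact: cvg_id.
apply: cont_mul; first by apply: cont_mul => //; exact: cst_continuous.
by apply: cont_comp; [exact: cont_exp|exact: cont_dstep].
Qed.

(** Both errors are measured against [1 / (1 + t^2)], the derivative of [atan], since this is the
    profile that the layer estimate integrates. They live on [t^2 < 2], where [1 + t^2 < 3]; there
    [|dqs| <= 4 * 4], whence [48]. *)
Lemma qs_facts t : [/\ 0 <= qs t <= 1, `|qs t - 1| <= 3 / (1 + t ^+ 2), `|dqs t| <= 48 / (1 + t ^+ 2)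
  & t ^+ 2 <= 1 -> qs t = 0 /\ dqs t = 0].
Proof.
rewrite /qs /dqs; have t0 := sqr_ge0 t.
have [/andP[s0 s1] /andP[d0 d4] _ H1 H2] := step_facts (t ^+ 2).
have T : 0 < 1 + t ^+ 2 by rewrite ltr_wpDr.
split; first by rewrite s0 s1.
- rewrite ler_pdivlMr //; have [t2|t2] := leP 2 (t ^+ 2).
    by have [-> _] := H2 t2; rewrite subrr normr0 mul0r.
  rewrite ler0_norm; last lra.
  by nra.
- rewrite ler_pdivlMr // normrM (ger0_norm d0); have [t2|t2] := leP 2 (t ^+ 2).
    by have [_ ->] := H2 t2; rewrite mulr0 mul0r.
  have : `|2 * t| <= 4.
    by rewrite ler_norml; apply/andP; split; nra.
  move: (`|2 * t|) (normr_ge0 (2 * t)) => a a0 a4.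
  have : a * dstep (t ^+ 2) <= 4 * 4 by rewrite ler_pM.
  have : 0 <= a * dstep (t ^+ 2) by rewrite mulr_ge0.
  nra.
- by move=> /H1[-> ->]; rewrite mulr0.
Qed.

End StepSquare.

Lemma cont_inv1sq (R : realType) : continuous (fun t : R => (1 + t ^+ 2)^-1).
Proof.
move=> t; apply: (@continuousV _ _ (fun t : R => 1 + t ^+ 2)).
  by rewrite gt_eqF // ltr_wpDr ?sqr_ge0.
have ci : continuous (fun t : R => t) by move=> x; exact: cvg_id.
by apply: cont_add; [exact: cst_continuous|exact: cont_exp].
Qed.

Section RegularLevel.
Variables (R : realType) (n : nat).
Local Notation X := 'rV[R]_n.
Implicit Types (x y : X).
Variables (F : 'I_n -> X -> R) (u : X -> R) (V : set X).
Hypotheses (cF : forall i, continuous (F i)) (Cu : C1 u) (bu : bsupp u) (oV : open V).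
Hypothesis Fu : forall f, C1 f -> supp_in (V `&` [set x | u x != 0]) f -> flux F f = 0.

Definition gradsq x : R := \sum_i partial i u x ^+ 2.

Lemma cont_gradsq : continuous gradsq.
Proof. by apply: cont_sum => i; apply: cont_exp; exact: C1_partial_cont. Qed.

Lemma partial_bounded : exists2 L : R, 0 < L & forall i x, `|partial i u x| <= L.
Proof.
have /choice[M HM] : forall i, exists M : R, 0 < M /\ forall x, `|partial i u x| <= M.
  by move=> i; have [M M0 HM] := bsupp_bounded (C1_partial_cont Cu) (partial_bsupp i bu); exists M.
exists (1 + \sum_i M i); first by rewrite ltr_pwDl ?sumr_ge0 // => i _; exact: ltW (HM i).1.
move=> i x; apply: le_trans ((HM i).2 x) _; rewrite (bigD1 i) //= addrCA lerDl addr_ge0 // sumr_ge0 // => j _.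
exact: ltW (HM j).1.
Qed.

Lemma dq_partial_uniform (e : R) : 0 < e ->
  exists2 d : R, 0 < d & forall i h x, h != 0 -> `|h| <= d -> `|dq h i u x - partial i u x| <= e.
Proof.
move=> e0.
apply: (finite_uniform (P := fun i d => forall h x, h != 0 -> `|h| <= d -> `|dq h i u x - partial i u x| <= e)).
  by move=> i d d' dd Hd h x h0 hd; apply: Hd => //; exact: le_trans dd.
by move=> i; have [d d0 Hd] := dq_uniform i Cu bu e0; exists d.
Qed.

Lemma C1_dq (f : X -> R) i h : C1 f -> C1 (dq h i f) /\ forall j, partial j (dq h i f) = dq h i (partial j f).
Proof.
move=> Hf; have [H1 E1] := C1_translate (h *: ebasis R i) Hf.
have [H2 E2] := C1_sub H1 Hf; have [H3 E3] := C1_scale h^-1 H2.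
by split => // j; rewrite /dq E3 E2 E1.
Qed.

(** The gradient of [u] is only continuous, so the transversal field is [P], the difference
    quotients of [u] at one fixed step: it is C^1 and still satisfies [P . Du >= m / 2] on the
    support of [z]. Integration by parts moves the derivative from [atan (a u)], bounded by
    [pi / 2], onto [z P]. So the integral of [z P . D(atan (a u))] is bounded independently of [a],
    while it is at least [a m / 2] times the layer integral. *)
Lemma level_layer_bound (z : X -> R) (m : R) : 0 < m -> C1 z -> bsupp z -> (forall x, 0 <= z x) ->
  (forall x, z x != 0 -> m <= gradsq x) ->
  exists2 C : R, 0 <= C & forall a, 0 < a -> integ (fun x => z x / (1 + (a * u x) ^+ 2)) <= C / a.
Proof.
move=> m0 Cz bz z0 Hm.
have [L L0 HL] := partial_bounded.
(* Keeps the error [n tau L] of replacing one factor [Du] by [P] in [|Du|^2] below [m / 2]. *)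
pose tau := m / (2 * (n%:R * L + 1)).
have nL : 0 < n%:R * L + 1 by rewrite ltr_wpDl // mulr_ge0 // ltW.
have tau0 : 0 < tau by rewrite divr_gt0 // mulr_gt0.
have [d d0 Hd] := dq_partial_uniform tau0.
pose P i := dq d i u.
have CP i := (C1_dq i d Cu).1.
have HP x : z x != 0 -> m / 2 <= \sum_i P i x * partial i u x.
  move=> zx; have := Hm x zx.
  have : `|\sum_i P i x * partial i u x - gradsq x| <= n%:R * (tau * L).
    rewrite /gradsq -sumrB (le_trans (ler_norm_sum _ _ _)) //.
    have -> : n%:R * (tau * L) = \sum_(i < n) tau * L by rewrite sumr_const card_ord mulr_natl.
    apply: ler_sum => i _; rewrite expr2 -mulrBl normrM ler_pM //.
    by apply: Hd; rewrite ?gt_eqF // gtr0_norm.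
  have : n%:R * (tau * L) <= m / 2.
    have -> : n%:R * (tau * L) = m / 2 * ((n%:R * L) / (n%:R * L + 1)).
      by rewrite /tau; field; rewrite gt_eqF.
    by rewrite ler_piMr ?divr_ge0 ?(ltW m0) // ler_pdivrMr // mul1r lerDl.
  rewrite ler_norml; lra.
pose zP i x := z x * P i x.
have CzP i : C1 (zP i) by exact: (C1_mul Cz (CP i)).1.
have bzP i : bsupp (zP i) by exact: bsupp_mull.
pose S := integ (fun x => \sum_i `|partial i (zP i) x|).
have HS : Cc (fun x => \sum_i `|partial i (zP i) x|).
  by apply: Cc_sum => i; apply: Cc_norm; exact: Cc_partial.
have S0 : 0 <= S by apply: integ_ge0 => // x; exact: sumr_ge0.
exists (2 / m * (pi / 2 * S)).
  by rewrite !mulr_ge0 ?invr_ge0 ?(ltW m0) ?(ltW (pi_gt0 R)).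
move=> a a0.
have [Cau Eau] := C1_scale a Cu.
have [Cat Eat] := C1_comp Cau (@is_derive1_atan R) (@cont_inv1sq R).
have Hw : Cc (fun x => z x / (1 + (a * u x) ^+ 2)).
  apply: Cc_mulr; first exact: Cc_C1.
  exact: (cont_comp (C1_cont Cau) (@cont_inv1sq R)).
pose T x := \sum_i zP i x * partial i (fun x => atan (a * u x)) x.
have HT : Cc T.
  by apply: Cc_sum => i; apply: Cc_mulr; [exact: Cc_C1|exact: C1_partial_cont].
have TE x : T x = a * (\sum_i P i x * partial i u x) * (z x / (1 + (a * u x) ^+ 2)).
  rewrite /T mulr_sumr mulr_suml; apply: eq_bigr => i _.
  by rewrite Eat Eau /zP; ring.
have IT : integ T <= pi / 2 * S.
  rewrite /T integ_sum; last first.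
    by move=> i; apply: Cc_mulr; [exact: Cc_C1|exact: C1_partial_cont].
  rewrite /S integ_sum; last by move=> i; apply: Cc_norm; exact: Cc_partial.
  rewrite mulr_sumr; apply: ler_sum => i _.
  rewrite (integ_parts i (CzP i) Cat (bzP i)) -integ_scale; last by apply: Cc_norm; exact: Cc_partial.
  have Hpa : Cc (fun x => partial i (zP i) x * atan (a * u x)).
    by apply: Cc_mulr; [exact: Cc_partial|exact: C1_cont].
  rewrite -integ_opp //; apply: integ_le; [exact: Cc_opp|by apply: Cc_scale; apply: Cc_norm; exact: Cc_partial|].
  move=> x; rewrite (le_trans (ler_norm _)) // normrN normrM mulrC ler_wpM2r //.
  by rewrite ler_norml ltW ?atan_gtNpi2 //= ltW // atan_ltpi2.
rewrite ler_pdivlMr // mulrC -integ_scale //.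
apply: (@le_trans _ _ (2 / m * integ T)); last by rewrite ler_wpM2l // divr_ge0 // ltW.
rewrite -integ_scale //; apply: integ_le; [exact: Cc_scale|exact: Cc_scale|].
move=> x; rewrite TE.
have [zx|zx] := eqVneq (z x) 0; first by rewrite zx mul0r !mulr0.
have w0 : 0 <= z x / (1 + (a * u x) ^+ 2) by rewrite divr_ge0 // addr_ge0 // sqr_ge0.
rewrite [leRHS]mulrA ler_wpM2r //.
have -> : 2 / m * (a * \sum_i P i x * partial i u x) = a * (2 / m * \sum_i P i x * partial i u x) by ring.
rewrite ler_peMr ?(ltW a0) //.
have H := HP x zx.
have -> : 2 / m * (\sum_i P i x * partial i u x) = (\sum_i P i x * partial i u x) / (m / 2).
  by field; rewrite gt_eqF.
by rewrite ler_pdivlMr ?mul1r // divr_gt0.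
Qed.

(** The factor [qs (a u)] vanishes near [{u = 0}] and makes the test function admissible. Its
    derivative costs a factor [a], which only cancels the width [1 / a] of the layer; smallness has
    to come from the field in front, so [f F] is replaced there by [f F - Y], at most [tau], and the
    part with [Y] is integrated by parts. *)
Lemma flux_regular (f : X -> R) : C1 f -> supp_in (V `&` [set x | 0 < gradsq x]) f -> flux F f = 0.
Proof.
move=> Cf [K [cK KV fK]].
have clK := compact_closed_rV cK.
have oV' : open (V `&` [set x | 0 < gradsq x]).
  by apply: openI => //; apply: open_gt; exact: cont_gradsq.
have [z [W [Cz z01 [K1 [cK1 K1V zK1]] oW [KW zW]]]] := cutoff cK oV' KV.
have bz : bsupp z by apply: (@supp_in_bsupp _ _ setT); exists K1.
have bf : bsupp f by apply: (@supp_in_bsupp _ _ setT); exists K.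
have z0 x : 0 <= z x by have /andP[] := z01 x.
have [m m0 Hm] := compact_lower_bound cK1 cont_gradsq (fun x Kx => (K1V x Kx).2).
have Hm' x : z x != 0 -> m <= gradsq x.
  by move=> zx; apply: Hm; apply: contrapT => nK; rewrite zK1 ?eqxx in zx.
have [C C0 HC] := level_layer_bound m0 Cz bz z0 Hm'.
have [L L0 HL] := partial_bounded.
have nKf x : ~ K x -> f x = 0 /\ forall i, partial i f x = 0.
  by move=> nK; split; [exact: fK|move=> i; exact: (partial_supp_in0 i clK fK nK)].
pose A x := \sum_i F i x * partial i f x.
have HA : Cc A := Cc_flux cF Cf bf.
have [M M0 HM] := bsupp_bounded (Cc_cont HA) (Cc_bsupp HA).
have MA x : `|A x| <= M * z x.
  have [Kx|nKx] := pselect (K x); first by rewrite (zW _ (KW x Kx)) mulr1.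
  rewrite /A big1 ?normr0 ?mulr_ge0 ?(ltW M0) // => i _.
  by have [_ ->] := nKf x nKx; rewrite mulr0.
apply: (@eq0_small _ _ (48 * n%:R * L * C + 1)).
  by rewrite addr_ge0 // !mulr_ge0 // ltW.
move=> tau tau0.
have [r r0 [K' [cK' K'W HK']]] := compact_room cK oW KW.
have KK' x : K x -> K' x by move=> Kx; apply: (HK' x x) => //; rewrite subrr normr0 ltW.
have clK' := compact_closed_rV cK'.
have [Y HY] : exists Y : 'I_n -> X -> R, forall i, [/\ C1 (Y i), forall x, `|Y i x - f x * F i x| <= tau &
    forall x, ~ K' x -> Y i x = 0].
  suff /choice[Y HY] : forall i, exists Yi : X -> R, [/\ C1 Yi, forall x, `|Yi x - f x * F i x| <= tau &
    forall x, ~ K' x -> Yi x = 0] by exists Y.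
  move=> i.
  have Hi : Cc (fun x => f x * F i x) by apply: Cc_mulr; [exact: Cc_C1|exact: cF].
  have [g [sg gf g0 _]] := mollify Hi tau0 r0.
  exists g; split => //; first exact: smooth_C1.
  move=> x nK; apply: g0 => y yx; rewrite fK ?mul0r // => Ky.
  by apply: nK; apply: (HK' y) => //; rewrite distrC.
have CY i : C1 (Y i) by have [] := HY i.
have bY i : bsupp (Y i).
  by have [_ _ H] := HY i; apply: (@supp_in_bsupp _ _ setT); exists K'.
pose D x := \sum_i partial i (Y i) x.
have HD : Cc D by apply: Cc_sum => i; exact: Cc_partial.
have [M' M'0 HM'] := bsupp_bounded (Cc_cont HD) (Cc_bsupp HD).
have MD x : `|D x| <= M' * z x.
  have [Kx|nKx] := pselect (K' x); first by rewrite (zW _ (K'W x Kx)) mulr1.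
  rewrite /D big1 ?normr0 ?mulr_ge0 ?(ltW M'0) // => i _.
  by have [_ _ H] := HY i; exact: (partial_supp_in0 i clK' H nKx).
have MY i x : `|f x * F i x - Y i x| <= tau * z x.
  have [_ H1 H2] := HY i.
  have [Kx|nKx] := pselect (K' x); first by rewrite (zW _ (K'W x Kx)) mulr1 distrC.
  rewrite H2 // fK; last by move=> /KK'.
  by rewrite mul0r subrr normr0 mulr_ge0 // ltW.
(* [a] is chosen after [Y], because the bound [M'] of [div Y] may grow as [tau] decreases. With this
   value the terms with [M] and [M'] contribute at most [tau]. *)
pose a := (3 * M + 3 * M') * C / tau + 1.
have a0 : 0 < a.
  by rewrite ltr_wpDl // divr_ge0 ?(ltW tau0) // mulr_ge0 // addr_ge0 // mulr_ge0 // ltW.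
have [Cau Eau] := C1_scale a Cu.
have [Cq Eq] := C1_comp Cau (@is_derive_qs R) (@cont_dqs R).
have [Cg Eg] := C1_mul Cf Cq.
have Fg : flux F (fun x => f x * qs (a * u x)) = 0.
  apply: Fu => //; exists (K `&` [set x | 1 <= (a * u x) ^+ 2]); split.
  - apply: compact_closedI => //; apply: (@closed_ge _ _ (fun x => (a * u x) ^+ 2)).
    exact: cont_exp (C1_cont Cau).
  - move=> x [Kx ux]; split; first by have [] := KV x Kx.
    by apply/eqP => ux0; move: ux; rewrite /= ux0 mulr0 expr0n /= ler10.
  - move=> x nK; have [Kx|nKx] := pselect (K x); last by rewrite fK ?mul0r.
    have [//|ux] := leP 1 ((a * u x) ^+ 2); first by move=> h; case: nK; split.
    by have [_ _ _ H] := qs_facts (a * u x); have [-> _] := H (ltW ux); rewrite mulr0.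
(* Subtracting [1] changes no derivative, but after the integration by parts it leaves [div Y]
   multiplied by a function concentrated near the zero set. *)
have [Ct Et] := C1_sub Cq (C1_cst n 1).1.
pose w x := z x / (1 + (a * u x) ^+ 2).
have Hw : Cc w.
  apply: Cc_mulr; first exact: Cc_C1.
  exact: (cont_comp (C1_cont Cau) (@cont_inv1sq R)).
pose T x := \sum_i Y i x * partial i (fun x => qs (a * u x) - 1) x.
have HT : Cc T by apply: Cc_sum => i; apply: Cc_mulr; [exact: Cc_C1|exact: C1_partial_cont].
pose T' x := D x * (qs (a * u x) - 1).
have HT' : Cc T' by apply: Cc_mulr => //; exact: C1_cont.
have ITT' : integ T = - integ T'.
  rewrite /T integ_sum; last by move=> i; apply: Cc_mulr; [exact: Cc_C1|exact: C1_partial_cont].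
  have -> : T' = fun x => \sum_i partial i (Y i) x * (qs (a * u x) - 1).
    by apply/funext => x; rewrite /T' /D mulr_suml.
  rewrite integ_sum; last by move=> i; apply: Cc_mulr; [exact: Cc_partial|exact: C1_cont].
  rewrite -sumrN; apply: eq_bigr => i _; exact: (integ_parts i (CY i) Ct (bY i)).
have bg : bsupp (fun x => f x * qs (a * u x)) by exact: bsupp_mull.
have HG := Cc_flux cF Cg bg.
(* The flux of [f qs (a u)] is zero and [T + T'] integrates to zero, so both may be inserted; the
   resulting integrand is bounded pointwise by a multiple of the layer profile [w]. *)
have -> : flux F f = integ (fun x => A x - \sum_i F i x * partial i (fun x => f x * qs (a * u x)) x + T x + T' x).
  rewrite integ_add //; last by apply: Cc_add => //; exact: Cc_sub.
  rewrite integ_add //; last exact: Cc_sub.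
  by rewrite integ_sub // ITT' -addrA addNr addr0 -/(flux F (fun x => f x * qs (a * u x))) Fg subr0.
have Hc : 0 <= 3 * M + 3 * M' + 48 * n%:R * L * a * tau.
  by rewrite !addr_ge0 // !mulr_ge0 // ltW.
apply: (@le_trans _ _ (integ (fun x => (3 * M + 3 * M' + 48 * n%:R * L * a * tau) * w x))); last first.
  rewrite integ_scale //; apply: (@le_trans _ _ ((3 * M + 3 * M' + 48 * n%:R * L * a * tau) * (C / a))).
    by rewrite ler_wpM2l //; exact: HC.
  rewrite mulrA ler_pdivrMr //.
  have -> : tau * (48 * n%:R * L * C + 1) * a = 48 * n%:R * L * a * tau * C + tau * a by ring.
  rewrite mulrDl addrC lerD2l.
  by rewrite -[leLHS]mulrC -ler_pdivrMl // mulrC [_^-1 * _]mulrC /a lerDl.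
apply: integ_norm_le; [|exact: Cc_scale|].
  by apply: Cc_add => //; apply: Cc_add => //; exact: Cc_sub.
move=> x.
have [_ Q1 Q2 _] := qs_facts (a * u x).
have -> : A x - \sum_i F i x * partial i (fun x => f x * qs (a * u x)) x + T x + T' x
  = - (qs (a * u x) - 1) * A x + (qs (a * u x) - 1) * D x
    - \sum_i (f x * F i x - Y i x) * (dqs (a * u x) * (a * partial i u x)).
  have -> : A x - \sum_i F i x * partial i (fun x => f x * qs (a * u x)) x + T x
    = \sum_i (F i x * partial i f x - F i x * partial i (fun x => f x * qs (a * u x)) x
              + Y i x * partial i (fun x => qs (a * u x) - 1) x).
    by rewrite big_split /= sumrB.
  rewrite [- _ * A x + _]addrC -[RHS]addrA [LHS]addrC /T' [D x * _]mulrC; congr (_ + _).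
  rewrite /A mulr_sumr -sumrB; apply: eq_bigr => i _.
  rewrite Eg Et Eq Eau (C1_cst n 1).2; ring.
have T0 : 0 < 1 + (a * u x) ^+ 2 by rewrite ltr_wpDr ?sqr_ge0.
have N1 : `|(qs (a * u x) - 1) * A x| <= 3 * M * w x.
  rewrite normrM /w.
  have -> : 3 * M * (z x / (1 + (a * u x) ^+ 2)) = 3 / (1 + (a * u x) ^+ 2) * (M * z x) by ring.
  exact: ler_pM.
have N2 : `|(qs (a * u x) - 1) * D x| <= 3 * M' * w x.
  rewrite normrM /w.
  have -> : 3 * M' * (z x / (1 + (a * u x) ^+ 2)) = 3 / (1 + (a * u x) ^+ 2) * (M' * z x) by ring.
  exact: ler_pM.
have N3 : `|\sum_i (f x * F i x - Y i x) * (dqs (a * u x) * (a * partial i u x))| <= 48 * n%:R * L * a * tau * w x.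
  rewrite (le_trans (ler_norm_sum _ _ _)) //.
  have -> : 48 * n%:R * L * a * tau * w x = \sum_(i < n) (tau * z x) * (48 / (1 + (a * u x) ^+ 2) * (a * L)).
    by rewrite sumr_const card_ord -mulr_natl /w; ring.
  apply: ler_sum => i _; rewrite normrM ler_pM // normrM ler_pM // normrM (gtr0_norm a0).
  by rewrite ler_wpM2l // ltW.
have -> : (3 * M + 3 * M' + 48 * n%:R * L * a * tau) * w x
  = 3 * M * w x + 3 * M' * w x + 48 * n%:R * L * a * tau * w x by ring.
apply: le_trans (ler_normB _ _) (lerD _ N3); rewrite mulNr.
by apply: le_trans (ler_normD _ _) (lerD _ N2); rewrite normrN.
Qed.

End RegularLevel.

(** * Pointwise energy inequality for the differenced equation *)

Section CauchySchwarz.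
Variable R : realType.

Lemma cauchy_schwarz (I : finType) (x y : I -> R) :
  (\sum_i x i * y i) ^+ 2 <= (\sum_i x i ^+ 2) * (\sum_i y i ^+ 2).
Proof.
set T := \sum_i x i * y i; set S := \sum_i y i ^+ 2; set A := \sum_i x i ^+ 2.
have S0 : 0 <= S by apply: sumr_ge0 => i _; exact: sqr_ge0.
have A0 : 0 <= A by apply: sumr_ge0 => i _; exact: sqr_ge0.
have H : 0 <= S * (A * S - T ^+ 2).
  have -> : S * (A * S - T ^+ 2) = \sum_i (x i * S - y i * T) ^+ 2.
    rewrite (eq_bigr (fun i => S ^+ 2 * x i ^+ 2 + (- (2 * S * T)) * (x i * y i) + T ^+ 2 * y i ^+ 2)).
      by rewrite !big_split /= -!mulr_sumr -/T -/S -/A; ring.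
    by move=> i _; ring.
  by apply: sumr_ge0 => i _; exact: sqr_ge0.
move: S0; rewrite le_eqVlt => /orP[/eqP S0|S0]; last first.
  by rewrite pmulr_rge0 // in H; lra.
have y0 i : y i = 0.
  apply/eqP; rewrite -sqrf_eq0; apply/eqP.
  have /psumr_eq0P : \sum_i y i ^+ 2 = 0 by rewrite -/S.
  by move=> /(_ (fun i _ => sqr_ge0 _)) ->.
rewrite -S0 mulr0 /T big1 ?expr0n //= => i _; by rewrite y0 mulr0.
Qed.

Lemma le_sqrt_prod (y A B : R) : 0 <= A -> 0 <= B -> y ^+ 2 <= A * B ->
  `|y| <= Num.sqrt A * Num.sqrt B.
Proof. by move=> A0 B0 H; rewrite -sqrtrM // -sqrtr_sqr ler_wsqrtr. Qed.

Lemma cauchy_schwarz_norm (I : finType) (x y : I -> R) :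
  `|\sum_i x i * y i| <= Num.sqrt (\sum_i x i ^+ 2) * Num.sqrt (\sum_i y i ^+ 2).
Proof.
apply: le_sqrt_prod; last exact: cauchy_schwarz.
- by apply: sumr_ge0 => i _; exact: sqr_ge0.
- by apply: sumr_ge0 => i _; exact: sqr_ge0.
Qed.

Lemma young (A B y : R) : 0 <= A -> 0 <= B -> y ^+ 2 <= A * B -> 2 * `|y| <= A + B.
Proof.
move=> A0 B0 H; rewrite -(ler_pXn2r (_ : (0 < 2)%N)) // ?nnegrE ?addr_ge0 ?mulr_ge0 //.
rewrite exprMn real_normK ?num_real //.
have : 0 <= (A - B) ^+ 2 by exact: sqr_ge0.
nra.
Qed.

End CauchySchwarz.

Section Algebra.
Variables (R : realType) (n : nat).
Variables (w zd : 'I_n -> R) (d E : 'I_n -> 'I_n -> R) (a kp g dg z b c1 c2 : R).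

Local Notation "'SS' x" := (\sum_k \sum_i x k i ^+ 2) (at level 10).
Let lam := \sum_k w k ^+ 2.
(** The rows [d k] will be difference quotients of [Du], so [d] need not be symmetric: contracting
    its second index ([wd]) or its first ([V]) gives different vectors. [V] is half the gradient of
    [lam]. *)
Let wd k := \sum_i w i * d k i.
Let V i := \sum_k w k * d k i.
Let wV := \sum_i w i * V i.
(* Linearization at [w] of [xi |-> |xi|^kp xi] applied to the rows of [d], with [a = |w|^kp]. *)
Definition linearized k i := a * (d k i + kp / lam * wd k * w i).
(* Gradient of the test function [z^2 g(lam) w_k] when [d k] is the gradient of [w_k] and [zd] that of [z]. *)
Definition test_grad k i := z ^+ 2 * (g * d k i + 2 * dg * (w k * V i)) + 2 * z * g * (w k * zd i).

Lemma wsum_sq_le (x : 'I_n -> 'I_n -> R) :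
  \sum_i (\sum_k w k * x k i) ^+ 2 <= lam * SS x.
Proof.
rewrite exchange_big /= mulr_sumr; apply: ler_sum => i _; exact: cauchy_schwarz.
Qed.

Lemma double_cauchy_schwarz (x y : 'I_n -> 'I_n -> R) :
  `|\sum_k \sum_i x k i * y k i| <= Num.sqrt (SS x) * Num.sqrt (SS y).
Proof.
rewrite !pair_bigA /=.
exact: (@cauchy_schwarz_norm R _ (fun p => x p.1 p.2) (fun p => y p.1 p.2)).
Qed.

Lemma SS_ge0 (x : 'I_n -> 'I_n -> R) : 0 <= SS x.
Proof. by apply: sumr_ge0 => k _; apply: sumr_ge0 => i _; exact: sqr_ge0. Qed.

Lemma wVE : \sum_k w k * wd k = wV.
Proof.
rewrite /wd /wV /V.
under eq_bigr do rewrite mulr_sumr.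
rewrite exchange_big /=; apply: eq_bigr => i _; rewrite mulr_sumr.
by apply: eq_bigr => k _; ring.
Qed.

Hypotheses (lam0 : 0 < lam) (a0 : 0 < a) (kp1 : -1 < kp) (c11 : c1 <= 1) (c1kp : c1 <= 1 + kp)
  (c2kp : `|kp| <= c2 - 1) (g0 : 0 <= g) (b0 : 0 <= b) (b1 : b <= 1) (dgb : - (1 - b) * g <= 2 * dg * lam)
  (z0 : 0 <= z) (c10 : 0 <= c1).

Let D := Num.sqrt (SS d).
Let E0 := Num.sqrt (SS E).
Let Zd := Num.sqrt (\sum_i zd i ^+ 2).
Let t := Num.sqrt lam.

Let S1 := \sum_k \sum_i linearized k i * d k i.
Let S2 := \sum_k \sum_i linearized k i * (w k * V i).
Let T1 := \sum_k \sum_i linearized k i * (w k * zd i).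

Lemma wd_sq k : wd k ^+ 2 <= lam * \sum_i d k i ^+ 2.
Proof. exact: cauchy_schwarz. Qed.

Lemma linearized_energyE : S1 = a * \sum_k (\sum_i d k i ^+ 2 + kp / lam * wd k ^+ 2).
Proof.
rewrite mulr_sumr; apply: eq_bigr => k _.
rewrite (eq_bigr (fun i => a * (d k i ^+ 2) + (a * (kp / lam) * wd k) * (w i * d k i))).
  by rewrite big_split /= -!mulr_sumr -/(wd k); ring.
by move=> i _; rewrite /linearized; ring.
Qed.

(** By Cauchy-Schwarz the rank-one term lies between [0] and [kp |d_k|^2], so the smaller of [1] and
    [1 + kp] is a lower ellipticity constant. *)
Lemma linearized_coercive : c1 * a * SS d <= S1.
Proof.
rewrite linearized_energyE [c1 * a]mulrC -mulrA ler_pM2l // mulr_sumr; apply: ler_sum => k _.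
have H := wd_sq k.
set A := \sum_i d k i ^+ 2 in H *.
have A0 : 0 <= A by apply: sumr_ge0 => i _; exact: sqr_ge0.
have q0 := sqr_ge0 (wd k).
have H2 : wd k ^+ 2 / lam <= A by rewrite ler_pdivrMr // mulrC.
have H3 : 0 <= wd k ^+ 2 / lam by rewrite divr_ge0 // ltW.
have -> : kp / lam * wd k ^+ 2 = kp * (wd k ^+ 2 / lam) by ring.
have h1 := c11; have h2 := c1kp.
move: (wd k ^+ 2 / lam) H2 H3 => y yA y0; case: (lerP 0 kp) => k0; nra.
Qed.

(** Controls the term created by [dg]. The constant in front of [lam * S1] is [1] whatever [kp] is;
    hence the loss is the fraction [2 beta] of the good term, and the restriction from above is
    [2 beta < 1]. *)
Lemma linearized_contraction_bounds : 0 <= S2 <= lam * S1.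
Proof.
(* [I + mu w w^T / lam] is a square root of the linearized operator [I + kp w w^T / lam]. *)
pose mu := Num.sqrt (1 + kp) - 1.
have mukp : 2 * mu + mu ^+ 2 = kp.
  have : Num.sqrt (1 + kp) ^+ 2 = 1 + kp by rewrite sqr_sqrtr //; have := kp1; lra.
  by rewrite /mu; move: (Num.sqrt _) => s Hs; lra.
pose l k i := d k i + mu / lam * wd k * w i.
have lne : lam != 0 by rewrite gt_eqF.
have E1 : S1 = a * SS l.
  rewrite linearized_energyE; congr (_ * _); apply: eq_bigr => k _.
  rewrite [RHS](eq_bigr (fun i => d k i ^+ 2 + (2 * (mu / lam) * wd k) * (w i * d k i) + ((mu / lam) ^+ 2 * wd k ^+ 2) * w i ^+ 2)).
    rewrite !big_split /= -!mulr_sumr -/(wd k) -/lam -mukp; by field.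
  by move=> i _; rewrite /l; ring.
have El i : \sum_k w k * l k i = V i + mu / lam * wV * w i.
  rewrite (eq_bigr (fun k => w k * d k i + (w k * wd k) * (mu / lam * w i))).
    by rewrite big_split /= -mulr_suml wVE -/(V i); ring.
  by move=> k _; rewrite /l; ring.
have Em i : \sum_k w k * linearized k i = a * (V i + kp / lam * wV * w i).
  rewrite (eq_bigr (fun k => a * (w k * d k i) + (w k * wd k) * (a * (kp / lam * w i)))).
    by rewrite big_split /= -mulr_sumr -mulr_suml wVE -/(V i); ring.
  by move=> k _; rewrite /linearized; ring.
have E2 : S2 = a * \sum_i (\sum_k w k * l k i) ^+ 2.
  rewrite /S2 exchange_big /=.
  rewrite (eq_bigr (fun i => V i * (\sum_k w k * linearized k i))); last first.
    by move=> i _; rewrite mulr_sumr; apply: eq_bigr => k _; ring.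
  rewrite (eq_bigr (fun i => a * V i ^+ 2 + (a * (kp / lam) * wV) * (w i * V i))); last first.
    by move=> i _; rewrite Em; ring.
  rewrite [in RHS](eq_bigr (fun i => V i ^+ 2 + (2 * (mu / lam) * wV) * (w i * V i) + ((mu / lam) ^+ 2 * wV ^+ 2) * w i ^+ 2)); last first.
    by move=> i _; rewrite El; ring.
  rewrite !big_split /= -!mulr_sumr -/wV -/lam -mukp; by field.
rewrite E2 E1; apply/andP; split.
  by rewrite mulr_ge0 ?(ltW a0) // sumr_ge0 // => i _; exact: sqr_ge0.
rewrite mulrCA ler_pM2l //; exact: wsum_sq_le.
Qed.

(** The matrix [I + kp w w^T / lam] has norm at most [1 + |kp| <= c2]. *)
Lemma linearized_cutoff_bound : `|T1| <= a * c2 * t * Zd * D.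
Proof.
have lne : lam != 0 by rewrite gt_eqF.
have Em i : \sum_k w k * linearized k i = a * (V i + kp / lam * wV * w i).
  rewrite (eq_bigr (fun k => a * (w k * d k i) + (w k * wd k) * (a * (kp / lam * w i)))).
    by rewrite big_split /= -mulr_sumr -mulr_suml wVE -/(V i); ring.
  by move=> k _; rewrite /linearized; ring.
have -> : T1 = \sum_i (\sum_k w k * linearized k i) * zd i.
  rewrite /T1 exchange_big /=; apply: eq_bigr => i _.
  by rewrite mulr_suml; apply: eq_bigr => k _; ring.
apply: le_trans (cauchy_schwarz_norm _ _) _.
rewrite [leRHS](_ : _ = (a * c2 * (t * D)) * Zd); last by ring.
rewrite ler_wpM2r ?sqrtr_ge0 //.
have c20 : 0 <= c2 by have := normr_ge0 kp; have := c2kp; lra.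
have -> : a * c2 * (t * D) = Num.sqrt ((a * c2) ^+ 2 * (lam * SS d)).
  rewrite sqrtrM ?sqr_ge0 // sqrtr_sqr ger0_norm ?mulr_ge0 ?(ltW a0) //.
  by rewrite sqrtrM // ltW.
apply: ler_wsqrtr.
apply: (@le_trans _ _ ((a * c2) ^+ 2 * \sum_i V i ^+ 2)); last first.
  by rewrite ler_wpM2l ?sqr_ge0 //; exact: wsum_sq_le.
rewrite (eq_bigr (fun i => a ^+ 2 * V i ^+ 2 + (a ^+ 2 * (2 * (kp / lam) * wV)) * (w i * V i) + (a ^+ 2 * ((kp / lam) ^+ 2 * wV ^+ 2)) * w i ^+ 2)); last first.
  by move=> i _; rewrite Em; ring.
rewrite !big_split /= -!mulr_sumr -/wV -/lam.
have H : wV ^+ 2 <= lam * \sum_i V i ^+ 2 by exact: cauchy_schwarz.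
set A := \sum_i V i ^+ 2 in H *.
have A0 : 0 <= A by apply: sumr_ge0 => i _; exact: sqr_ge0.
have H2 : wV ^+ 2 / lam <= A by rewrite ler_pdivrMr // mulrC.
have H3 : 0 <= wV ^+ 2 / lam by rewrite divr_ge0 ?sqr_ge0 // ltW.
rewrite [leLHS](_ : _ = a ^+ 2 * (A + (2 * kp + kp ^+ 2) * (wV ^+ 2 / lam))); last by field.
rewrite [leRHS](_ : _ = a ^+ 2 * (c2 ^+ 2 * A)); last by ring.
rewrite ler_wpM2l ?sqr_ge0 //.
have Hk : 2 * kp + kp ^+ 2 <= c2 ^+ 2 - 1.
  have := normr_ge0 kp; have := c2kp; rewrite ler_norml => /andP[k1 k2] _; nra.
have c21 : 0 <= c2 ^+ 2 - 1 by have := normr_ge0 kp; have := c2kp; nra.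
move: (wV ^+ 2 / lam) H2 H3 => y yA y0; nra.
Qed.

Lemma energy_density_lower : b * c1 * z ^+ 2 * g * a * D ^+ 2 - 2 * z * g * (a * c2 * t * Zd * D)
   - z ^+ 2 * (g + 2 * `|dg| * lam) * (E0 * D) - 2 * z * g * (t * E0 * Zd)
  <= \sum_k \sum_i (linearized k i + E k i) * test_grad k i.
Proof.
pose y1 := \sum_k \sum_i E k i * d k i.
pose y2 := \sum_k \sum_i E k i * (w k * V i).
pose y3 := \sum_k \sum_i E k i * (w k * zd i).
have -> : \sum_k \sum_i (linearized k i + E k i) * test_grad k i =
  z ^+ 2 * (g * S1 + 2 * dg * S2) + 2 * z * g * T1 + z ^+ 2 * (g * y1 + 2 * dg * y2) + 2 * z * g * y3.
  rewrite (eq_bigr (fun k => z ^+ 2 * (g * (\sum_i linearized k i * d k i) + 2 * dg * (\sum_i linearized k i * (w k * V i)))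
    + 2 * z * g * (\sum_i linearized k i * (w k * zd i)) + z ^+ 2 * (g * (\sum_i E k i * d k i) + 2 * dg * (\sum_i E k i * (w k * V i)))
    + 2 * z * g * (\sum_i E k i * (w k * zd i)))).
    by rewrite !(big_split, =^~ mulr_sumr) /=.
  move=> k _; rewrite !mulr_sumr -!big_split /= !mulr_sumr -!big_split /=.
  by apply: eq_bigr => i _; rewrite /test_grad; ring.
have D2 : D ^+ 2 = SS d by rewrite sqr_sqrtr // SS_ge0.
have t2 : t ^+ 2 = lam by rewrite sqr_sqrtr // ltW.
have G1 : b * c1 * z ^+ 2 * g * a * D ^+ 2 <= z ^+ 2 * (g * S1 + 2 * dg * S2).
  have -> : b * c1 * z ^+ 2 * g * a * D ^+ 2 = z ^+ 2 * (b * g * (c1 * a * SS d)) by rewrite D2; ring.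
  rewrite ler_wpM2l ?sqr_ge0 //.
  have h1 := linearized_coercive; have /andP[h2 h3] := linearized_contraction_bounds.
  have S10 : 0 <= S1 by apply: le_trans h1; rewrite !mulr_ge0 ?SS_ge0 // ltW.
  apply: (@le_trans _ _ (b * g * S1)); first by rewrite ler_wpM2l // mulr_ge0.
  (* For [dg >= 0] the extra term helps; otherwise [S2 <= lam S1] limits its loss to
     [(1 - b) g S1]. *)
  have [dg0|dg0] := leP 0 dg.
    have : b * (g * S1) <= 1 * (g * S1) by rewrite ler_wpM2r // mulr_ge0.
    have : 0 <= dg * S2 by rewrite mulr_ge0.
    rewrite mul1r !mulrA; lra.
  have : dg * (lam * S1) <= dg * S2 by rewrite ler_nM2l.
  have : - (1 - b) * g * S1 <= 2 * dg * lam * S1 by rewrite ler_wpM2r.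
  rewrite !mulrA; lra.
have G2 : - (2 * z * g * (a * c2 * t * Zd * D)) <= 2 * z * g * T1.
  rewrite -mulrN ler_wpM2l ?mulr_ge0 //.
  by have := linearized_cutoff_bound; rewrite ler_norml => /andP[].
have Y1 : `|y1| <= E0 * D by exact: double_cauchy_schwarz.
have wE : Num.sqrt (\sum_i (\sum_k w k * E k i) ^+ 2) <= t * E0.
  by rewrite -sqrtrM ?(ltW lam0) // ler_wsqrtr // wsum_sq_le.
have wD : Num.sqrt (\sum_i (V i) ^+ 2) <= t * D.
  by rewrite -sqrtrM ?(ltW lam0) // ler_wsqrtr // wsum_sq_le.
have Y2 : `|y2| <= lam * (E0 * D).
  have -> : y2 = \sum_i (\sum_k w k * E k i) * V i.
    rewrite /y2 exchange_big /=; apply: eq_bigr => i _.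
    by rewrite mulr_suml; apply: eq_bigr => k _; ring.
  apply: le_trans (cauchy_schwarz_norm _ _) _.
  rewrite -t2 [leRHS](_ : _ = (t * E0) * (t * D)); last by ring.
  by apply: ler_pM => //; exact: sqrtr_ge0.
have Y3 : `|y3| <= t * E0 * Zd.
  have -> : y3 = \sum_i (\sum_k w k * E k i) * zd i.
    rewrite /y3 exchange_big /=; apply: eq_bigr => i _.
    by rewrite mulr_suml; apply: eq_bigr => k _; ring.
  apply: le_trans (cauchy_schwarz_norm _ _) _.
  by rewrite ler_wpM2r ?sqrtr_ge0.
have G3 : - (z ^+ 2 * (g + 2 * `|dg| * lam) * (E0 * D)) <= z ^+ 2 * (g * y1 + 2 * dg * y2).
  rewrite -mulrA -mulrN ler_wpM2l ?sqr_ge0 //.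
  have : `|g * y1 + 2 * dg * y2| <= g * (E0 * D) + 2 * `|dg| * (lam * (E0 * D)).
    rewrite (le_trans (ler_normD _ _)) // !normrM (ger0_norm g0) (ger0_norm (ler0n R 2)).
    by rewrite lerD // ler_wpM2l // mulr_ge0.
  rewrite ler_norml => /andP[+ _].
  by have -> : - ((g + 2 * `|dg| * lam) * (E0 * D)) = - (g * (E0 * D) + 2 * `|dg| * (lam * (E0 * D))) by ring.
have G4 : - (2 * z * g * (t * E0 * Zd)) <= 2 * z * g * y3.
  rewrite -mulrN ler_wpM2l ?mulr_ge0 //.
  by move: Y3; rewrite ler_norml => /andP[].
lra.
Qed.

End Algebra.

(** * Real powers with varying base and exponent *)

Section Powers.
Variable R : realType.
Implicit Types (x y q s e m L E : R).

Lemma powRE x e : 0 < x -> x `^ e = expR (e * ln x).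
Proof. by move=> x0; rewrite /powR gt_eqF. Qed.

Lemma powR_add x a b : 0 < x -> x `^ (a + b) = x `^ a * x `^ b.
Proof. by move=> x0; rewrite !powRE // mulrDl expRD. Qed.

Definition lnbound m L : R := `|ln m| + `|ln L|.

Lemma ln_bound m L q : 0 < m -> m <= q -> q <= L -> `|ln q| <= lnbound m L.
Proof.
move=> m0 mq qL; have q0 := lt_le_trans m0 mq; have L0 := lt_le_trans q0 qL.
have h1 : ln m <= ln q by rewrite ler_ln ?posrE.
have h2 : ln q <= ln L by rewrite ler_ln ?posrE.
rewrite ler_norml /lnbound; apply/andP; split.
  have := ler_norm (- ln m); rewrite normrN; have := normr_ge0 (ln L); lra.
have := ler_norm (ln L); have := normr_ge0 (ln m); lra.
Qed.

Lemma powR_bound m L E q e : 0 < m -> m <= q -> q <= L -> `|e| <= E ->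
  q `^ e <= expR (E * lnbound m L).
Proof.
move=> m0 mq qL eE; rewrite powRE ?(lt_le_trans m0) // ler_expR.
rewrite (le_trans (ler_norm _)) // normrM ler_pM //; exact: ln_bound.
Qed.

Lemma powR_mvt m L x y e : 0 < m -> m <= x <= L -> m <= y <= L ->
  exists q, [/\ m <= q <= L, `|q - y| <= `|x - y| & x `^ e - y `^ e = e * q `^ (e - 1) * (x - y)].
Proof.
move=> m0 /andP[mx xL] /andP[my yL].
have D (t : R) : 0 < t -> is_derive t (1:R) (fun t : R => t `^ e) (e * t `^ (e - 1)) by move=> t0; exact: is_derive1_powR.
have C (u v : R) : 0 < u -> {within `[u, v], continuous (fun t : R => t `^ e)}.
  move=> u0; apply: derivable_within_continuous => t; rewrite in_itv /= => /andP[ut _].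
  by case: (D t (lt_le_trans u0 ut)).
have [xy|yx] := leP x y.
  have [||q] := @MVT_segment R (fun t : R => t `^ e) (fun t : R => e * t `^ (e - 1)) x y xy.
  - by move=> t; rewrite in_itv /= => /andP[xt _]; apply: D; lra.
  - by apply: C; lra.
  rewrite in_itv /= => /andP[xq qy] Eq; exists q; split.
  - by apply/andP; split; lra.
  - by rewrite !ler0_norm; lra.
  - by rewrite -opprB Eq; ring.
have [||q] := @MVT_segment R (fun t : R => t `^ e) (fun t : R => e * t `^ (e - 1)) y x (ltW yx).
- by move=> t; rewrite in_itv /= => /andP[xt _]; apply: D; lra.
- by apply: C; lra.
rewrite in_itv /= => /andP[xq qy] Eq; exists q; split.
- by apply/andP; split; lra.
- by rewrite !ger0_norm; lra.
- by [].
Qed.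

Lemma powR_lip m L E x y e : 0 < m -> m <= x <= L -> m <= y <= L -> `|e| <= E ->
  `|x `^ e - y `^ e| <= E * expR ((E + 1) * lnbound m L) * `|x - y|.
Proof.
move=> m0 mx my eE; have [q [/andP[mq qL] _ ->]] := powR_mvt e m0 mx my.
rewrite !normrM ler_wpM2r // ler_pM // ger0_norm ?powR_ge0 //.
apply: (powR_bound m0) => //; rewrite (le_trans (ler_normB _ _)) // normr1 lerD2r //.
Qed.

(** The quotient of the two powers is [exp z], and [|exp z - 1| <= 2 |z|] follows from
    [1 + z <= exp z] and [exp z (1 - z) <= 1]. *)
Lemma powR_exponent s a b : 0 < s -> `|(b - a) * ln s| <= 1 / 2 ->
  `|s `^ b - s `^ a| <= 2 * `|b - a| * `|ln s| * s `^ a.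
Proof.
move=> s0; set z := (b - a) * ln s => z2.
have -> : s `^ b - s `^ a = (expR z - 1) * s `^ a.
  rewrite (_ : b = (b - a) + a); last by ring.
  by rewrite powR_add // [s `^ (b - a)]powRE // -/z; ring.
rewrite normrM (ger0_norm (powR_ge0 _ _)) ler_wpM2r ?powR_ge0 //.
rewrite -mulrA -normrM -/z.
have h1 := expR_ge1Dx z; have h2 := expR_ge1Dx (- z).
have h3 := expRxMexpNx_1 z; have h4 := expR_gt0 z.
move: (expR z) (expR (- z)) h1 h2 h3 h4 => u v h1 h2 h3 h4.
move: z2; rewrite ler_norml => /andP[za zb].
have hu : u * (1 - z) <= 1 by rewrite -h3 ler_pM2l //; lra.
have zz := ler_norm z; have zz' := ler_norm (- z); rewrite normrN in zz'.
rewrite ler_norml; apply/andP; split; first lra.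
have [z0|z0] := leP 0 z; first by rewrite ger0_norm //; nra.
by rewrite ltr0_norm //; nra.
Qed.

(** For [s <= 1], the inequality [1 + y <= exp y] at [y = - e ln s] gives [s^e |ln s| <= 1 / e]. The
    logarithm will come from a change of the exponent [p]; uniformity in [e] is required because the
    exponent varies from point to point. *)
Lemma powR_ln_bound e0 E L : 0 < e0 -> 1 <= L -> exists2 C : R, 0 < C &
  forall e s, e0 <= e <= E -> 0 < s <= L -> s `^ e * `|ln s| <= C.
Proof.
move=> e00 L1; have lnL : 0 <= ln L by exact: ln_ge0.
exists (e0^-1 + expR (`|E| * ln L) * (ln L + 1)).
  by rewrite ltr_pwDl ?invr_gt0 // mulr_ge0 ?expR_ge0 // addr_ge0.
move=> e s /andP[ee eE] /andP[s0 sL].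
have e0' : 0 < e by lra.
have [s1|s1] := leP s 1.
  have ls : ln s <= 0 by exact: ln_le0.
  apply: (@le_trans _ _ e0^-1); last first.
    by rewrite lerDl mulr_ge0 ?expR_ge0 // addr_ge0.
  rewrite ler0_norm // powRE // -[e0^-1]mul1r ler_pdivlMr //.
  have h1 := expR_ge1Dx (- (e * ln s)).
  have h2 := expRxMexpNx_1 (e * ln s).
  have h3 := expR_gt0 (e * ln s).
  rewrite -h2 -mulrA ler_pM2l //; apply: le_trans h1.
  have : - ln s * e0 <= - ln s * e by rewrite ler_wpM2l //; lra.
  lra.
have ls : 0 <= ln s by apply: ln_ge0; exact: ltW.
have lsL : ln s <= ln L by rewrite ler_ln ?posrE //; lra.
rewrite ger0_norm // powRE //.
apply: (@le_trans _ _ (expR (`|E| * ln L) * (ln L + 1))); last by rewrite lerDr invr_ge0 ltW.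
rewrite ler_pM ?expR_ge0 //; last lra.
by rewrite ler_expR ler_pM //; [lra|have := ler_norm E; lra].
Qed.

Lemma powR_ratio E e x y : 0 < x -> 0 < y -> x <= 4 * y -> y <= 4 * x -> `|e| <= E ->
  x `^ e <= expR (E * ln 4) * y `^ e.
Proof.
move=> x0 y0 xy yx eE; rewrite !powRE // -expRD ler_expR.
have h1 : ln x <= ln 4 + ln y by rewrite -lnM ?posrE // ler_ln ?posrE ?mulr_gt0.
have h2 : ln y <= ln 4 + ln x by rewrite -lnM ?posrE // ler_ln ?posrE ?mulr_gt0.
have : `|e * (ln x - ln y)| <= E * ln 4.
  rewrite normrM ler_pM // ler_norml; apply/andP; split; lra.
rewrite ler_norml; lra.
Qed.

Lemma powR_le_exp e1 E L x : 0 < x <= L -> 1 <= L -> 0 <= e1 <= E -> x `^ e1 <= expR (E * ln L).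
Proof.
move=> /andP[x0 xL] L1 /andP[e0 eE]; rewrite powRE // ler_expR.
have lnL : 0 <= ln L by exact: ln_ge0.
have lsL : ln x <= ln L by rewrite ler_ln ?posrE //; lra.
have : e1 * ln x <= e1 * ln L by rewrite ler_wpM2l.
have : e1 * ln L <= E * ln L by rewrite ler_wpM2r.
lra.
Qed.

End Powers.

(** * The truncated power weight *)

Section Weight.
Variables (R : realType) (beta delta : R).
Hypotheses (beta0 : 0 <= beta) (beta1 : 2 * beta <= 1) (delta0 : 0 < delta).

(** The step starts at [delta^2 / 2] and is complete at [delta^2], so the weight is the full power
    on the shell from [delta^2] to [2 delta^2], where the last test function varies. *)
Definition weight (t : R) : R := t `^ (- beta) * step (2 / delta ^+ 2 * t).
Definition dweight (t : R) : R :=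
  - beta * t `^ (- beta - 1) * step (2 / delta ^+ 2 * t) + t `^ (- beta) * (2 / delta ^+ 2 * dstep (2 / delta ^+ 2 * t)).

Lemma weight_small t : t <= delta ^+ 2 / 2 -> weight t = 0 /\ dweight t = 0.
Proof.
move=> td; have [_ _ _ H _] := step_facts (2 / delta ^+ 2 * t).
have [|s0 d0] := H; last by rewrite /weight /dweight s0 d0 !mulr0 addr0.
by rewrite mulrAC ler_pdivrMr ?exprn_gt0 // mul1r; lra.
Qed.

Lemma weight_large t : delta ^+ 2 <= t -> weight t = t `^ (- beta).
Proof.
move=> td; have [_ _ _ _ H] := step_facts (2 / delta ^+ 2 * t).
have [|s1 _] := H; last by rewrite /weight s1 mulr1.
by rewrite mulrAC ler_pdivlMr ?exprn_gt0 //; lra.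
Qed.

Lemma is_derive_scaled_step (k t : R) : is_derive t (1:R) (fun t => step (k * t)) (k * dstep (k * t)).
Proof.
have D := is_deriveZ k (is_derive_id t (1:R)).
have := is_derive_comp1 D (is_derive_step (k * t)).
by rewrite /GRing.scale /= mulr1 mulrC.
Qed.

Lemma is_derive_weight t : is_derive t (1:R) weight (dweight t).
Proof.
have d20 : 0 < delta ^+ 2 by rewrite exprn_gt0.
have [t0|t0] := ltP 0 t.
  have D1 := is_derive1_powR (- beta) t0.
  have D := is_deriveM D1 (is_derive_scaled_step (2 / delta ^+ 2) t).
  apply: (is_derive_eq D); rewrite /dweight /GRing.scale /=; ring.
have [_ ->] : weight t = 0 /\ dweight t = 0 by apply: weight_small; lra.
apply: (@near_eq_is_derive _ _ _ (fun=> 0)).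
have := nbhsx_ballx t _ (_ : 0 < delta ^+ 2 / 2); rewrite -ball_normE => H.
apply: filterS (H _) => [y /=|]; last by rewrite divr_gt0.
rewrite ltr_norml => /andP[? ?]; by have [-> _] := @weight_small y ltac:(lra).
Qed.

Lemma cont_dweight : continuous dweight.
Proof.
have d20 : 0 < delta ^+ 2 by rewrite exprn_gt0.
have ck : continuous (fun t : R => 2 / delta ^+ 2 * t).
  by apply: cont_mul; [exact: cst_continuous|move=> x; exact: cvg_id].
have cs : continuous (@step R).
  by move=> s; apply/differentiable_continuous/derivable1_diffP; case: (is_derive_step s).
have c1 := cont_comp ck cs; have c2 := cont_comp ck (@cont_dstep R).
move=> t; have [t0|t0] := ltP 0 t.
  have cp e : {for t, continuous (fun t : R => t `^ e)}.
    by apply/differentiable_continuous/derivable1_diffP; case: (is_derive1_powR e t0).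
  apply: cvgD; apply: cvgM.
  - by apply: cvgM; [exact: cvg_cst|exact: cp].
  - exact: c1.
  - exact: cp.
  - by apply: cvgM; [exact: cvg_cst|exact: c2].
apply: (@eps_delta_continuous R R) => e e0; exists (delta ^+ 2 / 2); first by rewrite divr_gt0.
move=> y; rewrite ltr_norml => /andP[? ?].
have [_ ->] := @weight_small t ltac:(lra); have [_ ->] := @weight_small y ltac:(lra).
by rewrite subrr normr0 ltW.
Qed.

(** The step is nondecreasing, so its derivative can only help the lower bound on [dweight]. The
    quadratic bound rests on [dstep^2 <= 16 step]: with [s] and [d] for [step] and [dstep], it comes
    from [(2 s + 4 d)^2 <= 8 s^2 + 32 d^2 <= 8 s + 512 s]. *)
Lemma weight_facts t : 0 < t -> [/\ 0 <= weight t, weight t <= t `^ (- beta),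
  - (2 * beta) * weight t <= 2 * dweight t * t &
  (weight t + 2 * `|dweight t| * t) ^+ 2 <= 520 * t `^ (- beta) * weight t].
Proof.
move=> t0; have d20 : 0 < delta ^+ 2 by rewrite exprn_gt0.
have P1 : t `^ (- beta - 1) * t = t `^ (- beta) by rewrite powR_add // powR_inv1 ?(ltW t0) // mulfVK // gt_eqF.
have B0 := powR_ge0 t (- beta).
have [/andP[s0 s1] /andP[d0 d4] ds H1 H2] := step_facts (2 / delta ^+ 2 * t).
have [A0 A2] : 0 <= 2 / delta ^+ 2 * t * dstep (2 / delta ^+ 2 * t) /\ 2 / delta ^+ 2 * t * dstep (2 / delta ^+ 2 * t) <= 2 * dstep (2 / delta ^+ 2 * t).
  have k0 : 0 <= 2 / delta ^+ 2 * t by rewrite mulr_ge0 ?divr_ge0 // ltW.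
  split; first by rewrite mulr_ge0.
  have [k2|k2] := leP 2 (2 / delta ^+ 2 * t); first by have [_ ->] := H2 k2; rewrite !mulr0.
  by rewrite ler_wpM2r // ltW.
have E : dweight t * t = t `^ (- beta) * (- beta * step (2 / delta ^+ 2 * t) + 2 / delta ^+ 2 * t * dstep (2 / delta ^+ 2 * t)).
  rewrite /dweight mulrDl -[- beta * _ * _ * t](_ : - beta * step (2 / delta ^+ 2 * t) * (t `^ (- beta - 1) * t) = _); last by ring.
  by rewrite P1; ring.
have -> : 2 * `|dweight t| * t = 2 * `|dweight t * t| by rewrite normrM (gtr0_norm t0) mulrA.
have -> : 2 * dweight t * t = 2 * (dweight t * t) by rewrite mulrA.
rewrite E /weight.
move: (2 / delta ^+ 2 * t * dstep _) A0 A2 => A A0 A2.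
move: (step _) (dstep _) s0 s1 d0 d4 ds A2 => s d s0 s1 d0 d4 ds A2 {H1 H2 E P1}.
move: (t `^ (- beta)) B0 => B B0.
split.
- by rewrite mulr_ge0.
- by rewrite ler_piMr.
- have := mulr_ge0 B0 A0; nra.
- rewrite normrM (ger0_norm B0).
  have N : `|- beta * s + A| <= s / 2 + 2 * d.
    have g1 := mulr_ge0 beta0 s0; have g2 := ler_piMl s0 beta1.
    rewrite ler_norml; apply/andP; split; lra.
  have N0 := normr_ge0 (- beta * s + A).
  move: (`|_|) N N0 => z zN z0.
  have -> : B * s + 2 * (B * z) = B * (s + 2 * z) by ring.
  have -> : 520 * B * (B * s) = B ^+ 2 * (520 * s) by ring.
  rewrite exprMn ler_wpM2l ?sqr_ge0 //.
  have h : s + 2 * z <= 2 * s + 4 * d by lra.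
  have h0 : 0 <= s + 2 * z by lra.
  have : (s + 2 * z) ^+ 2 <= (2 * s + 4 * d) ^+ 2 by rewrite ler_pXn2r // nnegrE //; lra.
  have : 0 <= (2 * s - 4 * d) ^+ 2 by exact: sqr_ge0.
  nra.
Qed.

End Weight.

(** * Absorption of the error terms *)

Section Energy.
Variables (R : realType).

(** [X] is the good term. The part [Q0] of the error is tied to the weight by [gb Q0^2 <= CQ a], so
    Young's inequality absorbs it into [X] at a bounded cost. The part [tau D] has no such tie and
    survives as a small multiple of the unweighted [z^2 D^2]. *)
Lemma energy_scalar (ka lam t a c2 g gt gb z D E0 Zd Q0 tau K CQ M Z G0 : R) :
  0 < ka -> 0 <= G0 -> 0 <= c2 -> 0 <= t -> t ^+ 2 = lam -> 0 < a -> 0 <= g -> g <= gb -> 0 <= gt -> gt ^+ 2 <= 4 * G0 * gb * g ->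
  0 <= z <= 1 -> 0 <= D -> 0 <= E0 -> 0 <= Zd <= Z -> 0 <= Q0 -> 0 <= tau -> E0 <= Q0 + tau * D ->
  gb * Q0 ^+ 2 <= CQ * a -> gb * a * lam <= K -> gt <= M -> g * t <= M ->
  2 * z * g * (a * c2 * t * Zd * D) + z ^+ 2 * gt * (E0 * D) + 2 * z * g * (t * E0 * Zd)
  <= 2 * ka * (z ^+ 2 * g * a * D ^+ 2) + (ka^-1 * K * c2 ^+ 2 * Z ^+ 2 + G0 / ka * CQ + CQ * K + Z ^+ 2)
     + tau * M * (2 * (z ^+ 2 * D ^+ 2) + Z ^+ 2).
Proof.
move=> ka0 G00 c20 t0 tl a0 g0 ggb gt0 gtb /andP[z0 z1] D0 E00 /andP[Zd0 ZdZ] Q00 tau0 EQ HQ HK gtM gM.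
have gb0 : 0 <= gb by exact: le_trans ggb.
have lam0 : 0 <= lam by rewrite -tl sqr_ge0.
have kane : ka != 0 by rewrite gt_eqF.
have z2 : z ^+ 2 <= 1 by rewrite expr_le1.
have ZZ : Zd ^+ 2 <= Z ^+ 2 by rewrite ler_pXn2r // nnegrE // (le_trans Zd0).
have K0 : 0 <= K by apply: le_trans HK; rewrite !mulr_ge0 // ltW.
have CQ0 : 0 <= CQ by rewrite -(pmulr_lge0 _ a0) (le_trans _ HQ) // mulr_ge0 ?sqr_ge0.
set X := z ^+ 2 * g * a * D ^+ 2.
have X0 : 0 <= X by rewrite /X !mulr_ge0 ?sqr_ge0 // ltW.
have I1 : 2 * z * g * (a * c2 * t * Zd * D) <= ka * X + ka^-1 * K * c2 ^+ 2 * Z ^+ 2.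
  have -> : 2 * z * g * (a * c2 * t * Zd * D) = 2 * (z * g * a * c2 * t * Zd * D) by ring.
  apply: (@le_trans _ _ (2 * `|z * g * a * c2 * t * Zd * D|)); first by rewrite ler_pM2l // ler_norm.
  apply: (@le_trans _ _ (ka * X + ka^-1 * (g * a * lam) * c2 ^+ 2 * Zd ^+ 2)).
    apply: young; rewrite ?mulr_ge0 ?invr_ge0 ?sqr_ge0 ?(ltW ka0) ?(ltW a0) //.
    by rewrite /X -tl le_eqVlt; apply/orP; left; apply/eqP; field.
  rewrite lerD2l; apply: ler_pM; rewrite ?sqr_ge0 ?mulr_ge0 ?invr_ge0 ?sqr_ge0 ?(ltW ka0) ?(ltW a0) //.
  rewrite ler_wpM2r ?sqr_ge0 // ler_wpM2l ?invr_ge0 ?(ltW ka0) // (le_trans _ HK) //.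
  by rewrite ler_wpM2r // ler_wpM2r // ltW.
have I2 : z ^+ 2 * gt * (Q0 * D) <= ka * X + G0 / ka * CQ.
  have : 2 * `|z ^+ 2 * gt * (Q0 * D)| <= 2 * ka * X + 2 * G0 / ka * CQ.
    have n1 : 0 <= 2 * ka * X by rewrite mulr_ge0 // mulr_ge0 // ltW.
    have n2 : 0 <= 2 * G0 / ka * CQ by rewrite mulr_ge0 // divr_ge0 ?mulr_ge0 // ltW.
    apply: (young n1 n2).
    have -> : 2 * ka * X * (2 * G0 / ka * CQ) = 4 * G0 * (z ^+ 2 * D ^+ 2 * g) * (CQ * a) by rewrite /X; field.
    have -> : (z ^+ 2 * gt * (Q0 * D)) ^+ 2 = (z ^+ 2 * D ^+ 2 * Q0 ^+ 2) * (z ^+ 2 * gt ^+ 2) by ring.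
    apply: (@le_trans _ _ ((z ^+ 2 * D ^+ 2 * Q0 ^+ 2) * (4 * G0 * gb * g))).
      rewrite ler_wpM2l ?mulr_ge0 ?sqr_ge0 //; apply: le_trans gtb; rewrite ler_piMl ?sqr_ge0 //.
    have -> : z ^+ 2 * D ^+ 2 * Q0 ^+ 2 * (4 * G0 * gb * g) = 4 * G0 * (z ^+ 2 * D ^+ 2 * g) * (gb * Q0 ^+ 2) by ring.
    by rewrite ler_wpM2l // ?mulr_ge0 ?sqr_ge0.
  have := ler_norm (z ^+ 2 * gt * (Q0 * D)).
  have -> : 2 * G0 / ka * CQ = 2 * (G0 / ka * CQ) by field.
  lra.
have I3 : 2 * z * g * (t * Q0 * Zd) <= CQ * K + Z ^+ 2.
  have : 2 * `|g * t * Q0 * Zd| <= (g * t * Q0) ^+ 2 + Zd ^+ 2.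
    by apply: young; rewrite ?sqr_ge0 // -exprMn.
  have : (g * t * Q0) ^+ 2 <= CQ * K.
    have -> : (g * t * Q0) ^+ 2 = g ^+ 2 * lam * Q0 ^+ 2 by rewrite -tl; ring.
    apply: (@le_trans _ _ (gb ^+ 2 * lam * Q0 ^+ 2)).
      by rewrite ler_wpM2r ?sqr_ge0 // ler_wpM2r // ler_pXn2r // nnegrE.
    have -> : gb ^+ 2 * lam * Q0 ^+ 2 = gb * lam * (gb * Q0 ^+ 2) by ring.
    apply: (@le_trans _ _ (gb * lam * (CQ * a))); first by rewrite ler_wpM2l // mulr_ge0.
    have -> : gb * lam * (CQ * a) = CQ * (gb * a * lam) by ring.
    by rewrite ler_wpM2l.
  have h : 0 <= g * t * Q0 * Zd by rewrite !mulr_ge0.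
  rewrite (ger0_norm h).
  have : 2 * z * g * (t * Q0 * Zd) <= 2 * (g * t * Q0 * Zd).
    have -> : 2 * z * g * (t * Q0 * Zd) = z * (2 * (g * t * Q0 * Zd)) by ring.
    by rewrite ler_piMl // mulr_ge0.
  lra.
have I4 : z ^+ 2 * gt * (tau * D * D) <= tau * M * (z ^+ 2 * D ^+ 2).
  have -> : z ^+ 2 * gt * (tau * D * D) = tau * gt * (z ^+ 2 * D ^+ 2) by ring.
  by rewrite ler_wpM2r ?mulr_ge0 ?sqr_ge0 // ler_wpM2l.
have I5 : 2 * z * g * (t * (tau * D) * Zd) <= tau * M * (z ^+ 2 * D ^+ 2 + Z ^+ 2).
  have : 2 * `|z * D * Zd| <= (z * D) ^+ 2 + Zd ^+ 2.
    by apply: young; rewrite ?sqr_ge0 // -exprMn.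
  have h : 0 <= z * D * Zd by rewrite !mulr_ge0.
  rewrite (ger0_norm h) => Hy.
  have -> : 2 * z * g * (t * (tau * D) * Zd) = tau * (g * t) * (2 * (z * D * Zd)) by ring.
  rewrite ler_pM ?mulr_ge0 //; first by rewrite ler_wpM2l.
  by rewrite -exprMn; lra.
have J1 : z ^+ 2 * gt * (E0 * D) <= z ^+ 2 * gt * (Q0 * D) + z ^+ 2 * gt * (tau * D * D).
  by rewrite -mulrDr -mulrDl ler_wpM2l ?mulr_ge0 ?sqr_ge0 // ler_wpM2r.
have J2 : 2 * z * g * (t * E0 * Zd) <= 2 * z * g * (t * Q0 * Zd) + 2 * z * g * (t * (tau * D) * Zd).
  rewrite -mulrDr -mulrDl -mulrDr ler_wpM2l ?mulr_ge0 // ler_wpM2r // ler_wpM2l //.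
have -> : tau * M * (2 * (z ^+ 2 * D ^+ 2) + Z ^+ 2) = tau * M * (z ^+ 2 * D ^+ 2) + tau * M * (z ^+ 2 * D ^+ 2 + Z ^+ 2) by ring.
lra.
Qed.

Lemma energy_lower n (w zd : 'I_n -> R) (d E : 'I_n -> 'I_n -> R) (a kp g dg gb z b c1 c2 Q0 tau K CQ M Z G0 : R) :
  let lam := \sum_k w k ^+ 2 in
  let SS x := \sum_k \sum_i (x k i : R) ^+ 2 in
  0 < lam -> 0 < a -> -1 < kp -> 0 < c1 <= 1 -> c1 <= 1 + kp -> `|kp| <= c2 - 1 -> 0 < b <= 1 ->
  0 <= z <= 1 -> 0 <= g -> g <= gb -> - (1 - b) * g <= 2 * dg * lam -> 0 <= G0 ->
  (g + 2 * `|dg| * lam) ^+ 2 <= 4 * G0 * gb * g ->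
  g + 2 * `|dg| * lam <= M -> g * Num.sqrt lam <= M -> 0 <= Q0 -> 0 <= tau ->
  Num.sqrt (SS E) <= Q0 + tau * Num.sqrt (SS d) -> gb * Q0 ^+ 2 <= CQ * a -> gb * a * lam <= K ->
  0 <= Z -> Num.sqrt (\sum_i zd i ^+ 2) <= Z ->
  b * c1 / 2 * (z ^+ 2 * g * a * SS d)
  <= \sum_k \sum_i (linearized w d a kp k i + E k i) * test_grad w zd d g dg z k i
     + (4 / (b * c1) * K * c2 ^+ 2 * Z ^+ 2 + 4 * G0 / (b * c1) * CQ + CQ * K + Z ^+ 2)
     + tau * M * (2 * (z ^+ 2 * SS d) + Z ^+ 2).
Proof.
move=> lam SS lam0 a0 kp1 /andP[c10 c11] c1kp c2kp /andP[b0 b1] /andP[z0 z1] g0 ggb dgb G00 gtb gtM gM Q00 tau0 HE HQ HK Z0 HZ.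
have c20 : 0 <= c2 by have := normr_ge0 kp; lra.
have bc0 : 0 < b * c1 by rewrite mulr_gt0.
have H := energy_density_lower zd d E lam0 a0 kp1 c11 c1kp c2kp g0 (ltW b0) b1 dgb z0 (ltW c10).
have SSd : Num.sqrt (SS d) ^+ 2 = SS d.
  by rewrite sqr_sqrtr // /SS sumr_ge0 // => k _; rewrite sumr_ge0 // => i _; exact: sqr_ge0.
have gt0 : 0 <= g + 2 * `|dg| * lam by rewrite addr_ge0 // mulr_ge0 ?mulr_ge0 // ltW.
have tl : Num.sqrt lam ^+ 2 = lam by rewrite sqr_sqrtr // ltW.
have Zd0 : 0 <= Num.sqrt (\sum_i zd i ^+ 2) <= Z by rewrite sqrtr_ge0.
have z01 : 0 <= z <= 1 by rewrite z0.
(* With [ka = b c1 / 4] the absorption spends [2 ka], half of the coercivity constant [b c1]. *)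
have bc4 : 0 < b * c1 / 4 by rewrite divr_gt0.
have H2 := energy_scalar bc4 G00 c20 (sqrtr_ge0 lam) tl a0 g0 ggb gt0 gtb z01 (sqrtr_ge0 (SS d))
  (sqrtr_ge0 (SS E)) Zd0 Q00 tau0 HE HQ HK gtM gM.
rewrite -/lam -/(SS d) -/(SS E) SSd in H.
rewrite SSd in H2.
have E1 : (b * c1 / 4)^-1 = 4 / (b * c1) by rewrite invf_div.
have E2 : G0 / (b * c1 / 4) = 4 * G0 / (b * c1) by rewrite E1 mulrCA mulrA.
rewrite E2 E1 in H2.
have E3 : 2 * (b * c1 / 4) * (z ^+ 2 * g * a * SS d) = b * c1 / 2 * (z ^+ 2 * g * a * SS d).
  by congr (_ * _); rewrite mulrCA; congr (_ * _); apply/eqP; rewrite eq_sym -subr_eq0; apply/eqP; lra.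
have E4 : b * c1 * z ^+ 2 * g * a * SS d = b * c1 / 2 * (z ^+ 2 * g * a * SS d) + b * c1 / 2 * (z ^+ 2 * g * a * SS d) by field.
rewrite E3 in H2; rewrite E4 in H.
move: (b * c1 / 2 * _) (4 / (b * c1) * K * _ * _) (4 * G0 / (b * c1) * CQ) H H2 => A1 A2 A3.
move: (2 * z * g * (a * c2 * _ * _ * _)) => A5; move: (2 * z * g * _) (z ^+ 2 * _ * (_ * _)) (tau * M * _) => A7 A6 A4.
move: (\sum_k _) (CQ * K) (Z ^+ 2) => A8 A9 A10; lra.
Qed.

End Energy.

(** * Linearization of the power field, uniform in base point and exponent *)

Section StrictDifferentiability.
Variables (R : realType) (n : nat).
Implicit Types (w xi : 'I_n -> R).

Lemma sumsq_near w xi (th L : R) : 0 <= th <= 1 -> (forall i, `|w i| <= L) -> (forall i, `|xi i - w i| <= th) ->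
  `|\sum_i xi i ^+ 2 - \sum_i w i ^+ 2| <= th * (n%:R * (2 * L + 1)).
Proof.
move=> /andP[th0 th1] wL xw; rewrite -sumrB (le_trans (ler_norm_sum _ _ _)) //.
have -> : th * (n%:R * (2 * L + 1)) = \sum_(i < n) th * (2 * L + 1) by rewrite sumr_const card_ord -mulr_natl; ring.
apply: ler_sum => i _; rewrite subr_sqr normrM ler_pM //.
have -> : xi i + w i = (xi i - w i) + 2 * w i by ring.
rewrite (le_trans (ler_normD _ _)) // normrM gtr0_norm //; have := xw i; have := wL i; lra.
Qed.

(** The derivative of [xi |-> |xi|^(2 e) xi] is taken at a third point [w], near both ends of the
    increment: [w] will be the vector of difference quotients that also occurs in the test function,
    and the quadratic-form inequalities require the same [w] in both places. *)
Lemma power_field_strict_derivative (m L E tau : R) : 0 < m -> 0 <= L -> 0 <= E -> 0 < tau ->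
  exists2 th : R, 0 < th & forall e w xi0 xi1, `|e| <= E -> m <= \sum_i w i ^+ 2 -> (forall i, `|w i| <= L) ->
    (forall i, `|xi0 i - w i| <= th) -> (forall i, `|xi1 i - w i| <= th) ->
    forall i, `|(\sum_j xi1 j ^+ 2) `^ e * xi1 i - (\sum_j xi0 j ^+ 2) `^ e * xi0 i
      - (\sum_j w j ^+ 2) `^ e * ((xi1 i - xi0 i) + 2 * e / (\sum_j w j ^+ 2) * (\sum_j w j * (xi1 j - xi0 j)) * w i)|
      <= tau * \sum_j `|xi1 j - xi0 j|.
Proof.
have range (a b k q l : R) : 0 < a -> a <= l -> l <= b -> 0 <= k -> - (a / 2) <= q - l -> q - l <= k ->
  a / 2 <= q <= b + k by move=> *; apply/andP; split; lra.
have add2 (a b k : R) : a <= k -> b <= k -> a + b <= 2 * k by lra.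
move=> m0 L0 E0 tau0.
pose N := n%:R * (2 * L + 1) : R.
have N0 : 0 <= N by rewrite mulr_ge0 // addr_ge0 // mulr_ge0.
pose M1 := n%:R * L ^+ 2 + N : R.
pose lb := lnbound (m / 2) M1.
pose K := (E + 1) * expR ((E + 1 + 1) * lb).
pose B := expR ((E + 1) * lb).
have B0 : 0 <= B by exact: expR_ge0.
have K0 : 0 <= K by rewrite mulr_ge0 ?expR_ge0 // addr_ge0.
pose Kt := K * N + E * B * (2 * (L + 1)) + E * B * 2 * L + E * (K * (3 * N)) * (2 * L * L).
have Kt0 : 0 <= Kt.
  have L10 : 0 <= L + 1 by rewrite addr_ge0.
  by rewrite /Kt; clearbody K B N; rewrite !addr_ge0 // !mulr_ge0.
(* The second entry keeps [|xi0|^2] and [|xi1|^2] within [m / 2] of [|w|^2]; the third turns the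
   total constant [Kt] of the four error terms into [tau]. *)
exists (Num.min 1 (Num.min (m / (2 * (N + 1))) (tau / (Kt + 1)))).
  by rewrite !lt_min ltr01 /= !divr_gt0 // ?mulr_gt0 // ltr_wpDl.
set th := Num.min _ _ => e w xi0 xi1 eE mw wL d0 d1 i.
have th1 : th <= 1 by rewrite ge_min lexx.
have th0 : 0 <= th by apply: le_trans (d0 i).
have thN : th * N <= m / 2.
  have : th <= m / (2 * (N + 1)) by rewrite /th !ge_min lexx !orbT.
  rewrite ler_pdivlMr ?mulr_gt0 ?ltr_wpDl // => H.
  rewrite ler_pdivlMr //; apply: le_trans H.
  lra.
have thK : th * Kt <= tau.
  have : th <= tau / (Kt + 1) by rewrite /th !ge_min lexx !orbT.
  rewrite ler_pdivlMr ?ltr_wpDl // => H; apply: le_trans H.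
  by rewrite ler_wpM2l // lerDl.
have th01 : 0 <= th <= 1 by rewrite th0.
have Q0 := sumsq_near th01 wL d0; have Q1 := sumsq_near th01 wL d1.
rewrite -/N in Q0 Q1.
set lam := \sum_j w j ^+ 2 in mw Q0 Q1 *.
set q0 := \sum_j xi0 j ^+ 2 in Q0 *; set q1 := \sum_j xi1 j ^+ 2 in Q1 *.
set S : R := \sum_j `|xi1 j - xi0 j|.
have S0 : 0 <= S by exact: sumr_ge0.
have lamM : lam <= n%:R * L ^+ 2.
  rewrite -sum_ord_const.
  apply: ler_sum => j _; rewrite -real_normK ?num_real // ler_pXn2r ?nnegrE //; exact: wL.
have thNN : th * N <= N by rewrite ler_piMl.
have /andP[Q0a Q0b] : - (th * N) <= q0 - lam <= th * N by rewrite -ler_norml.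
have /andP[Q1a Q1b] : - (th * N) <= q1 - lam <= th * N by rewrite -ler_norml.
have m20 : 0 < m / 2 by rewrite divr_gt0.
have thN' : - (m / 2) <= - (th * N) by rewrite lerN2.
have rl : m / 2 <= lam <= M1.
  by apply: (range _ _ _ _ _ m0 mw lamM N0); rewrite subrr // oppr_le0 ltW.
have r0 : m / 2 <= q0 <= M1 by apply: (range _ _ _ _ _ m0 mw lamM N0); [exact: le_trans Q0a|exact: le_trans thNN].
have r1 : m / 2 <= q1 <= M1 by apply: (range _ _ _ _ _ m0 mw lamM N0); [exact: le_trans Q1a|exact: le_trans thNN].
have [qs [rs qsq Eq]] := powR_mvt e m20 r1 r0.
have eE1 : `|e| <= E + 1 by rewrite (le_trans eE) // lerDl.
have eE2 : `|e - 1| <= E + 1 by rewrite (le_trans (ler_normB _ _)) // normr1 lerD2r.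
have HB : `|qs `^ (e - 1)| <= B.
  by rewrite ger0_norm ?powR_ge0 //; case/andP: rs => ? ?; exact: (powR_bound m20).
have HK1 := powR_lip m20 r1 rl eE1.
have HK2 := powR_lip m20 rs rl eE2.
rewrite -/lb -/K in HK1 HK2.
have lamE : lam `^ e / lam = lam `^ (e - 1).
  have l0 : 0 < lam by case/andP: rl => l1 _; exact: lt_le_trans l1.
  by rewrite powR_add // powR_inv1 ?(ltW l0).
set W := \sum_j w j * (xi1 j - xi0 j).
have WS : `|W| <= L * S.
  rewrite (le_trans (ler_norm_sum _ _ _)) // /S mulr_sumr; apply: ler_sum => j _.
  by rewrite normrM ler_wpM2r.
pose r := \sum_j ((xi1 j - w j) + (xi0 j - w j)) * (xi1 j - xi0 j).
(* Expansion at [w]: [2 W] is the linear part, and [r] carries an extra factor [th]. *)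
have q10 : q1 - q0 = 2 * W + r.
  by rewrite /q1 /q0 /W /r mulr_sumr -sumrB -big_split; apply: eq_bigr => j _ /=; ring.
have rS : `|r| <= 2 * th * S.
  rewrite (le_trans (ler_norm_sum _ _ _)) // /S mulr_sumr; apply: ler_sum => j _.
  by rewrite normrM ler_wpM2r // (le_trans (ler_normD _ _)) // add2.
have q10S : `|q1 - q0| <= 2 * (L + 1) * S.
  rewrite q10 (le_trans (ler_normD _ _)) // normrM (gtr0_norm (_ : 0 < 2)) //.
  have -> : 2 * (L + 1) * S = 2 * (L * S) + 2 * S by ring.
  by rewrite lerD ?ler_pM2l // (le_trans rS) // -mulrA ler_pM2l // ler_piMl.
set eta := xi1 i - xi0 i.
have etaS : `|eta| <= S by rewrite /S (bigD1 i) //= lerDl sumr_ge0.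
have -> : q1 `^ e * xi1 i - q0 `^ e * xi0 i - lam `^ e * (eta + 2 * e / lam * W * w i)
  = (q1 `^ e - lam `^ e) * eta + e * (qs `^ (e - 1) * ((q1 - q0) * (xi0 i - w i)))
    + e * (qs `^ (e - 1) * (r * w i)) + e * ((qs `^ (e - 1) - lam `^ (e - 1)) * (2 * W * w i)).
  have -> : lam `^ e * (eta + 2 * e / lam * W * w i) = lam `^ e * eta + (lam `^ e / lam) * (2 * e * W * w i) by ring.
  have q1E : q1 `^ e = q0 `^ e + e * qs `^ (e - 1) * (q1 - q0) by rewrite -Eq addrC subrK.
  have xE : xi1 i = xi0 i + eta by rewrite /eta addrC subrK.
  rewrite lamE q1E q10 xE; ring.
have T1 : `|(q1 `^ e - lam `^ e) * eta| <= K * N * th * S.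
  rewrite normrM ler_pM //; apply: le_trans HK1 _.
  by rewrite -mulrA ler_wpM2l // mulrC.
have T2 : `|e * (qs `^ (e - 1) * ((q1 - q0) * (xi0 i - w i)))| <= E * B * (2 * (L + 1)) * th * S.
  have -> : E * B * (2 * (L + 1)) * th * S = E * (B * (2 * (L + 1) * S * th)) by ring.
  by do 3 (rewrite normrM ler_pM //).
have T3 : `|e * (qs `^ (e - 1) * (r * w i))| <= E * B * 2 * L * th * S.
  have -> : E * B * 2 * L * th * S = E * (B * (2 * th * S * L)) by ring.
  by do 3 (rewrite normrM ler_pM //).
have T4 : `|e * ((qs `^ (e - 1) - lam `^ (e - 1)) * (2 * W * w i))| <= E * (K * (3 * N)) * (2 * L * L) * th * S.
  have -> : E * (K * (3 * N)) * (2 * L * L) * th * S = E * (K * (3 * (th * N)) * (2 * (L * S) * L)) by ring.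
  rewrite normrM ler_pM // normrM ler_pM //; last first.
    by rewrite normrM ler_pM // normrM gtr0_norm // ler_pM2l.
  apply: le_trans HK2 _; rewrite ler_wpM2l //.
  have -> : qs - lam = (qs - q0) + (q0 - lam) by ring.
  have q10N : `|q1 - q0| <= 2 * (th * N).
    have -> : q1 - q0 = (q1 - lam) - (q0 - lam) by ring.
    by rewrite (le_trans (ler_normB _ _)) // add2.
  have -> : 3 * (th * N) = 2 * (th * N) + th * N by ring.
  by rewrite (le_trans (ler_normD _ _)) // lerD // (le_trans qsq).
have : th * Kt * S <= tau * S by rewrite ler_wpM2r.
have -> : th * Kt * S = K * N * th * S + E * B * (2 * (L + 1)) * th * S + E * B * 2 * L * th * S + E * (K * (3 * N)) * (2 * L * L) * th * S by rewrite /Kt; ring.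
move=> HS; apply: le_trans HS.
apply: le_trans (ler_normD _ _) (lerD _ T4).
apply: le_trans (ler_normD _ _) (lerD _ T3).
exact: le_trans (ler_normD _ _) (lerD T1 T2).
Qed.

End StrictDifferentiability.

Section Field.
Variables (R : realType) (n : nat).
Local Notation X := 'rV[R]_n.
Implicit Types (x y : X) (h : R).
Variables (p u : X -> R) (c C Lp beta : R).
Hypotheses (cp : continuous p) (c1 : 1 < c) (pc : forall x, c <= p x <= C)
  (pL : forall i h x, `|p (x + h *: ebasis R i) - p x| <= Lp * `|h|)
  (Cu : C1 u) (bu : bsupp u) (beta0 : 0 <= beta) (beta1 : 2 * beta <= 1).

Definition plap_field (i : 'I_n) x : R := gradsq u x `^ ((p x - 2) / 2) * partial i u x.

Lemma gradsq_ge0 x : 0 <= gradsq u x.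
Proof. by apply: sumr_ge0 => i _; exact: sqr_ge0. Qed.

Lemma partial_le_gradsq i x : `|partial i u x| <= gradsq u x `^ (1 / 2).
Proof.
rewrite div1r powR12_sqrt ?gradsq_ge0 // -sqrtr_sqr ler_wsqrtr //.
by rewrite /gradsq (bigD1 i) //= lerDl sumr_ge0 // => j _; exact: sqr_ge0.
Qed.

(** [|F| <= |Du|^(p - 1)], with exponent at least [c - 1 > 0]. This gives continuity of the field at
    critical points even where [p < 2], and later its smallness near them. *)
Lemma plap_field_small i x : gradsq u x <= 1 -> `|plap_field i x| <= gradsq u x `^ ((c - 1) / 2).
Proof.
move=> q1; rewrite /plap_field normrM (ger0_norm (powR_ge0 _ _)).
have := gradsq_ge0 x; rewrite le_eqVlt => /orP[/eqP q0|q0].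
  have /eqP -> : partial i u x == 0.
    have := partial_le_gradsq i x; rewrite -q0 powR0 ?normr_le0 // gt_eqF //; lra.
  by rewrite normr0 mulr0 powR_ge0.
apply: (@le_trans _ _ (gradsq u x `^ ((p x - 2) / 2) * gradsq u x `^ (1 / 2))).
  by rewrite ler_wpM2l ?powR_ge0 // partial_le_gradsq.
rewrite -powR_add // !powRE // ler_expR.
have l0 : ln (gradsq u x) <= 0 by exact: ln_le0.
rewrite ler_wnM2r //; have /andP[] := pc x; lra.
Qed.

Lemma cont_plap_field i : continuous (plap_field i).
Proof.
have cmul (f g : X -> R) (y : X) : {for y, continuous f} -> {for y, continuous g} ->
  {for y, continuous (fun z => f z * g z)} by move=> ? ?; exact: continuousM.
move=> x; have := gradsq_ge0 x; rewrite le_eqVlt => /orP[/eqP q0|q0]; last first.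
  apply: (cmul _ _ _ _ _); last by apply: C1_partial_cont.
  have cq : {for x, continuous (fun y => expR ((p y - 2) / 2 * ln (gradsq u y)))}.
    apply: continuous_comp; last exact: continuous_expR.
    apply: (cmul _ _ _ _ _).
      apply: cont_mul; last exact: cst_continuous.
      by apply: cont_sub; [exact: cp|exact: cst_continuous].
    apply: continuous_comp; first exact: cont_gradsq.
    exact: continuous_ln.
  apply: eps_delta_continuous => e ee0.
  have [d d0 Hd] := continuous_eps_delta cq ee0.
  have [d' d'0 Hd'] := continuous_eps_delta (@cont_gradsq _ _ _ Cu x) q0.
  exists (Num.min d d'); first by rewrite lt_min d0.
  move=> y; rewrite lt_min => /andP[/Hd h1 /Hd' h2].
  have qy : 0 < gradsq u y by move: h2; rewrite ltr_norml; lra.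
  by rewrite !powRE // ltW.
have e0 : 0 < (c - 1) / 2 by rewrite divr_gt0 // subr_gt0.
have F0 : plap_field i x = 0.
  apply/eqP; rewrite -normr_le0; apply: le_trans (plap_field_small _ _) _; first by rewrite -q0.
  by rewrite -q0 powR0 // gt_eqF.
apply: eps_delta_continuous => e ee0.
pose t := Num.min 1 (e `^ ((c - 1) / 2)^-1).
have t0 : 0 < t by rewrite lt_min ltr01 powR_gt0.
have [d d0 Hd] := continuous_eps_delta (@cont_gradsq _ _ _ Cu x) t0; exists d => // y /Hd.
rewrite -q0 sub0r normrN ger0_norm ?gradsq_ge0 // lt_min => /andP[y1 ye].
rewrite F0 sub0r normrN; apply: le_trans (plap_field_small _ (ltW y1)) _.
have -> : e = (e `^ ((c - 1) / 2)^-1) `^ ((c - 1) / 2).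
  by rewrite -powRrM mulVf ?gt_eqF // powRr1 // ltW.
by rewrite ge0_ler_powR ?nnegrE ?gradsq_ge0 ?powR_ge0 // ltW.
Qed.

Definition dqu h x (k : 'I_n) : R := dq h k u x.
Definition dqd h x (k i : 'I_n) : R := dq h k (partial i u) x.
Definition dqsq h x : R := \sum_k dqu h x k ^+ 2.
Definition hessq h x : R := \sum_k \sum_i dqd h x k i ^+ 2.
Definition dq_error h x (k i : 'I_n) : R := dq h k (plap_field i) x -
  linearized (dqu h x) (dqd h x) (dqsq h x `^ ((p x - 2) / 2)) (p x - 2) k i.

Lemma partial_uniform_cont (e : R) : 0 < e ->
  exists2 d : R, 0 < d & forall i x y, `|x - y| <= d -> `|partial i u x - partial i u y| <= e.
Proof.
move=> e0.
apply: (finite_uniform (P := fun i d => forall x y, `|x - y| <= d -> `|partial i u x - partial i u y| <= e)).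
  by move=> i d d' dd Hd x y xy; apply: Hd; exact: le_trans dd.
by move=> i; exact: uniform_cont (C1_partial_cont Cu) (partial_bsupp i bu) _ e0.
Qed.

Lemma dqu_bounded : exists2 L : R, 0 < L &
  (forall i x, `|partial i u x| <= L) /\ (forall h x k, h != 0 -> `|dqu h x k| <= L).
Proof.
have [L L0 HL] := partial_bounded Cu bu; exists L => //; split=> // h x k h0.
by rewrite /dqu; have [y _ ->] := dq_mvt k x Cu h0.
Qed.

Lemma dqsq_uniform (e : R) : 0 < e ->
  exists2 d : R, 0 < d & forall h x, 0 < h -> h <= d -> `|dqsq h x - gradsq u x| <= e.
Proof.
move=> e0; have [L L0 [HL _]] := dqu_bounded.
have N0 : 0 <= n%:R * (2 * L + 1) by rewrite mulr_ge0 // addr_ge0 // mulr_ge0 // ltW.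
pose th := Num.min 1 (e / (n%:R * (2 * L + 1) + 1)).
have th0 : 0 < th by rewrite lt_min ltr01 divr_gt0 // ltr_wpDl.
have [d d0 Hd] := dq_partial_uniform Cu bu th0; exists d => // h x h0 hd.
have th01 : 0 <= th <= 1 by rewrite (ltW th0) ge_min lexx.
have := @sumsq_near R n (fun i => partial i u x) (dqu h x) th L th01 (fun i => HL i x).
move=> /(_ (fun i => _)) H; apply: le_trans (H _) _.
  by move=> i; apply: Hd; rewrite ?gt_eqF // gtr0_norm.
have : th <= e / (n%:R * (2 * L + 1) + 1) by rewrite ge_min lexx orbT.
rewrite ler_pdivlMr ?ltr_wpDl // => H1; apply: le_trans H1.
by rewrite ler_wpM2l ?(ltW th0) // lerDl.
Qed.

Lemma hessq_ge0 h x : 0 <= hessq h x.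
Proof. by apply: sumr_ge0 => k _; apply: sumr_ge0 => i _; exact: sqr_ge0. Qed.

Lemma dqd_le h x k i : `|dqd h x k i| <= Num.sqrt (hessq h x).
Proof.
rewrite -sqrtr_sqr ler_wsqrtr // /hessq (bigD1 k) //= (bigD1 i) //= -addrA lerDl.
by rewrite addr_ge0 ?sumr_ge0 // => j _; rewrite ?sqr_ge0 // sumr_ge0 // => l _; rewrite sqr_ge0.
Qed.

(** The increment splits into a change of exponent at fixed gradient and a change of gradient at
    fixed exponent. The constant [CQ] of the first is fixed before [m] and [tau], hence uniform up
    to the critical set; its power of [dqsq] is such that its square times [dqsq^(- beta)] is
    exactly [dqsq^((p - 2) / 2)]. *)
Lemma plap_field_expansion : exists2 CQ : R, 0 <= CQ & forall m tau : R, 0 < m -> 0 < tau ->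
  exists2 h1 : R, 0 < h1 & forall h x, 0 < h -> h <= h1 -> m <= dqsq h x ->
    Num.sqrt (\sum_k \sum_i dq_error h x k i ^+ 2)
    <= CQ * dqsq h x `^ (((p x - 2) / 2 + beta) / 2) + tau * Num.sqrt (hessq h x).
Proof.
have near_half (m l q : R) : 0 < m -> m <= l -> - (m / 2) <= q - l -> q - l <= m / 2 ->
  [/\ m / 2 <= q, q <= 4 * l & l <= 4 * q] by split; lra.
have halfW (t s r : R) : 0 <= s -> t <= s / 2 -> s <= r -> t <= r by lra.
have half2 (t s : R) : t <= s / 2 -> 2 * t <= s by lra.
have half_small (s t : R) : t <= 1 -> s <= t -> s / 2 <= 1 / 2 by lra.
have [L L0 [HL HLw]] := dqu_bounded.
pose N := n%:R * (2 * L + 1) : R.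
have N0 : 0 <= N by rewrite mulr_ge0 // addr_ge0 // mulr_ge0 // ltW.
pose E := C + 2.
have pE x : `|(p x - 2) / 2| <= E.
  by have /andP[? ?] := pc x; rewrite /E ler_norml; apply/andP; split; have := c1; lra.
have E0 : 0 <= E by have := pE 0; apply: le_trans.
have ex1 x : (c / 2 - beta) / 2 <= ((p x - 2) / 2 + 1 - beta) / 2 <= E + 1.
  have /andP[? ?] := pc x; have := beta1; have := beta0; have := c1; rewrite /E => ? ? ?.
  by apply/andP; split; lra.
have ex2 x : `|((p x - 2) / 2 + beta) / 2| <= E + 1.
  have /andP[? ?] := pc x; have := beta1; have := beta0; have := c1; rewrite /E => ? ? ?.
  by rewrite ler_norml; apply/andP; split; lra.
pose M1 := n%:R * L ^+ 2 + N + 1 : R.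
have M11 : 1 <= M1 by rewrite /M1 lerDr addr_ge0 // mulr_ge0 // sqr_ge0.
have e00 : 0 < (c / 2 - beta) / 2 by have := c1; have := beta1; lra.
have [Cl Cl0 HCl] := @powR_ln_bound R _ (E + 1) M1 e00 M11.
have Lp0 : 0 <= `|Lp| by [].
pose Kr := expR ((E + 1) * ln 4) : R.
have Kr0 : 0 <= Kr by exact: expR_ge0.
exists (n%:R * (`|Lp| * (Cl * Kr))).
  by rewrite !mulr_ge0 // ltW.
move=> m tau m0 tau0.
(* Each of the [n^2] entries will contribute [n tau' D], so the root of the sum of squares
   contributes [n^2 tau' D]. *)
pose tau' := tau / (n%:R ^+ 2 + 1).
have n21 : 0 < n%:R ^+ 2 + 1 :> R by rewrite ltr_wpDl // sqr_ge0.
have tau'0 : 0 < tau' by rewrite divr_gt0.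
have [th th0 Hth] := power_field_strict_derivative n m0 (ltW L0) E0 tau'0.
pose th2 := Num.min 1 (Num.min th (m / (2 * (N + 1)))).
have th20 : 0 < th2 by rewrite !lt_min ltr01 th0 /= divr_gt0 // mulr_gt0 // ltr_wpDl.
have th21 : th2 <= 1 by rewrite ge_min lexx.
have th2th : th2 <= th by rewrite /th2 !ge_min lexx orbT.
have th2N : th2 * N <= m / 2.
  have : th2 <= m / (2 * (N + 1)) by rewrite /th2 !ge_min lexx !orbT.
  rewrite ler_pdivlMr ?mulr_gt0 ?ltr_wpDl // => H.
  by rewrite ler_pdivlMr //; apply: le_trans H; lra.
have th220 : 0 < th2 / 2 by rewrite divr_gt0.
have [d1 d10 Hd1] := dq_partial_uniform Cu bu th220.
have [d2 d20 Hd2] := partial_uniform_cont th220.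
pose lb := lnbound (m / 2) M1.
have lb0 : 0 <= lb by rewrite addr_ge0.
(* Keeps the change of exponent times the logarithm below [1 / 2], as [powR_exponent] requires. *)
pose d3 := ((`|Lp| + 1) * (lb + 1))^-1.
have d30 : 0 < d3 by rewrite invr_gt0 mulr_gt0 // ltr_wpDl.
exists (Num.min d1 (Num.min d2 d3)); first by rewrite !lt_min d10 d20.
move=> h x h0; rewrite !le_min => /and3P[hd1 hd2 hd3] mw.
have hne : h != 0 by rewrite gt_eqF.
have hn : `|h| = h by rewrite gtr0_norm.
set lam := dqsq h x in mw *.
set e0 := (p x - 2) / 2.
set D := Num.sqrt (hessq h x).
have D0 : 0 <= D by exact: sqrtr_ge0.
have wL k : `|dqu h x k| <= L by exact: HLw.
have lam0 : 0 < lam by exact: lt_le_trans mw.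
have lamM : lam <= n%:R * L ^+ 2.
  rewrite -sum_ord_const.
  apply: ler_sum => j _; rewrite -real_normK ?num_real // ler_pXn2r ?nnegrE // ltW //.
have qb0 : 0 <= lam `^ ((e0 + beta) / 2) by exact: powR_ge0.
set qb := lam `^ ((e0 + beta) / 2) in qb0 *.
suff entry k i : `|dq_error h x k i| <= `|Lp| * (Cl * Kr) * qb + n%:R * tau' * D.
  set cc := `|Lp| * (Cl * Kr) * qb + n%:R * tau' * D in entry.
  have cc0 : 0 <= cc.
    by rewrite /cc addr_ge0 // !mulr_ge0 // ltW.
  apply: (@le_trans _ _ (n%:R * cc)).
    have -> : n%:R * cc = Num.sqrt ((n%:R * cc) ^+ 2) by rewrite sqrtr_sqr ger0_norm // mulr_ge0.
    apply: ler_wsqrtr.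
    have -> : (n%:R * cc) ^+ 2 = \sum_(k < n) \sum_(i < n) cc ^+ 2.
      by rewrite !sumr_const card_ord exprMn -natrX mulr_natl -mulrnA mulnn.
    apply: ler_sum => k _; apply: ler_sum => i _.
    by rewrite -real_normK ?num_real // ler_pXn2r ?nnegrE.
  rewrite /cc mulrDr !mulrA lerD2l ler_wpM2r //.
  rewrite /tau' ler_pdivrMr // -expr2 mulrC ler_pM2l // lerDl //.
pose xk := x + h *: ebasis R k.
have xk1 : `|x - xk| <= h.
  by rewrite /xk opprD addNKr normrN -{2}hn norm_scale_ebasis_le.
have Hw j : `|partial j u x - dqu h x j| <= th2 / 2 by rewrite distrC; apply: Hd1 => //; rewrite hn.
have Hw1 j : `|partial j u xk - dqu h x j| <= th2.
  have -> : partial j u xk - dqu h x j = (partial j u xk - partial j u x) + (partial j u x - dqu h x j) by ring.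
  have Hk : `|partial j u xk - partial j u x| <= th2 / 2.
    by rewrite distrC; apply: Hd2; apply: le_trans xk1 _.
  by rewrite [leRHS]splitr (le_trans (ler_normD _ _)) // lerD.
have q1near : `|gradsq u xk - lam| <= m / 2.
  apply: le_trans th2N; apply: (@sumsq_near R n (dqu h x) (fun i => partial i u xk)) => //.
  by rewrite (ltW th20).
have /andP[q1a q1b] : - (m / 2) <= gradsq u xk - lam <= m / 2 by rewrite -ler_norml.
set q1 := gradsq u xk in q1a q1b *.
have [q1m q14 lam4] := near_half m lam q1 m0 mw q1a q1b.
have q10 : 0 < q1 by apply: lt_le_trans q1m; rewrite divr_gt0.
have q1M : q1 <= M1.
  have qN : q1 - lam <= N.
    apply: le_trans (ler_norm _) _; apply: (@le_trans _ _ (th2 * N)); last by rewrite ler_piMl.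
    apply: (@sumsq_near R n (dqu h x) (fun i => partial i u xk)) => //.
    by rewrite (ltW th20).
  by rewrite -(subrK lam q1) addrC /M1 -addrA lerD // ler_wpDr.
set e1 := (p xk - 2) / 2.
have e10 : `|e1 - e0| <= `|Lp| * h / 2.
  have -> : e1 - e0 = (p xk - p x) / 2 by rewrite /e1 /e0; field.
  rewrite normrM (@ger0_norm _ 2^-1) ?invr_ge0 // ler_pM2r ?invr_gt0 //.
  apply: le_trans (pL k h x) _; rewrite hn ler_wpM2r ?(ltW h0) // ler_norm //.
have lnq : `|ln q1| <= lb by apply: ln_bound => //; rewrite divr_gt0.
have small : `|(e1 - e0) * ln q1| <= 1 / 2.
  rewrite normrM; apply: (@le_trans _ _ (`|Lp| * h / 2 * lb)); first exact: ler_pM.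
  have H1 : h * ((`|Lp| + 1) * (lb + 1)) <= 1.
    by rewrite -ler_pdivlMr ?mul1r // mulr_gt0 // ltr_wpDl.
  have H2 : h * (`|Lp| * lb) <= h * ((`|Lp| + 1) * (lb + 1)).
    rewrite ler_wpM2l ?(ltW h0) // ler_pM ?mulr_ge0 // lerDl //.
  have -> : `|Lp| * h / 2 * lb = h * (`|Lp| * lb) / 2 by ring.
  exact: half_small H1 H2.
have Qb : `|h^-1 * (q1 `^ e1 - q1 `^ e0) * partial i u xk| <= `|Lp| * (Cl * Kr) * qb.
  have P1 := powR_exponent q10 small.
  rewrite !normrM (ger0_norm (_ : 0 <= h^-1)) ?invr_ge0 ?(ltW h0) //.
  apply: (@le_trans _ _ (h^-1 * (`|Lp| * h * `|ln q1| * q1 `^ e0) * q1 `^ (1 / 2))).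
    rewrite ler_pM ?mulr_ge0 ?invr_ge0 ?(ltW h0) //; last exact: partial_le_gradsq.
    rewrite ler_wpM2l ?invr_ge0 ?(ltW h0) //; apply: le_trans P1 _.
    by rewrite ler_wpM2r ?powR_ge0 // ler_wpM2r // half2.
  have -> : h^-1 * (`|Lp| * h * `|ln q1| * q1 `^ e0) * q1 `^ (1 / 2)
    = `|Lp| * ((q1 `^ ((e0 + 1 - beta) / 2) * `|ln q1|) * q1 `^ ((e0 + beta) / 2)).
    (* The first factor on the right pays for the logarithm: its exponent is at least
       [(c / 2 - beta) / 2 > 0]. The second is the power announced in the statement. *)
    have E1 : q1 `^ e0 * q1 `^ (1 / 2) = q1 `^ ((e0 + 1 - beta) / 2) * q1 `^ ((e0 + beta) / 2).
      by rewrite -!powR_add //; congr (_ `^ _); field.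
    transitivity (`|Lp| * `|ln q1| * (q1 `^ e0 * q1 `^ (1 / 2))); first by field.
    by rewrite E1; ring.
  rewrite -!mulrA ler_wpM2l // mulrA ler_pM ?powR_ge0 ?mulr_ge0 ?powR_ge0 //.
    by apply: HCl; [exact: ex1|rewrite q10].
  exact: (powR_ratio q10 lam0 q14 lam4 (ex2 x)).
have Tb : `|h^-1 * (q1 `^ e0 * partial i u xk - gradsq u x `^ e0 * partial i u x
   - lam `^ e0 * ((partial i u xk - partial i u x) + 2 * e0 / lam * (\sum_j dqu h x j * (partial j u xk - partial j u x)) * dqu h x i))|
   <= n%:R * tau' * D.
  rewrite normrM (ger0_norm (_ : 0 <= h^-1)) ?invr_ge0 ?(ltW h0) //.
  have H := Hth e0 (dqu h x) (fun j => partial j u x) (fun j => partial j u xk) (pE x) mw wL _ _ i.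
  apply: (@le_trans _ _ (h^-1 * (tau' * \sum_j `|partial j u xk - partial j u x|))).
    rewrite ler_wpM2l ?invr_ge0 ?(ltW h0) //; apply: H => j.
      exact: halfW (ltW th20) (Hw j) th2th.
    exact: le_trans (Hw1 j) th2th.
  rewrite mulrCA [n%:R * tau']mulrC -[leRHS]mulrA ler_pM2l // mulr_sumr.
  rewrite -sum_ord_const.
  apply: ler_sum => j _; apply: le_trans (dqd_le h x k j).
  by rewrite /dqd /dq -/xk normrM (ger0_norm (_ : 0 <= h^-1)) ?invr_ge0 ?(ltW h0).
have -> : dq_error h x k i = h^-1 * (q1 `^ e1 - q1 `^ e0) * partial i u xk
  + h^-1 * (q1 `^ e0 * partial i u xk - gradsq u x `^ e0 * partial i u x
   - lam `^ e0 * ((partial i u xk - partial i u x) + 2 * e0 / lam * (\sum_j dqu h x j * (partial j u xk - partial j u x)) * dqu h x i)).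
  have S1 : \sum_j dqu h x j * dqd h x k j = h^-1 * \sum_j dqu h x j * (partial j u xk - partial j u x).
    by rewrite mulr_sumr; apply: eq_bigr => j _; rewrite /dqd /dq -/xk; ring.
  rewrite /dq_error /linearized -/lam S1 /dqd /dq -/xk /plap_field -/q1 -/e0 -/e1 -/(dqsq h x) -/lam.
  have -> : p x - 2 = 2 * e0 by rewrite /e0; field.
  move: (h^-1) (q1 `^ e1) (q1 `^ e0) (gradsq u x `^ e0) (lam `^ e0) (partial i u xk) (partial i u x) (dqu h x i)
    (\sum_j _) (2 * e0 / lam) => a1 a2 a3 a4 a5 a6 a7 a8 a9 a10; clear; ring.
exact: le_trans (ler_normD _ _) (lerD Qb Tb).
Qed.

End Field.

(** * Second-order estimates *)

Section EnergyPointwise.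
Variables (R : realType) (n : nat).
Local Notation X := 'rV[R]_n.
Implicit Types (x y : X) (h : R).
Variables (p u : X -> R) (c C Lp beta Ml : R).
Hypotheses (c1 : 1 < c) (c2 : c <= 2) (pc : forall x, c <= p x <= C)
  (pL : forall i h x, `|p (x + h *: ebasis R i) - p x| <= Lp * `|h|)
  (Cu : C1 u) (bu : bsupp u) (beta0 : 0 <= beta) (beta1 : 2 * beta < 1)
  (Ml1 : 1 <= Ml) (lamM : forall h x, 0 < h -> dqsq u h x <= Ml).

(* The first lower bound on [dg] is what ellipticity can absorb; the quadratic bound lets Young's
   inequality split the error terms. *)
Definition admissible_weight (G0 t g dg : R) :=
  [/\ 0 <= g, g <= t `^ (- beta), - (2 * beta) * g <= 2 * dg * t &
      (g + 2 * `|dg| * t) ^+ 2 <= 4 * G0 * t `^ (- beta) * g].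

Definition energy_const := (1 - 2 * beta) * (c - 1) / 2.

Lemma energy_const_gt0 : 0 < energy_const.
Proof. by rewrite divr_gt0 // mulr_gt0 // subr_gt0. Qed.

(** [C0] is fixed before the weight and the floor [m0]; whatever degenerates as [m0] tends to [0] is
    confined to the [tau] term by taking the step small. *)
Lemma energy_pointwise (G0 Z : R) : 0 <= G0 -> 0 <= Z -> exists2 C0 : R, 0 <= C0 &
  forall (g dg : R -> R) (m0 tau : R), 0 < m0 -> 0 < tau ->
    (forall t, m0 <= t <= Ml -> admissible_weight G0 t (g t) (dg t)) ->
  exists2 h3 : R, 0 < h3 & forall h x (z : R) (zd : 'I_n -> R), 0 < h -> h <= h3 -> m0 <= dqsq u h x ->
    0 <= z <= 1 -> Num.sqrt (\sum_i zd i ^+ 2) <= Z ->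
    energy_const * (z ^+ 2 * g (dqsq u h x) * dqsq u h x `^ ((p x - 2) / 2) * hessq u h x)
    <= \sum_k \sum_i dq h k (plap_field p u i) x *
         test_grad (dqu u h x) zd (dqd u h x) (g (dqsq u h x)) (dg (dqsq u h x)) z k i
       + C0 + tau * (2 * (z ^+ 2 * hessq u h x) + Z ^+ 2).
Proof.
move=> G00 Z0.
have G0sq : G0 <= (G0 + 1) ^+ 2 by nra.
have ex x : 0 <= - beta + (p x - 2) / 2 + 1 <= C + 2.
  have /andP[? ?] := pc x; have := c1; have := beta0; have := beta1 => ? ? ?.
  by apply/andP; split; lra.
have kp x : [/\ -1 < p x - 2, c - 1 <= 1 + (p x - 2) & `|p x - 2| <= (C + 2) - 1].
  by have /andP[? ?] := pc x; have := c1 => ?; split; [lra|lra|rewrite ler_norml; apply/andP; split; lra].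
have c11 : 0 < c - 1 <= 1 by rewrite subr_gt0 c1 /=; have := c2; lra.
have b11 : 1 - 2 * beta <= 1 by rewrite gerBl mulr_ge0.
have [CQ CQ0 HCQ] := plap_field_expansion c1 pc pL Cu bu beta0 (ltW beta1).
pose E := C + 2.
have E0 : 0 <= E by have /andP[? ?] := pc 0; have := c1; rewrite /E; lra.
pose K := expR (E * ln Ml) : R.
have K0 : 0 <= K by exact: expR_ge0.
pose b := 1 - 2 * beta; pose c1' := c - 1.
have b0 : 0 < b by rewrite subr_gt0.
have c1'0 : 0 < c1' by rewrite subr_gt0.
have bc0 : 0 < b * c1' by rewrite mulr_gt0.
exists (4 / (b * c1') * K * (C + 2) ^+ 2 * Z ^+ 2 + 4 * G0 / (b * c1') * CQ ^+ 2 + CQ ^+ 2 * K + Z ^+ 2).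
  have h4 : 0 <= 4 / (b * c1') by rewrite divr_ge0 // ltW.
  have h5 : 0 <= 4 * G0 / (b * c1') by rewrite divr_ge0 ?mulr_ge0 // ltW.
  have h6 := sqr_ge0 CQ; have h7 := sqr_ge0 Z; have h8 := sqr_ge0 (C + 2).
  move: (4 / _) (4 * G0 / _) (CQ ^+ 2) (Z ^+ 2) ((C + 2) ^+ 2) h4 h5 h6 h7 h8 => a1 a2 a3 a4 a5 *.
  by rewrite !addr_ge0 // !mulr_ge0.
move=> g dg m0 tau m00 tau0 Hg.
pose B := m0 `^ (- beta).
have B0 : 0 <= B by exact: powR_ge0.
(* This bound on the weight terms grows with [B = m0^(- beta)]; running the expansion with
   [tau / (M + 1)] compensates for it. *)
pose M := 2 * (G0 + 1) * B + B * Ml.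
have G10 : 0 <= G0 + 1 by rewrite addr_ge0.
have Ml0 : 0 <= Ml by apply: le_trans Ml1.
have M0 : 0 <= M by rewrite /M addr_ge0 // !mulr_ge0.
have M10 : 0 < M + 1 by rewrite ltr_wpDl.
have tau10 : 0 < tau / (M + 1) by rewrite divr_gt0.
have [h3 h30 Hh3] := HCQ m0 (tau / (M + 1)) m00 tau10.
exists h3 => // h x z zd h0 hh3 mlam z01 HZ.
have lamMl := lamM x h0.
have lamI : m0 <= dqsq u h x <= Ml by rewrite mlam.
have [g0 ggb dgb gtb] := Hg _ lamI.
have lam0 : 0 < dqsq u h x by exact: lt_le_trans mlam.
have gbB : dqsq u h x `^ (- beta) <= B.
  rewrite /B !powRE // ler_expR !mulNr lerN2 ler_wpM2l //.
  by rewrite ler_ln ?posrE.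
have a0 : 0 < dqsq u h x `^ ((p x - 2) / 2) by exact: powR_gt0.
have [kp1 c1kp c2kp] := kp x.
(* The total exponent is [p / 2 - beta], which is positive, so the product stays bounded up to the
   critical set. *)
have HK : dqsq u h x `^ (- beta) * dqsq u h x `^ ((p x - 2) / 2) * dqsq u h x <= K.
  rewrite -[in X in _ * X <= _](powRr1 (ltW lam0)) -!powR_add //.
  by apply: powR_le_exp; rewrite ?lam0.
have HQ : dqsq u h x `^ (- beta) * (CQ * dqsq u h x `^ (((p x - 2) / 2 + beta) / 2)) ^+ 2
    <= CQ ^+ 2 * dqsq u h x `^ ((p x - 2) / 2).
  rewrite exprMn mulrCA ler_wpM2l ?sqr_ge0 // expr2 -!powR_add // le_eqVlt; apply/orP; left.
  by apply/eqP; congr (_ `^ _); field.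
have gt0 : 0 <= g (dqsq u h x) + 2 * `|dg (dqsq u h x)| * dqsq u h x.
  by rewrite addr_ge0 // mulr_ge0 ?mulr_ge0 // ltW.
have gtM : g (dqsq u h x) + 2 * `|dg (dqsq u h x)| * dqsq u h x <= M.
  apply: (@le_trans _ _ (2 * (G0 + 1) * B)); last by rewrite /M lerDl mulr_ge0.
  rewrite -(ler_pXn2r (_ : (0 < 2)%N)) // ?nnegrE ?mulr_ge0 //.
  apply: le_trans gtb _; apply: (@le_trans _ _ (4 * G0 * B * B)).
    by rewrite ler_pM ?mulr_ge0 ?powR_ge0 // ?(le_trans ggb) // ler_wpM2l ?mulr_ge0.
  have -> : (2 * (G0 + 1) * B) ^+ 2 = 4 * (G0 + 1) ^+ 2 * (B * B) by ring.
  rewrite -mulrA ler_wpM2r ?mulr_ge0 //.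
  by apply: ler_wpM2l G0sq; rewrite ler0n.
have gM : g (dqsq u h x) * Num.sqrt (dqsq u h x) <= M.
  apply: (@le_trans _ _ (B * Ml)); last by rewrite /M lerDr !mulr_ge0.
  rewrite ler_pM ?sqrtr_ge0 // ?(le_trans ggb) //.
  apply: (@le_trans _ _ (Num.sqrt (Ml ^+ 2))); last by rewrite sqrtr_sqr ger0_norm.
  by rewrite ler_wsqrtr // (le_trans lamMl) // expr2 ler_peMl.
have Q00 : 0 <= CQ * dqsq u h x `^ (((p x - 2) / 2 + beta) / 2) by rewrite mulr_ge0 // powR_ge0.
have HE := Hh3 h x h0 hh3 mlam.
have b01 : 0 < b <= 1 by rewrite b0.
have dgb' : - (1 - b) * g (dqsq u h x) <= 2 * dg (dqsq u h x) * dqsq u h x.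
  by have -> : 1 - b = 2 * beta by rewrite /b; ring.
have H := @energy_lower R n (dqu u h x) zd (dqd u h x) (dq_error p u h x) _ _ _ _ _ _ _ _ _ _ _ _ _ _ _ _
  lam0 a0 kp1 c11 c1kp c2kp b01 z01 g0 ggb dgb' G00 gtb gtM gM Q00 (ltW tau10) HE HQ HK Z0 HZ.
apply: le_trans H _.
rewrite -/(hessq u h x).
have -> : \sum_k \sum_i (linearized (dqu u h x) (dqd u h x) (dqsq u h x `^ ((p x - 2) / 2)) (p x - 2) k i + dq_error p u h x k i) *
    test_grad (dqu u h x) zd (dqd u h x) (g (dqsq u h x)) (dg (dqsq u h x)) z k i =
   \sum_k \sum_i dq h k (plap_field p u i) x *
         test_grad (dqu u h x) zd (dqd u h x) (g (dqsq u h x)) (dg (dqsq u h x)) z k i.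
  by apply: eq_bigr => k _; apply: eq_bigr => i _; rewrite /dq_error addrC subrK.
rewrite lerD2l ler_wpM2r //.
  by rewrite addr_ge0 ?sqr_ge0 // mulr_ge0 // mulr_ge0 ?sqr_ge0 // hessq_ge0.
by rewrite mulrAC ler_pdivrMr // ler_wpM2l ?(ltW tau0) // lerDl.
Qed.

End EnergyPointwise.

Section EnergyIdentity.
Variables (R : realType) (n : nat).
Local Notation X := 'rV[R]_n.
Implicit Types (x y : X) (h : R).
Variables (F : 'I_n -> X -> R) (u : X -> R) (O : set X).
Hypotheses (cF : forall i, continuous (F i)) (Cu : C1 u) (bu : bsupp u) (oO : open O).
Hypothesis FO : forall f, C1 f -> supp_in O f -> flux F f = 0.

(** Testing with [psi] and with its shift by [h e_k], then translating the second integral back,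
    puts the difference quotient on [F]. [compact_room] keeps the shifted support inside [O]. *)
Lemma shifted_flux (K : set X) : compact K -> K `<=` O -> exists2 h0 : R, 0 < h0 &
  forall h k (psi : X -> R), 0 < h -> h <= h0 -> C1 psi -> (forall x, ~ K x -> psi x = 0) ->
    integ (fun x => \sum_i dq h k (F i) x * partial i psi x) = 0.
Proof.
move=> cK KO; have [r r0 [K' [cK' K'O HK']]] := compact_room cK oO KO.
exists r => // h k psi h0 hr Cpsi psi0.
have bpsi : bsupp psi by apply: (@supp_in_bsupp _ _ setT); exists K.
set v := h *: ebasis R k.
have [Ct Et] := C1_translate (- v) Cpsi.
have bt : bsupp (fun x => psi (x - v)) by exact: bsupp_translate.
have I0 : flux F psi = 0 by apply: FO => //; exists K.
have I1 : flux F (fun x => psi (x - v)) = 0.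
  apply: FO => //; exists K'; split=> // x nK'; apply: psi0 => Kx; apply: nK'.
  apply: (HK' (x - v)) => //; rewrite opprB addrC subrK.
  apply: le_trans (norm_scale_ebasis_le _ _) _; by rewrite gtr0_norm.
have H1 := Cc_flux cF Ct bt; have H0 := Cc_flux cF Cpsi bpsi.
have H2 := Cc_translate v H1.
have -> : (fun x => \sum_i dq h k (F i) x * partial i psi x) = (fun x => h^-1 *
   (\sum_i F i (x + v) * partial i (fun x => psi (x - v)) (x + v) - \sum_i F i x * partial i psi x)).
  apply/funext => x; rewrite -sumrB mulr_sumr; apply: eq_bigr => i _.
  by rewrite Et addrK /dq -/v; ring.
rewrite integ_scale; last exact: Cc_sub.
rewrite integ_sub // (@integ_translate _ _ (fun x => \sum_i F i x * partial i (fun x => psi (x - v)) x)) //.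
by rewrite -/(flux F (fun x => psi (x - v))) -/(flux F psi) I0 I1 subrr mulr0.
Qed.

Lemma C1_dqu h k : C1 (fun x => dqu u h x k) /\ forall i, partial i (fun x => dqu u h x k) = (fun x => dqd u h x k i).
Proof. by have [H E] := C1_dq k h Cu. Qed.

Lemma C1_dqsq h : C1 (dqsq u h) /\
  forall i, partial i (dqsq u h) = (fun x => 2 * \sum_k dqu u h x k * dqd u h x k i).
Proof.
have H k : C1 (fun x => dqu u h x k ^+ 2) /\ forall i, partial i (fun x => dqu u h x k ^+ 2) = (fun x => 2 * (dqu u h x k * dqd u h x k i)).
  have [H1 E1] := C1_dqu h k; have [H2 E2] := C1_mul H1 H1; split => // i.
  by rewrite E2 E1; apply/funext => x; ring.
have [HS ES] := C1_sum (index_enum 'I_n) (fun k => (H k).1); split => // i.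
rewrite ES; apply/funext => x; rewrite mulr_sumr; apply: eq_bigr => k _; by rewrite (H k).2.
Qed.

Lemma cont_hessq h : continuous (hessq u h).
Proof.
apply: cont_sum => k; apply: cont_sum => i; apply: cont_exp.
by apply: (Cc_cont (Cc_dq k h _)); split; [exact: C1_partial_cont|exact: partial_bsupp].
Qed.

(** [z] may be non-zero at critical points; the weight vanishes there, so [z^2 g(lam) w_k] is an
    admissible test function although [z] itself is not. *)
Lemma energy_identity (K : set X) : compact K -> K `<=` O -> exists2 h0 : R, 0 < h0 &
  forall h (z : X -> R) (g dg : R -> R), 0 < h -> h <= h0 -> C1 z -> bsupp z ->
    (forall t : R, is_derive t (1:R) g (dg t)) -> continuous dg ->
    (forall x, ~ K x -> z x != 0 -> g (dqsq u h x) = 0) ->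
  let G x := \sum_k \sum_i dq h k (F i) x *
    test_grad (dqu u h x) (fun i => partial i z x) (dqd u h x) (g (dqsq u h x)) (dg (dqsq u h x)) (z x) k i in
  Cc G /\ integ G = 0.
Proof.
move=> cK KO; have [h0 h00 H] := shifted_flux cK KO; exists h0 => // h z g dg hp hh Cz bz Hg cdg gK.
pose psi k x := z x * z x * (g (dqsq u h x) * dqu u h x k).
have [Cl El] := C1_dqsq h.
have [Cg Eg] := C1_comp Cl Hg cdg.
have [Czz Ezz] := C1_mul Cz Cz.
have Hpsi k : C1 (psi k) /\ forall i x, partial i (psi k) x =
   test_grad (dqu u h x) (fun i => partial i z x) (dqd u h x) (g (dqsq u h x)) (dg (dqsq u h x)) (z x) k i.
  have [Cw Ew] := C1_dqu h k; have [Cgw Egw] := C1_mul Cg Cw; have [Cp Ep] := C1_mul Czz Cgw.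
  split => // i x; rewrite /psi Ep Ezz Egw Eg Ew El /test_grad; ring.
have bpsi k : bsupp (psi k) by apply: bsupp_mull; exact: bsupp_mull.
have CcF k : Cc (fun x => \sum_i dq h k (F i) x * partial i (psi k) x).
  apply: Cc_flux => //; last exact: (Hpsi k).1.
  move=> i; apply: cont_mul; first exact: cst_continuous.
  by apply: cont_sub => //; exact: cont_translate.
move=> G.
have GE : G = fun x => \sum_k \sum_i dq h k (F i) x * partial i (psi k) x.
  by apply/funext => x; apply: eq_bigr => k _; apply: eq_bigr => i _; rewrite (Hpsi k).2.
rewrite GE; split; first exact: Cc_sum.
rewrite integ_sum // big1 // => k _; apply: H => //; first exact: (Hpsi k).1.
move=> x nK; rewrite /psi; have [->|zx] := eqVneq (z x) 0; first by rewrite !mul0r.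
by rewrite (gK x nK zx) mul0r mulr0.
Qed.

End EnergyIdentity.

Section SecondOrderBounds.
Variables (R : realType) (n : nat).
Local Notation X := 'rV[R]_n.
Implicit Types (x y : X) (h : R).
Variables (p u : X -> R) (c C Lp beta Ml : R) (V : set X).
Hypotheses (cp : continuous p) (c1 : 1 < c) (c2 : c <= 2) (pc : forall x, c <= p x <= C)
  (pL : forall i h x, `|p (x + h *: ebasis R i) - p x| <= Lp * `|h|)
  (Cu : C1 u) (bu : bsupp u) (beta0 : 0 <= beta) (beta1 : 2 * beta < 1)
  (Ml1 : 1 <= Ml) (lamM : forall h x, 0 < h -> dqsq u h x <= Ml) (oV : open V)
  (FV : forall f, C1 f -> supp_in (V `&` [set x | 0 < gradsq u x]) f -> flux (plap_field p u) f = 0).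

Let O := V `&` [set x | 0 < gradsq u x].
Let energy_const0 : 0 < energy_const c beta := energy_const_gt0 c1 beta1.

Lemma open_regular : open O.
Proof. by apply: openI => //; apply: open_gt; exact: cont_gradsq. Qed.

(** The density contains [dqsq^((p - 2) / 2)], a factor that is not continuous at [0] when [p < 2].
    Hence the left side is any continuous [Y] below the density, and the unweighted energy enters
    through a continuous [W] above it on [K]. [C0] depends neither on the weight nor on [K]. *)
Lemma energy_bound (G0 Z : R) : 0 <= G0 -> 0 <= Z -> exists2 C0 : R, 0 <= C0 &
  forall (z : X -> R) (g dg : R -> R) (K : set X) (m0 tau h2 : R),
    C1 z -> bsupp z -> (forall x, 0 <= z x <= 1) -> (forall x, Num.sqrt (\sum_i partial i z x ^+ 2) <= Z) ->
    (forall t : R, is_derive t (1:R) g (dg t)) -> continuous dg ->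
    compact K -> K `<=` O -> 0 < m0 -> 0 < tau -> 0 < h2 ->
    (forall t, m0 <= t <= Ml -> admissible_weight beta G0 t (g t) (dg t)) ->
    (forall h x, 0 < h -> h <= h2 -> K x -> m0 <= dqsq u h x) ->
    (forall h x, 0 < h -> h <= h2 -> ~ K x -> z x != 0 -> g (dqsq u h x) = 0 /\ dg (dqsq u h x) = 0) ->
  exists2 h3 : R, 0 < h3 & forall h (Y W eta : X -> R), 0 < h -> h <= h3 -> Cc Y -> Cc W -> Cc eta ->
    (forall x, Y x <= energy_const c beta * (z x ^+ 2 * g (dqsq u h x) * dqsq u h x `^ ((p x - 2) / 2) * hessq u h x)) ->
    (forall x, 0 <= W x) -> (forall x, K x -> z x ^+ 2 * hessq u h x <= W x) ->
    (forall x, 0 <= eta x) -> (forall x, K x -> 1 <= eta x) ->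
    integ Y <= C0 * integ eta + tau * (2 * integ W + Z ^+ 2 * integ eta).
Proof.
move=> G00 Z0.
have [C0 C00 HC0] := energy_pointwise c1 c2 pc pL Cu bu beta0 beta1 Ml1 lamM G00 Z0.
exists C0 => // z g dg K m0 tau h2 Cz bz z01 HZ Dg cdg cK KO m00 tau0 h20 Hg Km Kz.
have [h3 h30 H3] := HC0 g dg m0 tau m00 tau0 Hg.
have cF := cont_plap_field cp c1 pc Cu.
have [h4 h40 H4] := energy_identity cF Cu open_regular FV cK KO.
exists (Num.min h2 (Num.min h3 h4)); first by rewrite !lt_min h20 h30.
move=> h Y W eta h0; rewrite !le_min => /and3P[hh2 hh3 hh4] HY HW He YE W0 KW e0 e1.
have [|CG IG] := H4 h z g dg h0 hh4 Cz bz Dg cdg.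
  by move=> x nK zx; have [] := Kz h x h0 hh2 nK zx.
set G := (fun x => \sum_k _) in CG IG.
have Ctot : Cc (fun x => G x + C0 * eta x + tau * (2 * W x + Z ^+ 2 * eta x)).
  apply: Cc_add; first by apply: Cc_add => //; exact: Cc_scale.
  by apply: Cc_scale; apply: Cc_add; exact: Cc_scale.
have -> : C0 * integ eta + tau * (2 * integ W + Z ^+ 2 * integ eta)
   = integ (fun x => G x + C0 * eta x + tau * (2 * W x + Z ^+ 2 * eta x)).
  have C1' : Cc (fun x => C0 * eta x) by exact: Cc_scale.
  have C2' : Cc (fun x => 2 * W x) by exact: Cc_scale.
  have C3' : Cc (fun x => Z ^+ 2 * eta x) by exact: Cc_scale.
  have C4' : Cc (fun x => 2 * W x + Z ^+ 2 * eta x) by exact: Cc_add.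
  have C5' : Cc (fun x => G x + C0 * eta x) by exact: Cc_add.
  have C6' : Cc (fun x => tau * (2 * W x + Z ^+ 2 * eta x)) by exact: Cc_scale.
  rewrite integ_add // integ_add // IG add0r [integ (fun x => tau * _)]integ_scale // integ_add //.
  by rewrite !integ_scale.
apply: integ_le => // x; apply: le_trans (YE x) _.
have [Kx|nKx] := pselect (K x).
  have H := H3 h x (z x) (fun i => partial i z x) h0 hh3 (Km h x h0 hh2 Kx) (z01 x) (HZ x).
  apply: le_trans H _; apply: lerD.
    by rewrite lerD2l ler_peMr //; exact: e1.
  rewrite ler_wpM2l ?(ltW tau0) //; apply: lerD.
    by rewrite ler_wpM2l //; exact: KW.
  by rewrite ler_peMr ?sqr_ge0 //; exact: e1.
have rest : 0 <= C0 * eta x + tau * (2 * W x + Z ^+ 2 * eta x).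
  by rewrite addr_ge0 ?mulr_ge0 ?addr_ge0 ?mulr_ge0 ?sqr_ge0 // ltW.
rewrite -addrA.
have G0x : (z x = 0 \/ (g (dqsq u h x) = 0 /\ dg (dqsq u h x) = 0)).
  by have [->|zx] := eqVneq (z x) 0; [left|right; exact: Kz].
have -> : G x = 0.
  rewrite /G big1 // => k _; rewrite big1 // => i _; rewrite /test_grad.
  by case: G0x => [->|[-> ->]]; ring.
rewrite add0r; apply: le_trans rest; rewrite le_eqVlt; apply/orP; left; apply/eqP.
by case: G0x => [->|[-> _]]; ring.
Qed.

Lemma grad_norm_bounded (z : X -> R) : C1 z -> bsupp z -> exists2 Z : R, 0 <= Z &
  forall x, Num.sqrt (\sum_i partial i z x ^+ 2) <= Z.
Proof.
move=> Cz bz; have [L L0 HL] := partial_bounded Cz bz.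
exists (Num.sqrt (n%:R * L ^+ 2)) => // x; apply: ler_wsqrtr.
rewrite -sum_ord_const.
by apply: ler_sum => i _; rewrite -real_normK ?num_real // ler_pXn2r ?nnegrE ?(ltW L0).
Qed.

(** Away from the critical points a constant weight suffices, and [tau = A / 4] lets the unweighted
    error be absorbed on the left. The bound depends on the support of [z]; it serves to make the
    error of the weighted estimate small. *)
Lemma hessq_local_bound (z : X -> R) : C1 z -> supp_in O z -> (forall x, 0 <= z x <= 1) ->
  exists (h3 C3 : R), [/\ 0 < h3, 0 <= C3 &
    forall h, 0 < h -> h <= h3 -> integ (fun x => z x ^+ 2 * hessq u h x) <= C3].
Proof.
move=> Cz [K [cK KO zK]] z01.
have bz : bsupp z by apply: (@supp_in_bsupp _ _ setT); exists K.
have [Z Z0 HZ] := grad_norm_bounded Cz bz.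
have G00 : 0 <= 1 :> R by [].
have [C0 C00 H] := energy_bound G00 Z0.
have [m m0 Hm] := compact_lower_bound cK (cont_gradsq Cu) (fun x Kx => (KO x Kx).2).
have m20 : 0 < m / 2 by rewrite divr_gt0.
have [h2 h20 Hh2] := dqsq_uniform Cu bu m20.
have Km h x : 0 < h -> h <= h2 -> K x -> m / 2 <= dqsq u h x.
  move=> h0 hh2 /Hm; have := Hh2 h x h0 hh2; rewrite ler_norml; lra.
(* The largest constant below [t^(- beta)] for all positive [t <= Ml], as admissibility demands. *)
pose g0 := Ml `^ (- beta).
have Ml0 : 0 < Ml by apply: lt_le_trans Ml1.
have g00 : 0 < g0 by exact: powR_gt0.
have adm t : m / 2 <= t <= Ml -> admissible_weight beta 1 t g0 0.
  move=> /andP[mt tM]; have t0 : 0 < t by exact: lt_le_trans mt.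
  have gt : g0 <= t `^ (- beta).
    rewrite /g0 !powRE // ler_expR !mulNr lerN2 ler_wpM2l // ler_ln ?posrE //.
  split => //; first exact: ltW.
    by rewrite mulr0 mul0r mulNr oppr_le0 mulr_ge0 ?(ltW g00) // mulr_ge0.
  rewrite normr0 mulr0 mul0r addr0 expr2 mulr1 ler_pM2r //.
  apply: le_trans gt _; rewrite ler_peMl ?powR_ge0 //; lra.
pose am := expR (- ((C + 2) * lnbound (m / 2) Ml)).
have am0 : 0 < am by exact: expR_gt0.
pose A := energy_const c beta * g0 * am.
have A0 : 0 < A by rewrite /A mulr_gt0 // mulr_gt0.
have tau0 : 0 < A / 4 by rewrite divr_gt0.
have Dg (t : R) : is_derive t (1:R) (fun=> g0) 0 by exact: is_derive_cst.
have [|h3 h30 H3] := H z _ _ K _ _ _ Cz bz z01 HZ Dg (@cst_continuous _ _ 0) cK KO m20 tau0 h20 adm Km.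
  by move=> h x _ _ nK; rewrite zK ?eqxx.
have [eta [He e0 e1]] := compact_plateau cK.
have Ie : 0 <= integ eta by exact: integ_ge0.
pose B := C0 * integ eta + A / 4 * (Z ^+ 2 * integ eta).
have B0 : 0 <= B.
  have ZI : 0 <= Z ^+ 2 * integ eta by rewrite mulr_ge0 ?sqr_ge0.
  have CI : 0 <= C0 * integ eta by rewrite mulr_ge0.
  by rewrite /B addr_ge0 // mulr_ge0 // (ltW tau0).
exists (Num.min h2 h3), (2 / A * B); split.
- by rewrite lt_min h20.
- by rewrite mulr_ge0 // divr_ge0 // ltW.
move=> h h0; rewrite le_min => /andP[hh2 hh3].
pose W x := z x ^+ 2 * hessq u h x.
have HW : Cc W.
  apply: Cc_mulr; last exact: cont_hessq.
  split; first by apply: cont_exp; exact: C1_cont.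
  by case: bz => r' zr; exists r' => x rx; rewrite zr // expr0n.
have W0 x : 0 <= W x by rewrite mulr_ge0 ?sqr_ge0 ?hessq_ge0.
have := H3 h (fun x => A * W x) W eta h0 hh3 (Cc_scale _ HW) HW He _ W0 (fun x _ => lexx _) e0 e1.
rewrite integ_scale // => H4.
have {}H4 : A * integ W <= C0 * integ eta + A / 4 * (2 * integ W + Z ^+ 2 * integ eta).
  apply: H4 => x; have [Kx|nKx] := pselect (K x); last first.
    by rewrite /W zK // expr0n /= !mul0r !mulr0.
  have lm := Km h x h0 hh2 Kx; have l0 : 0 < dqsq u h x by exact: lt_le_trans lm.
  have lM := lamM x h0.
  have -> : A * W x = energy_const c beta * (z x ^+ 2 * g0 * am * hessq u h x) by rewrite /A /W; ring.
  rewrite ler_wpM2l ?(ltW energy_const0) // ler_wpM2r ?hessq_ge0 // ler_wpM2l //.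
    by rewrite mulr_ge0 ?sqr_ge0 // ltW.
  rewrite /am powRE // ler_expR.
  have /andP[p1 p2] := pc x; have c1' := c1.
  have lnb := ln_bound m20 lm lM.
  have : `|(p x - 2) / 2 * ln (dqsq u h x)| <= (C + 2) * lnbound (m / 2) Ml.
    rewrite normrM ler_pM // ler_norml; apply/andP; split; lra.
  by rewrite ler_norml => /andP[].
rewrite -/W.
have : A * integ W <= 2 * B by rewrite /B; lra.
by rewrite -ler_pdivlMl // mulrA [A^-1 * 2]mulrC.
Qed.

(** The point is that [C0] precedes [delta]. The local bound [C3] depends on [delta], but [tau] is
    chosen after it, so that the whole error term contributes at most the summand [1] in
    [C0 * integ eta + 1]. *)
Lemma weighted_hessq_bound (z : X -> R) : C1 z -> supp_in V z -> (forall x, 0 <= z x <= 1) ->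
  exists2 C0 : R, 0 <= C0 & forall delta : R, 0 < delta -> exists2 h1 : R, 0 < h1 &
    forall h (Y : X -> R), 0 < h -> h <= h1 -> Cc Y ->
    (forall x, Y x <= energy_const c beta *
       (z x ^+ 2 * weight beta delta (dqsq u h x) * dqsq u h x `^ ((p x - 2) / 2) * hessq u h x)) ->
    integ Y <= C0.
Proof.
move=> Cz [Kz [cKz KzV zKz]] z01.
have bz : bsupp z by apply: (@supp_in_bsupp _ _ setT); exists Kz.
have [Z Z0 HZ] := grad_norm_bounded Cz bz.
(* [4 * 130] is the constant [520] of [weight_facts]. *)
have G00 : 0 <= 130 :> R by rewrite ler0n.
have [C0 C00 H] := energy_bound G00 Z0.
have [eta [He e0 e1]] := compact_plateau cKz.
have Ie : 0 <= integ eta by exact: integ_ge0.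
exists (C0 * integ eta + 1); first by rewrite addr_ge0 // mulr_ge0.
move=> delta delta0; have d20 : 0 < delta ^+ 2 by rewrite exprn_gt0.
(* Once [dqsq] is within [delta^2 / 8] of [gradsq], it is at least [delta^2 / 8] on [K], and on the
   rest of [Kz] it is below [delta^2 / 2], where the weight vanishes. *)
pose K := Kz `&` [set x | delta ^+ 2 / 4 <= gradsq u x].
have cK : compact K by apply: compact_closedI => //; apply: closed_ge; exact: cont_gradsq.
have KO : K `<=` O.
  move=> x [Kx qx]; split; first exact: KzV.
  by apply: lt_le_trans qx; rewrite divr_gt0.
have [z1 [V1 [Cz1 z101 Sz1 oV1 [KV1 zV1]]]] := cutoff cK open_regular KO.
have [ha [C3 [ha0 C30 H3]]] := hessq_local_bound Cz1 Sz1 z101.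
have bz1 : bsupp z1 by exact: supp_in_bsupp Sz1.
have d80 : 0 < delta ^+ 2 / 8 by rewrite divr_gt0.
have [h2 h20 Hh2] := dqsq_uniform Cu bu d80.
have Km h x : 0 < h -> h <= h2 -> K x -> delta ^+ 2 / 8 <= dqsq u h x.
  move=> h0 hh2 [_ /= qx]; have := Hh2 h x h0 hh2; rewrite ler_norml; lra.
have Kz' h x : 0 < h -> h <= h2 -> ~ K x -> z x != 0 ->
   weight beta delta (dqsq u h x) = 0 /\ dweight beta delta (dqsq u h x) = 0.
  move=> h0 hh2 nK zx; apply: weight_small => //.
  have Kx : Kz x by apply: contrapT => nKx; rewrite zKz ?eqxx in zx.
  have [qx|qx] := leP (delta ^+ 2 / 4) (gradsq u x); first by case: nK.
  have := Hh2 h x h0 hh2; rewrite ler_norml; lra.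
pose T := 2 * C3 + Z ^+ 2 * integ eta.
have T0 : 0 <= T by rewrite /T addr_ge0 // mulr_ge0 ?sqr_ge0.
have tau0 : 0 < (T + 1)^-1 by rewrite invr_gt0 ltr_wpDl.
have adm t : delta ^+ 2 / 8 <= t <= Ml -> admissible_weight beta 130 t (weight beta delta t) (dweight beta delta t).
  move=> /andP[dt _]; have t0 : 0 < t by exact: lt_le_trans dt.
  have [w1 w2 w3 w4] := weight_facts beta0 (ltW beta1) delta0 t0; split=> //.
  have -> : 4 * 130 = 520 :> R by rewrite -natrM.
  by [].
have Dw (t : R) : is_derive t (1:R) (weight beta delta) (dweight beta delta t) by exact: is_derive_weight.
have cw : continuous (dweight beta delta) by exact: cont_dweight.
have [h3 h30 Hh3] := H z _ _ K _ _ _ Cz bz z01 HZ Dw cw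
  cK KO d80 tau0 h20 adm Km Kz'.
exists (Num.min ha h3); first by rewrite lt_min ha0.
move=> h Y h0; rewrite le_min => /andP[hha hh3] HY YE.
pose W x := z1 x ^+ 2 * hessq u h x.
have HW : Cc W.
  apply: Cc_mulr; last exact: cont_hessq.
  split; first by apply: cont_exp; exact: C1_cont.
  by case: bz1 => r' zr; exists r' => x rx; rewrite zr // expr0n.
have W0 x : 0 <= W x by rewrite mulr_ge0 ?sqr_ge0 ?hessq_ge0.
have KW x : K x -> z x ^+ 2 * hessq u h x <= W x.
  move=> Kx; rewrite /W (zV1 _ (KV1 _ Kx)) expr1n ler_wpM2r ?hessq_ge0 //.
  by have /andP[? ?] := z01 x; rewrite expr_le1.
apply: le_trans (Hh3 h Y W eta h0 hh3 HY HW He YE W0 KW e0 (fun x Kx => e1 x Kx.1)) _.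
rewrite lerD2l -[leRHS](mulVf (_ : T + 1 != 0)) ?gt_eqF ?ltr_wpDl // ler_wpM2l ?(ltW tau0) //.
apply: (@le_trans _ _ T); last by rewrite lerDl.
by rewrite /T lerD2r ler_wpM2l //; exact: H3.
Qed.

End SecondOrderBounds.

(** * Crossing the critical set *)

Lemma powR_small (R : realType) (e0 s : R) : 0 < e0 -> 0 < s -> exists2 d : R, 0 < d <= 1 &
  forall t e : R, 0 <= t <= d -> e0 <= e -> t `^ e <= s.
Proof.
move=> e00 s0; exists (Num.min 1 (s `^ e0^-1)).
  by rewrite lt_min ltr01 powR_gt0 //= ge_min lexx.
move=> t e /andP[]; rewrite le_eqVlt => /orP[/eqP <- _ ee|t0].
  by rewrite powR0 ?ltW // gt_eqF // (lt_le_trans e00).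
rewrite le_min => /andP[t1 ts] ee.
apply: (@le_trans _ _ (t `^ e0)).
  rewrite !powRE // ler_expR ler_wnM2r //; exact: ln_le0.
have -> : s = (s `^ e0^-1) `^ e0 by rewrite -powRrM mulVf ?gt_eqF // powRr1 // ltW.
by rewrite ge0_ler_powR ?nnegrE ?powR_ge0 // ltW.
Qed.

Section Removability.
Variables (R : realType) (n : nat).
Local Notation X := 'rV[R]_n.
Implicit Types (x y : X) (h : R).
Variables (p u : X -> R) (c C Lp beta Ml : R) (V : set X).
Hypotheses (cp : continuous p) (c1 : 1 < c) (c2 : c <= 2) (pc : forall x, c <= p x <= C)
  (pL : forall i h x, `|p (x + h *: ebasis R i) - p x| <= Lp * `|h|)
  (Cu : C1 u) (bu : bsupp u) (beta0 : 0 <= beta) (beta1 : 2 * beta < 1) (betac : 2 - c < 2 * beta)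
  (Ml1 : 1 <= Ml) (lamM : forall h x, 0 < h -> dqsq u h x <= Ml) (oV : open V)
  (FV : forall f, C1 f -> supp_in (V `&` [set x | 0 < gradsq u x]) f -> flux (plap_field p u) f = 0).

Let F := plap_field p u.

(** The factor [dqsq] gained here will cancel the [1 / delta^2] from the derivative of the step. *)
Lemma field_dot_bound h x : gradsq u x <= 4 * dqsq u h x -> dqsq u h x <= 4 * gradsq u x -> 0 < dqsq u h x ->
  `|\sum_i F i x * \sum_k dqu u h x k * dqd u h x k i|
    <= expR ((C + 2) * ln 4) * dqsq u h x `^ ((p x - 2) / 2) * dqsq u h x * Num.sqrt (hessq u h x).
Proof.
move=> q1 q2 l0; have q0 : 0 < gradsq u x by lra.
have lam0 := ltW l0.
apply: le_trans (cauchy_schwarz_norm _ _) _.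
set e := (p x - 2) / 2.
have -> : Num.sqrt (\sum_i F i x ^+ 2) = gradsq u x `^ (e + 1 / 2).
  have -> : \sum_i F i x ^+ 2 = (gradsq u x `^ e) ^+ 2 * gradsq u x.
    by rewrite /gradsq mulr_sumr; apply: eq_bigr => i _; rewrite exprMn.
  rewrite sqrtrM ?sqr_ge0 // sqrtr_sqr ger0_norm ?powR_ge0 // powR_add // div1r powR12_sqrt //.
  exact: ltW.
have -> : expR ((C + 2) * ln 4) * dqsq u h x `^ e * dqsq u h x * Num.sqrt (hessq u h x)
  = (expR ((C + 2) * ln 4) * dqsq u h x `^ (e + 1 / 2)) * (Num.sqrt (dqsq u h x) * Num.sqrt (hessq u h x)).
  rewrite powR_add // div1r powR12_sqrt // -[X in _ * X * Num.sqrt (hessq u h x) = _](sqr_sqrtr lam0); ring.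
apply: ler_pM; rewrite ?powR_ge0 ?sqrtr_ge0 //.
  apply: powR_ratio => //; have /andP[p1 p2] := pc x; have c1' := c1.
  by rewrite /e ler_norml; apply/andP; split; lra.
rewrite -sqrtrM //; apply: ler_wsqrtr; exact: (wsum_sq_le (dqu u h x) (dqd u h x)).
Qed.

(** The cut-off [nu] is a function of [dqsq], which is C^1, and not of [gradsq], which is only
    continuous. Removing it leaves [B], where [Df] meets [1 - nu] and the field is small, and [A],
    where [nu] is differentiated and which lives on the shell between [delta^2] and [2 delta^2]. *)
Lemma flux_removable (f : X -> R) : C1 f -> supp_in V f -> flux F f = 0.
Proof.
have near_arith (l q s : R) : 0 < s -> - (s / 2) <= l - q <= s / 2 ->
  [/\ s < l -> q <= 4 * l /\ l <= 4 * q, q < s / 2 -> l <= s & l < 2 * s -> q <= 4 * s].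
  by move=> s0 /andP[? ?]; split=> [?|?|?]; [split| |]; lra.
move=> Cf [K [cK KV fK]].
have bf : bsupp f by apply: (@supp_in_bsupp _ _ setT); exists K.
have [Mf Mf0 HMf] := bsupp_bounded (C1_cont Cf) bf.
have [z [W [Cz z01 Sz oW [KW zW]]]] := cutoff cK oV KV.
have [C0 C00 HC0] := weighted_hessq_bound cp c1 c2 pc pL Cu bu beta0 beta1 Ml1 lamM oV FV Cz Sz z01.
have [eta [He e0 e1]] := compact_plateau cK.
have Ie : 0 <= integ eta by exact: integ_ge0.
have cF i : continuous (F i) := cont_plap_field cp c1 pc Cu (i := i).
pose S := integ (fun x => \sum_i `|partial i f x|).
have HS : Cc (fun x => \sum_i `|partial i f x|).
  by apply: Cc_sum => i; apply: Cc_norm; exact: Cc_partial.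
have S0 : 0 <= S by apply: integ_ge0 => // x; exact: sumr_ge0.
have k0 := energy_const_gt0 c1 beta1.
move: (energy_const c beta) k0 HC0 => kap k0 HC0.
apply: (@eq0_small _ _ (S + (C0 / kap + integ eta))).
  by rewrite addr_ge0 // addr_ge0 // divr_ge0 // ltW.
move=> eps eps0.
(* [16 = 2 * 4 * 2]: on the shell [1 / delta^2 <= 2 / lam], [dstep <= 4], and the gradient of [lam]
   brings another [2]. *)
pose M := 16 * Mf * expR ((C + 2) * ln 4).
have M0 : 0 <= M by rewrite /M !mulr_ge0 ?expR_ge0 // ltW.
have M20 : 0 < M ^+ 2 + 1 by rewrite ltr_wpDl // sqr_ge0.
(* The first entry makes the field small in [B]; the second makes the remainder [M^2 / (4 eps) * sg]
   of Young's inequality at most [eps]. *)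
pose sg := Num.min eps (4 * eps ^+ 2 / (M ^+ 2 + 1)).
have sg0 : 0 < sg by rewrite lt_min eps0 divr_gt0 // mulr_gt0 // exprn_gt0.
have sge : sg <= eps by rewrite ge_min lexx.
have sgM : M ^+ 2 / (4 * eps) * sg <= eps.
  have : sg <= 4 * eps ^+ 2 / (M ^+ 2 + 1) by rewrite ge_min lexx orbT.
  rewrite ler_pdivlMr // => H.
  rewrite mulrAC ler_pdivrMr ?mulr_gt0 //.
  have -> : eps * (4 * eps) = 4 * eps ^+ 2 by ring.
  by apply: le_trans H; rewrite mulrC ler_wpM2l ?(ltW sg0) // lerDl.
have e00 : 0 < (c - 2 + 2 * beta) / 2 by have := betac; lra.
have exb x : (c - 2 + 2 * beta) / 2 <= (p x - 2) / 2 + beta by have /andP[? _] := pc x; lra.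
have exc : (c - 2 + 2 * beta) / 2 <= (c - 1) / 2 by have := beta1; lra.
have [d /andP[d0 d1] Hd] := powR_small e00 sg0.
(* As [d <= 1], this gives [4 delta^2 <= d], which covers [dqsq] on the shell and [gradsq] wherever
   [dqsq < 2 delta^2]. *)
pose delta := d / 4.
have delta0 : 0 < delta by rewrite divr_gt0.
have d20 : 0 < delta ^+ 2 by rewrite exprn_gt0.
have d2d : 4 * delta ^+ 2 <= d.
  have -> : 4 * delta ^+ 2 = d * (d / 4) by rewrite /delta; field.
  by rewrite ler_piMr ?(ltW d0) //; lra.
have [h1 h10 H1] := HC0 delta delta0.
have d220 : 0 < delta ^+ 2 / 2 by rewrite divr_gt0.
have [h2 h20 H2] := dqsq_uniform Cu bu d220.
pose h := Num.min h1 h2.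
have h0 : 0 < h by rewrite lt_min h10.
have hh1 : h <= h1 by rewrite ge_min lexx.
have hh2 : h <= h2 by rewrite ge_min lexx orbT.
pose kk := (delta ^+ 2)^-1.
have kk0 : 0 < kk by rewrite invr_gt0.
have [Cl El] := C1_dqsq Cu h.
have cds : continuous (fun t : R => kk * dstep (kk * t)).
  apply: cont_mul; first exact: cst_continuous.
  apply: cont_comp; last exact: cont_dstep.
  by apply: cont_mul; [exact: cst_continuous|move=> t; exact: cvg_id].
have [Cn En] := C1_comp Cl (is_derive_scaled_step kk) cds.
set nu := (fun x => step (kk * dqsq u h x)) in Cn En.
have kl x : (kk * dqsq u h x <= 1) = (dqsq u h x <= delta ^+ 2).
  by rewrite /kk ler_pdivrMl // mulr1.
have kl2 x : (2 <= kk * dqsq u h x) = (2 * delta ^+ 2 <= dqsq u h x).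
  by rewrite /kk ler_pdivlMl // mulrC.
have near x : [/\ delta ^+ 2 < dqsq u h x -> gradsq u x <= 4 * dqsq u h x /\ dqsq u h x <= 4 * gradsq u x,
    gradsq u x < delta ^+ 2 / 2 -> dqsq u h x <= delta ^+ 2 & dqsq u h x < 2 * delta ^+ 2 -> gradsq u x <= 4 * delta ^+ 2].
  by apply: near_arith => //; rewrite -ler_norml; exact: H2.
have nu01 x : 0 <= nu x <= 1 by have [] := step_facts (kk * dqsq u h x).
have [Cfn Efn] := C1_mul Cf Cn.
have bfn : bsupp (fun x => f x * nu x) by exact: bsupp_mull.
have flux0 : flux F (fun x => f x * nu x) = 0.
  apply: FV => //; exists (K `&` [set x | delta ^+ 2 / 2 <= gradsq u x]); split.
  - by apply: compact_closedI => //; apply: closed_ge; exact: cont_gradsq.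
  - by move=> x [Kx qx]; split; [exact: KV|exact: lt_le_trans qx].
  - move=> x nK; have [Kx|nKx] := pselect (K x); last by rewrite fK ?mul0r.
    have [qx|qx] := leP (delta ^+ 2 / 2) (gradsq u x); first by case: nK.
    have [_ _ _ H _] := step_facts (kk * dqsq u h x).
    have [|n0 _] := H; last by rewrite /nu n0 mulr0.
    by rewrite kl; have [_ nx _] := near x; exact: nx.
pose A x := \sum_i F i x * (f x * partial i nu x).
pose B x := \sum_i F i x * ((1 - nu x) * partial i f x).
have HA : Cc A.
  apply: Cc_sum => i; apply: Cc_mull; last exact: cF.
  by apply: Cc_mulr; [exact: Cc_C1|exact: C1_partial_cont].
have HB : Cc B.
  apply: Cc_sum => i; apply: Cc_mull; last exact: cF.
  apply: Cc_mull; first exact: Cc_partial.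
  by apply: cont_sub; [exact: cst_continuous|exact: C1_cont].
have BE x : `|B x| <= eps * \sum_i `|partial i f x|.
  have [lx|lx] := leP (2 * delta ^+ 2) (dqsq u h x).
    have [_ _ _ _ H] := step_facts (kk * dqsq u h x).
    have [|n1 _] := H; first by rewrite kl2.
    rewrite /B big1 ?normr0 ?mulr_ge0 ?(ltW eps0) ?sumr_ge0 // => i _.
    by rewrite /nu n1 subrr mul0r mulr0.
  rewrite mulr_sumr (le_trans (ler_norm_sum _ _ _)) //; apply: ler_sum => i _.
  have qd : gradsq u x <= d by have [_ _ nx] := near x; exact: le_trans (nx lx) d2d.
  have q1 : gradsq u x <= 1 by exact: le_trans d1.
  have Fs : `|F i x| <= eps.
    apply: le_trans (plap_field_small pc i q1) _; apply: le_trans sge.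
    by apply: Hd => //; rewrite gradsq_ge0.
  have /andP[nx0 nx1] := nu01 x.
  have n1 : `|1 - nu x| <= 1 by rewrite ger0_norm ?subr_ge0 // gerBl.
  by rewrite normrM; apply: ler_pM => //; rewrite normrM ler_piMl.
have AE x : `|A x| <= eps * (z x ^+ 2 * weight beta delta (dqsq u h x) * dqsq u h x `^ ((p x - 2) / 2) * hessq u h x)
    + eps * eta x.
  have rhs0 : 0 <= weight beta delta (dqsq u h x) ->
    0 <= eps * (z x ^+ 2 * weight beta delta (dqsq u h x) * dqsq u h x `^ ((p x - 2) / 2) * hessq u h x) + eps * eta x.
    move=> w0; rewrite addr_ge0 // mulr_ge0 ?(ltW eps0) // mulr_ge0 ?hessq_ge0 // mulr_ge0 ?powR_ge0 //.
    by rewrite mulr_ge0 ?sqr_ge0.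
  have w0 : 0 <= weight beta delta (dqsq u h x).
    rewrite /weight mulr_ge0 ?powR_ge0 //.
    by have [/andP[]] := step_facts (2 / delta ^+ 2 * dqsq u h x).
  have [Kx|nKx] := pselect (K x); last first.
    rewrite /A big1 ?normr0 ?rhs0 // => i _; by rewrite fK // mul0r mulr0.
  have [/andP[s0 s1] /andP[ds0 ds4] _ Ha Hb] := step_facts (kk * dqsq u h x).
  have AE1 : A x = f x * (kk * dstep (kk * dqsq u h x) * 2) * \sum_i F i x * \sum_k dqu u h x k * dqd u h x k i.
    rewrite /A mulr_sumr; apply: eq_bigr => i _; rewrite En El; ring.
  have [l1|l1] := leP (dqsq u h x) (delta ^+ 2).
    have [|_ dd] := Ha; first by rewrite kl.
    by rewrite AE1 dd !(mulr0, mul0r) normr0 rhs0.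
  have [l2|l2] := leP (2 * delta ^+ 2) (dqsq u h x).
    have [|_ dd] := Hb; first by rewrite kl2.
    by rewrite AE1 dd !(mulr0, mul0r) normr0 rhs0.
  set lam := dqsq u h x in l1 l2 w0 rhs0 AE1 ds0 ds4 *.
  have lam0 : 0 < lam by exact: lt_trans l1.
  set a := lam `^ ((p x - 2) / 2); set D2 := hessq u h x.
  have D20 : 0 <= D2 by exact: hessq_ge0.
  have Ab : `|A x| <= M * a * Num.sqrt D2.
    have [nx _ _] := near x; have [q1 q2] := nx l1.
    have FD := field_dot_bound q1 q2 lam0; rewrite -/lam -/a -/D2 in FD.
    rewrite AE1 normrM.
    have kb : `|f x * (kk * dstep (kk * lam) * 2)| <= Mf * (2 / lam * 4 * 2).
      have k1 : kk <= 2 / lam.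
        by rewrite /kk -[_^-1]mul1r ler_pdivrMr // mulrAC ler_pdivlMr // mul1r ltW.
      have kd0 : 0 <= kk * dstep (kk * lam) * 2 by rewrite mulr_ge0 // mulr_ge0 // ltW.
      rewrite normrM (ger0_norm kd0); apply: ler_pM => //.
      by apply: ler_wpM2r => //; apply: ler_pM => //; exact: ltW.
    apply: le_trans (ler_pM _ _ kb FD) _ => //.
    rewrite le_eqVlt; apply/orP; left; apply/eqP; rewrite /M.
    move: (expR _) (a) (Num.sqrt _) => a1 a2 a3; field; by rewrite gt_eqF.
  apply: le_trans Ab _.
  have zx : z x = 1 by apply: zW; exact: KW.
  rewrite zx expr1n mul1r (weight_large _ delta0 (ltW l1)).
  set gb := lam `^ (- beta).
  have gb0 : 0 < gb by exact: powR_gt0.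
  have a0 : 0 < a by exact: powR_gt0.
  (* The exponent [(p - 2) / 2 + beta] of this ratio is bounded below by a positive number because
     [2 - c < 2 beta]. *)
  have agb : a / gb <= sg.
    have -> : a / gb = lam `^ ((p x - 2) / 2 + beta) by rewrite /a /gb powR_add // powRN invrK.
    apply: Hd => //; rewrite (ltW lam0) /= (le_trans (ltW l2)) // (le_trans _ d2d) // ler_wpM2r ?(ltW d20) //.
    by rewrite ler_nat.
  have n1 : 0 <= 2 * eps * (gb * a * D2) by rewrite !mulr_ge0 // ltW.
  have n2 : 0 <= M ^+ 2 / (2 * eps) * (a / gb).
    by rewrite mulr_ge0 ?divr_ge0 ?sqr_ge0 ?mulr_ge0 // ltW.
  have Y2 : (M * a * Num.sqrt D2) ^+ 2 <= 2 * eps * (gb * a * D2) * (M ^+ 2 / (2 * eps) * (a / gb)).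
    rewrite le_eqVlt; apply/orP; left; apply/eqP.
    rewrite exprMn sqr_sqrtr //; field; by rewrite !gt_eqF.
  have := young n1 n2 Y2.
  have y0 : 0 <= M * a * Num.sqrt D2 by rewrite mulr_ge0 ?sqrtr_ge0 // mulr_ge0 // ltW.
  rewrite (ger0_norm y0).
  have -> : M ^+ 2 / (2 * eps) * (a / gb) = 2 * (M ^+ 2 / (4 * eps) * (a / gb)).
    by field; rewrite !gt_eqF.
  have s1' : M ^+ 2 / (4 * eps) * (a / gb) <= M ^+ 2 / (4 * eps) * sg.
    by rewrite ler_wpM2l // divr_ge0 ?sqr_ge0 // mulr_ge0 // ltW.
  have s2' : eps <= eps * eta x by rewrite ler_peMr ?(ltW eps0) //; exact: e1.
  have -> : 2 * eps * (gb * a * D2) = 2 * (eps * (gb * a * D2)) by ring.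
  rewrite -mulrDr ler_pM2l // => /le_trans -> //; rewrite lerD2l.
  exact: le_trans (le_trans s1' sgM) s2'.
have HAn := Cc_norm HA.
have IA : integ (fun x => `|A x|) <= eps * (C0 / kap + integ eta).
  (* By [AE] this continuous function lies below the weighted energy density, so it can play the
     role of [Y] in the bound uniform in [delta]. *)
  have HY : Cc (fun x => kap / eps * (`|A x| - eps * eta x)).
    by apply: Cc_scale; apply: Cc_sub => //; exact: Cc_scale.
  have := H1 h _ h0 hh1 HY; rewrite integ_scale; last by apply: Cc_sub => //; exact: Cc_scale.
  rewrite integ_sub //; last exact: Cc_scale.
  rewrite integ_scale // => H.
  have {}H : kap / eps * (integ (fun x => `|A x|) - eps * integ eta) <= C0.
    apply: H => x.
    set T := z x ^+ 2 * _ * _ * _.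
    have -> : kap * T = kap / eps * (eps * T) by field; rewrite gt_eqF.
    have ke : 0 <= kap / eps by rewrite divr_ge0 // ltW.
    by apply: (ler_wpM2l ke); rewrite lerBlDr; exact: AE.
  rewrite mulrDr -lerBlDr.
  have -> : eps * (C0 / kap) = C0 / (kap / eps) by rewrite (invf_div kap eps) mulrCA.
  by rewrite ler_pdivlMr ?divr_gt0 // mulrC.
have IB : integ (fun x => `|B x|) <= eps * S.
  by rewrite -integ_scale //; apply: integ_le => //; [exact: Cc_norm|exact: Cc_scale].
have -> : flux F f = integ B - integ A.
  have HG := Cc_flux cF Cfn bfn.
  have -> : integ B - integ A = integ (fun x => B x + \sum_i F i x * partial i (fun x => f x * nu x) x - A x).
    rewrite integ_sub //; last exact: Cc_add.
    by rewrite integ_add // -/(flux F (fun x => f x * nu x)) flux0 addr0.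
  rewrite /flux; congr integ; apply/funext => x.
  rewrite /A /B -big_split -sumrB; apply: eq_bigr => i _ /=; rewrite Efn; ring.
rewrite mulrDr; apply: le_trans (ler_normB _ _) (lerD _ _).
  by apply: le_trans IB; apply: integ_norm_le => //; exact: Cc_norm.
by apply: le_trans IA; apply: integ_norm_le.
Qed.

End Removability.

(** * The theorem *)

Section Globalization.
Variables (R : realType) (n : nat).
Local Notation X := 'rV[R]_n.
Implicit Types (x y : X).

(** Extension by zero: outside [U] the values of [v] are arbitrary, but every such point has a
    neighbourhood that misses the compact set carrying [chi]. *)
Lemma C1_cutoff (U : set X) (chi v : X -> R) : open U -> C1 chi -> supp_in U chi -> C1_on v U ->
  C1 (fun x => chi x * v x) /\
  forall i, partial i (fun x => chi x * v x) = (fun x => partial i chi x * v x + chi x * partial i v x).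
Proof.
move=> oU Cc [K [cK KU chi0]] Cv.
have clK := compact_closed_rV cK.
have off x : ~ U x -> \forall y \near x, ~ K y.
  move=> nU; apply: open_nbhs_nbhs; split; first exact: closed_openC.
  by move=> /KU.
have pchi0 i x : ~ K x -> partial i chi x = 0 by move=> nK; exact: (partial_supp_in0 i clK chi0).
have cont0 (f : X -> R) x : ~ U x -> (forall y, ~ K y -> f y = 0) -> {for x, continuous f}.
  move=> nU f0; have [d d0 Hd] := near_norm_ex (off x nU).
  apply: eps_delta_continuous => e e0; exists d => // y /Hd nK.
  have Kx : ~ K x by move=> /KU.
  by rewrite !f0 // subrr normr0 ltW.
have cmul (f g : X -> R) x : {for x, continuous f} -> {for x, continuous g} ->
  {for x, continuous (fun y => f y * g y)} by move=> ? ?; exact: continuousM.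
have cadd (f g : X -> R) x : {for x, continuous f} -> {for x, continuous g} ->
  {for x, continuous (fun y => f y + g y)} by move=> ? ?; exact: continuousD.
apply: C1_of => [x|i x|i x].
- have [Ux|nU] := pselect (U x); last by apply: cont0 => // y nK; rewrite chi0 ?mul0r.
  by apply: (cmul chi v x); [exact: C1_cont|exact: (C1_on_cont oU Cv)].
- have [Ux|nU] := pselect (U x).
    have Dv : is_derive x (ebasis R i) v (partial i v x) by apply: DeriveDef => //; exact: (Cv i).1.
    rewrite addrC [_ * v x]mulrC; exact: (is_deriveM (C1_is_derive i x Cc) Dv).
  have Kx : ~ K x by move=> /KU.
  rewrite pchi0 // chi0 // !mul0r addr0.
  apply: (@near_eq_is_derive _ _ _ (fun=> 0)).
  by apply: filterS (off x nU) => y nK; rewrite chi0 ?mul0r.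
- have [Ux|nU] := pselect (U x); last first.
    by apply: cont0 => // y nK; rewrite pchi0 // chi0 // !mul0r addr0.
  apply: (cadd (fun y => partial i chi y * v y) (fun y => chi y * partial i v y) x).
    by apply: (cmul (partial i chi) v x); [exact: C1_partial_cont|exact: (C1_on_cont oU Cv)].
  by apply: (cmul chi (partial i v) x); [exact: C1_cont|exact: (Cv i).2].
Qed.

Lemma partial_locally1 (chi : X -> R) (W : set X) i x : C1 chi -> open W -> (forall y, W y -> chi y = 1) -> W x ->
  partial i chi x = 0.
Proof.
move=> Cc oW W1 Wx; have [C1c C1E] := C1_cst n (1 : R); have [_ E] := C1_sub Cc C1c.
have <- : partial i (fun y => chi y - 1) x = partial i chi x by rewrite E C1E subr0.
apply: partial_near0; have H : \forall y \near x, W y by exact: open_nbhs_nbhs.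
by apply: filterS H => y /W1 ->; rewrite subrr.
Qed.

Lemma enorm_grad_powR (v : X -> R) (e : R) x : enorm (grad v x) `^ e = gradsq v x `^ (e / 2).
Proof.
have -> : enorm (grad v x) = gradsq v x `^ 2^-1.
  rewrite powR12_sqrt ?gradsq_ge0 // /enorm /dotRn; congr Num.sqrt.
  by apply: eq_bigr => i _; rewrite mxE expr2.
by rewrite -powRrM mulrC.
Qed.

Lemma powR_le_bound (a b M C : R) : 0 <= a -> a <= M -> 1 <= M -> 0 <= b -> b <= C -> a `^ b <= M `^ C.
Proof.
move=> a0 aM M1 b0 bC; apply: (@le_trans _ _ (M `^ b)); last exact: ler_powR.
by apply: ge0_ler_powR; rewrite ?nnegrE // (le_trans a0).
Qed.

End Globalization.

Section WeakForm.
Variables (R : realType) (n : nat).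
Local Notation X := 'rV[R]_n.
Implicit Types (x y : X).
Variables (Omega : set X) (p u : X -> R) (c C : R).
Hypotheses (oO : open Omega) (Cp : C1_on p setT) (Cu : C1_on u Omega)
  (c1 : 1 < c) (cp : forall x, Omega x -> c <= p x) (pC : forall x, Omega x -> p x <= C).

Lemma weak_sobolev (K : set X) : compact K -> K `<=` Omega ->
  (intRn_on K (fun x => (`|u x| `^ (p x) + enorm (grad u x) `^ (p x))%:E) < +oo)%E.
Proof.
move=> cK KO.
have [chi [W [Cchi c01 Sc oW [KW W1]]]] := cutoff cK oO KO.
have bc := supp_in_bsupp Sc.
have [Cv Ev] := C1_cutoff oO Cchi Sc Cu.
have bv : bsupp (fun x => chi x * u x) by exact: bsupp_mull.
have [M M0 HM] := bsupp_bounded (C1_cont Cv) bv.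
have [L L0 HL] := grad_norm_bounded Cv bv.
have [pl [Hp p0 p1]] := compact_plateau cK.
(* [B >= 1] makes [B^t] nondecreasing in [t], so the variable exponent may be replaced by its upper
   bound [C]. *)
pose B := M + L + 1.
have B1 : 1 <= B by rewrite /B lerDr addr_ge0 // ltW.
pose eta x : R := 2 * B `^ C * pl x.
have He : Cc eta by exact: Cc_scale.
have [|x|_] := @intRn_le R n (fun x => if x \in K then (`|u x| `^ (p x) + enorm (grad u x) `^ (p x))%:E else 0%E)
   (fun x => (eta x)%:E).
- by move=> x; case: ifP => // _; rewrite lee_fin addr_ge0 // powR_ge0.
- case: ifPn => [|_]; last first.
    by rewrite lee_fin mulr_ge0 // mulr_ge0 // powR_ge0.
  rewrite inE => Kx; rewrite lee_fin.
  have px0 : 0 <= p x by apply: le_trans (cp (KO x Kx)); have := c1; lra.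
  have chi1 : chi x = 1 by apply: W1; exact: KW.
  have u1 : `|u x| `^ (p x) <= B `^ C.
    apply: powR_le_bound => //; last exact: (pC (KO x Kx)).
    by have := HM x; rewrite chi1 mul1r /B; have := L0; lra.
  have u2 : enorm (grad u x) `^ (p x) <= B `^ C.
    apply: powR_le_bound; rewrite ?sqrtr_ge0 //; last exact: (pC (KO x Kx)).
    apply: (@le_trans _ _ L); last by rewrite /B; have := M0; lra.
    apply: le_trans (HL x); rewrite le_eqVlt; apply/orP; left; apply/eqP; congr Num.sqrt.
    apply: eq_bigr => i _; rewrite !mxE Ev (partial_locally1 i Cchi oW W1 (KW x Kx)) chi1.
    by rewrite mul0r add0r mul1r expr2.
  rewrite /eta; apply: le_trans (lerD u1 u2) _.
  have -> : B `^ C + B `^ C = 2 * B `^ C by ring.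
  by rewrite ler_peMr ?p1 // mulr_ge0 // powR_ge0.
- by move=> H; apply: le_lt_trans H _; rewrite intRn_Cc // ltry.
Qed.

(** The estimates ask for global data, while the bounds on [p] and the regularity of [u] are given
    on [Omega]. Both functions are therefore modified away from [W], a neighbourhood of the support
    of [phi], which does not affect the pairing with [phi]. *)
Lemma weak_removable (phi : X -> R) : test_fun Omega phi ->
  (forall psi, test_fun (Omega `\` [set x | u x = 0]) psi ->
     intRn_on (Omega `\` [set x | u x = 0]) (fun x => (enorm (grad u x) `^ (p x - 2) * dotRn (grad u x) (grad psi x))%:E) = 0%E) ->
  intRn_on Omega (fun x => (enorm (grad u x) `^ (p x - 2) * dotRn (grad u x) (grad phi x))%:E) = 0%E.
Proof.
move=> [sphi [cphi phiO]] Hw.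
have [chi [W [Cchi c01 Sc oW [KW W1]]]] := cutoff cphi oO phiO.
have bc := supp_in_bsupp Sc.
have WO : W `<=` Omega.
  move=> x Wx; case: (Sc) => K [_ KO chi0]; apply: contrapT => nO.
  have : chi x = 0 by apply: chi0 => /KO.
  by rewrite W1 // => /eqP; rewrite oner_eq0.
have [Cv Ev] := C1_cutoff oO Cchi Sc Cu.
pose v x := chi x * u x.
have bv : bsupp v by exact: bsupp_mull.
have CpO : C1_on p Omega by move=> i; split=> x _; [exact: (Cp i).1|exact: (Cp i).2].
have [Cq Eq] := C1_cutoff oO Cchi Sc CpO.
have [C2 E2] := C1_scale 2 Cchi.
have [Cd Ed] := C1_sub Cq C2.
(* The convex combination of [p] and the constant [2] with weight [chi]: it inherits bounds
   everywhere, and since [q - 2] is C^1 of bounded support, its increments along the axes are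
   Lipschitz. *)
pose q x := chi x * p x - 2 * chi x + 2.
have bd : bsupp (fun x => chi x * p x - 2 * chi x).
  by case: bc => s s0; exists s => x sx; rewrite s0 // mul0r mulr0 subrr.
have cq : continuous q by apply: cont_add; [exact: C1_cont|exact: cst_continuous].
(* The interval is widened to contain the exponent [2]. Moreover [c' <= 2] keeps the ellipticity
   constant [c' - 1] at most [1] and [beta = (3 - c') / 4] positive. *)
pose c' := Num.min c 2; pose C' := Num.max C 2.
have c'1 : 1 < c' by rewrite lt_min c1 /=; lra.
have c'2 : c' <= 2 by rewrite ge_min lexx orbT.
have qc x : c' <= q x <= C'.
  have /andP[x0 x1] := c01 x.
  have [Ox|nO] := pselect (Omega x); last first.
    have -> : q x = 2 by case: Sc => K [_ KO chi0]; rewrite /q chi0 ?mul0r ?mulr0 ?subrr ?add0r // => /KO.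
    by rewrite c'2 le_max lexx orbT.
  have a1 : c' <= p x by apply: le_trans (cp Ox); rewrite ge_min lexx.
  have a2 : p x <= C' by apply: le_trans (pC Ox) _; rewrite le_max lexx.
  have a3 : 2 <= C' by rewrite le_max lexx orbT.
  have -> : q x = chi x * p x + (1 - chi x) * 2 by rewrite /q; ring.
  move: (p x) (chi x) x0 x1 a1 a2 => t s s0 s1 a1 a2.
  have s1' : 0 <= 1 - s by rewrite subr_ge0.
  have b1 : s * c' <= s * t by rewrite ler_wpM2l.
  have b2 : (1 - s) * c' <= (1 - s) * 2 by rewrite ler_wpM2l.
  have b3 : s * t <= s * C' by rewrite ler_wpM2l.
  have b4 : (1 - s) * 2 <= (1 - s) * C' by rewrite ler_wpM2l.
  have e1 : s * c' + (1 - s) * c' = c' by ring.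
  have e2 : s * C' + (1 - s) * C' = C' by ring.
  by apply/andP; split; [rewrite -[leLHS]e1|rewrite -[leRHS]e2]; exact: lerD.
have [Lp Lp0 HLp] := partial_bounded Cd bd.
have qL i h x : `|q (x + h *: ebasis R i) - q x| <= Lp * `|h|.
  have [->|h0] := eqVneq h 0; first by rewrite scale0r addr0 subrr !normr0 mulr0.
  have [y _] := dq_mvt i x Cd h0; rewrite /dq => E.
  have -> : q (x + h *: ebasis R i) - q x = partial i (fun x => chi x * p x - 2 * chi x) y * h.
    by rewrite -E mulrC mulVKf // /q; ring.
  by rewrite normrM ler_wpM2r.
have [L L0 [_ HL]] := dqu_bounded Cv bv.
pose Ml := n%:R * L ^+ 2 + 1 : R.
have Ml1 : 1 <= Ml by rewrite /Ml lerDr mulr_ge0 // sqr_ge0.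
have lamM h x : 0 < h -> dqsq v h x <= Ml.
  move=> h0; apply: (@le_trans _ _ (n%:R * L ^+ 2)); last by rewrite /Ml lerDl.
  rewrite -sum_ord_const.
  by apply: ler_sum => j _; rewrite -real_normK ?num_real // ler_pXn2r ?nnegrE ?(ltW L0) // HL ?gt_eqF.
pose F := plap_field q v.
have cF i : continuous (F i) := cont_plap_field cq c'1 qc Cv (i := i).
have pv i x : W x -> partial i v x = partial i u x.
  move=> Wx; rewrite /v Ev (partial_locally1 i Cchi oW W1 Wx) W1 // mul0r add0r mul1r //.
(* Used twice: on [Omega] for [phi], and off the zero set for the test functions of the hypothesis.
   Outside its support [psi] has zero gradient, and on it the original and the modified data
   coincide. *)
have weak_form (U : set X) (psi : X -> R) : U `<=` Omega -> smooth psi -> compact (Defs.support psi) ->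
    Defs.support psi `<=` U -> Defs.support psi `<=` W ->
    intRn_on U (fun x => (enorm (grad u x) `^ (p x - 2) * dotRn (grad u x) (grad psi x))%:E) = (flux F psi)%:E.
  move=> UO spsi cpsi psiU psiW.
  have psi0 x : ~ Defs.support psi x -> psi x = 0.
    by move=> nS; apply: contrapT => /eqP ne; apply: nS; exact: subset_closure.
  have Cpsi := smooth_C1 spsi.
  have bpsi : bsupp psi by apply: (@supp_in_bsupp _ _ setT); exists (Defs.support psi).
  rewrite -intRn_Cc; last exact: Cc_flux.
  congr intRn; apply/funext => x.
  have [Sx|nS] := pselect (Defs.support psi x); last first.
    have p0 i : partial i psi x = 0 by exact: (partial_supp_in0 i (compact_closed_rV cpsi) psi0).
    rewrite [X in _ = X%:E]big1; last by move=> i _; rewrite p0 mulr0.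
    case: ifP => // _; congr EFin; rewrite /dotRn big1 ?mulr0 // => i _.
    by rewrite !mxE p0 mulr0.
  have Wx := psiW x Sx; have Ux : x \in U by rewrite inE; exact: psiU.
  rewrite Ux; congr EFin; rewrite enorm_grad_powR /dotRn mulr_sumr; apply: eq_bigr => i _.
  have gE (w : X -> R) : grad w x 0 i = partial i w x by rewrite mxE.
  have E1 : gradsq v x = gradsq u x by apply: eq_bigr => j _; rewrite (pv j x Wx).
  have E2' : q x = p x by rewrite /q (W1 x Wx) mul1r mulr1 subrK.
  have FE : F i x = gradsq u x `^ ((p x - 2) / 2) * partial i u x.
    by rewrite /F /plap_field E1 E2' (pv i x Wx).
  by rewrite FE (gE u) (gE psi) mulrA.
have phiE := weak_form _ phi (fun x Ox => Ox) sphi cphi phiO KW.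
rewrite phiE; congr EFin.
(* This [beta] puts [2 beta] at the midpoint of the interval from [2 - c'] to [1]. *)
have beta0 : 0 <= (3 - c') / 4 by lra.
have beta1 : 2 * ((3 - c') / 4) < 1 by lra.
have betac : 2 - c' < 2 * ((3 - c') / 4) by lra.
have oWv : open (W `&` [set x | v x != 0]).
  apply: openI => //; have -> : [set x | v x != 0] = [set x | 0 < v x ^+ 2].
    by apply/seteqP; split=> x /=; rewrite lt0r sqrf_eq0 sqr_ge0 andbT.
  by apply: open_gt; exact: cont_exp (C1_cont Cv).
apply: (flux_removable cq c'1 c'2 qc qL Cv bv beta0 beta1 betac Ml1 lamM oW).
- move=> f Cf Sf; apply: (flux_regular cF Cv bv oW _ Cf Sf) => {Cf Sf}f Cf Sf.
  apply: (flux_C1 oWv cF _ Cf Sf) => psi [spsi [cpsi psiS]].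
  have UO : Omega `\` [set x | u x = 0] `<=` Omega by move=> x [].
  have psiU : Defs.support psi `<=` Omega `\` [set x | u x = 0].
    move=> x /psiS[Wx /= vx]; split; first exact: WO.
    by move=> /= u0; rewrite /v u0 mulr0 eqxx in vx.
  have psiW : Defs.support psi `<=` W by move=> x /psiS[].
  have := weak_form _ psi UO spsi cpsi psiU psiW.
  by rewrite Hw => [[<-]|]; last by split.
- exact: smooth_C1.
- exists (Defs.support phi); split=> // x nS; apply: contrapT => /eqP ne; apply: nS; exact: subset_closure.
Qed.

End WeakForm.

Unset Implicit Arguments.

Theorem theorem7p1 (R : realType) (n : nat) (Omega : set 'rV[R]_n)
  (p : 'rV[R]_n -> R) (u : 'rV[R]_n -> R) :
  open Omega -> bounded_set Omega ->
  C1_on p [set: 'rV[R]_n] ->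
  (forall x, 1 <= p x) ->
  (exists c : R, 1 < c /\ forall x, Omega x -> c <= p x) ->
  (exists C : R, forall x, Omega x -> p x <= C) ->
  C1_on u Omega ->
  weak_solution p u (Omega `\` [set x | u x = 0]) ->
  weak_solution p u Omega.
Proof.
move=> oO _ Cp _ [c [c1 cp]] [C pC] Cu [_ Hw]; split.
- by move=> K cK KO; exact: (weak_sobolev oO Cu c1 cp pC cK KO).
- by move=> phi tphi; exact: (weak_removable oO Cp Cu c1 cp pC tphi Hw).
Qed.
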